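(* Let $\Omega$ be a domain of $\mathbb{R}^2$, let $\mathscr{A}^{hk}(x)=\{a^{hk}_{ij}(x)\}$ ($1\le i,j\le m$, $1\le h,k\le2$) be $m\times m$ matrices with complex valued $L^\infty(\Omega)$ entries, and let $\varphi$ satisfy conditions (i)-(vi) of the context. If the operator $A=\partial_h(\mathscr{A}^{hk}(x)\partial_k)$ is $L^\Phi$-dissipative, then $$\operatorname{Re}\Big(\langle(\mathscr{A}^{hk}(x)\xi_h\xi_k)\eta,\eta\rangle-\Lambda_\infty^2\langle(\mathscr{A}^{hk}(x)\xi_h\xi_k)\omega,\omega\rangle(\operatorname{Re}\langle\eta,\omega\rangle)^2+\Lambda_\infty\big(\langle(\mathscr{A}^{hk}(x)\xi_h\xi_k)\omega,\eta\rangle-\langle(\mathscr{A}^{hk}(x)\xi_h\xi_k)\eta,\omega\rangle\big)\operatorname{Re}\langle\eta,\omega\rangle\Big)\ge0$$ for almost every $x\in\Omega$ and for any $\xi\in\mathbb{R}^2$, $\eta,\omega\in\mathbb{C}^m$, $|\omega|=1$.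
   Context: Conditions on $\varphi:(0,+\infty)\to(0,+\infty)$: (i) $\varphi\in C^1((0,+\infty))$; (ii) $(s\varphi(s))'>0$ for all $s>0$; (iii) the range of the strictly increasing function $s\varphi(s)$ is $(0,+\infty)$; (iv) there exist constants $C_1,C_2>0$, $r>-1$ and $s_0>0$ such that $C_1s^r\le(s\varphi(s))'\le C_2s^r$ for $s\in(0,s_0)$; if $r=0$ one requires moreover that the finite limit $\lim_{s\to0^+}\varphi(s)$ exists and is $>0$, and $\lim_{s\to0^+}s\varphi'(s)=0$; (v) there exists $s_1>s_0$ such that either $\varphi'(s)\ge0$ for all $s\ge s_1$ or $\varphi'(s)\le0$ for all $s\ge s_1$; (vi) the function $|s\varphi'(s)/\varphi(s)|$ is non-decreasing on $(0,+\infty)$. The function $s\mapsto s\sqrt{\varphi(s)}$ is a strictly increasing bijection of $(0,+\infty)$; $\Lambda:(0,+\infty)\to\mathbb{R}$ is defined by $\Lambda(s\sqrt{\varphi(s)})=-\frac{s\varphi'(s)}{s\varphi'(s)+2\varphi(s)}$ for $s>0$. Under (vi), $\Lambda$ is monotone and bounded, and $\Lambda_\infty:=\lim_{t\to+\infty}\Lambda(t)$ exists and is finite. $\Phi(s)=\int_0^s\sigma\varphi(\sigma)d\sigma$ is only used in the name ''$L^\Phi$-dissipative''. Summation over repeated indices is understood; $\langle\cdot,\cdot\rangle$ is the standard Hermitian inner product of $\mathbb{C}^m$. $\mathring{H}^1(\Omega)$ is the closure of the complex valued $C_c^\infty(\Omega)$ in the $H^1$ norm. $A$ is $L^\Phi$-dissipative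 if $\operatorname{Re}\int_\Omega\langle\mathscr{A}^{hk}\partial_ku,\partial_h(\varphi(|u|)u)\rangle dx\ge0$ for any $u\in[\mathring{H}^1(\Omega)]^m$ such that $\varphi(|u|)u\in[\mathring{H}^1(\Omega)]^m$ (with $\varphi(|u|)u:=0$ where $u=0$). *)

(* Defs.v *)
From HB Require Import structures.
From mathcomp Require Import all_boot all_order all_algebra.
From mathcomp Require Import all_classical all_reals all_analysis.
From mathcomp Require Import complex.

Set Implicit Arguments.
Unset Strict Implicit.
Unset Printing Implicit Defensive.

Import Order.TTheory GRing.Theory Num.Theory.
Import numFieldNormedType.Exports.

Local Open Scope classical_set_scope.
Local Open Scope complex_scope.
Local Open Scope ring_scope.

(* The plane is R * R; measurableTypeR R is R carrying the Borel sigma-algebra on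
   which lebesgue_measure is defined, with the usual topology and norm. *)
Notation plane R := (measurableTypeR R * measurableTypeR R)%type.

Section Plane.
Context {R : realType}.

Definition leb2 : {measure set (plane R) -> \bar R} :=
  (@lebesgue_measure R \x @lebesgue_measure R)%E.

Definition basis2 (h : 'I_2) : plane R := if h == ord0 then (1, 0) else (0, 1).

Definition domain2 (Omega : set (plane R)) : Prop :=
  [/\ Omega !=set0, open Omega & connected Omega].

Fixpoint C_k (k : nat) (f : plane R -> R) : Prop :=
  match k with
  | 0%N => continuous f
  | k'.+1 => continuous f /\
      forall h : 'I_2, (forall x, derivable f x (basis2 h)) /\
                       C_k k' (fun x => 'D_(basis2 h) f x)
  end.

Definition cre (f : plane R -> R[i]) : plane R -> R := fun x => complex.Re (f x).
Definition cim (f : plane R -> R[i]) : plane R -> R := fun x => complex.Im (f x).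

(* Functions on an open set Omega are represented by total functions whose
   values outside Omega are ignored, except for test functions, which are
   extended by 0. *)
Definition Cc_infty (Omega : set (plane R)) (f : plane R -> R[i]) : Prop :=
  [/\ forall k, C_k k (cre f), forall k, C_k k (cim f),
      compact (closure [set x | f x != 0]) &
      closure [set x | f x != 0] `<=` Omega].

Definition cpartial (h : 'I_2) (f : plane R -> R[i]) (x : plane R) : R[i] :=
  ('D_(basis2 h) (cre f) x) +i* ('D_(basis2 h) (cim f) x).

Definition cintegral (Omega : set (plane R)) (f : plane R -> R[i]) : R[i] :=
  (\int[leb2]_(x in Omega) cre f x) +i* (\int[leb2]_(x in Omega) cim f x).

Definition LpNorm (Omega : set (plane R)) (p : \bar R) (f : plane R -> R[i]) :
    \bar R :=
  ('N[leb2]_p[ (fun x => (Normc.normc (f x))%:E) \_ Omega ])%E.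

Definition in_Lp (Omega : set (plane R)) (p : \bar R) (f : plane R -> R[i]) : Prop :=
  [/\ measurable_fun Omega (cre f), measurable_fun Omega (cim f) &
      (LpNorm Omega p f < +oo)%E].

Definition weak_gradient (Omega : set (plane R)) (f : plane R -> R[i])
    (Df : 'I_2 -> plane R -> R[i]) : Prop :=
  forall (h : 'I_2) (psi : plane R -> R[i]), Cc_infty Omega psi ->
    cintegral Omega (fun x => f x * cpartial h psi x) =
    - cintegral Omega (fun x => Df h x * psi x).

(* f is in H^1(Omega), with weak gradient Df. *)
Definition H1 (Omega : set (plane R)) (f : plane R -> R[i])
    (Df : 'I_2 -> plane R -> R[i]) : Prop :=
  [/\ in_Lp Omega 2%:E f, forall h, in_Lp Omega 2%:E (Df h) &
      weak_gradient Omega f Df].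

Definition H1norm (Omega : set (plane R)) (f : plane R -> R[i])
    (Df : 'I_2 -> plane R -> R[i]) : \bar R :=
  ((LpNorm Omega 2%:E f ^+ 2 + \sum_(h < 2) LpNorm Omega 2%:E (Df h) ^+ 2)
    `^ (2^-1))%E.

(* f is in the H^1-closure of C_c^oo(Omega), with weak gradient Df. *)
Definition H1_0 (Omega : set (plane R)) (f : plane R -> R[i])
    (Df : 'I_2 -> plane R -> R[i]) : Prop :=
  H1 Omega f Df /\
  forall eps : R, 0 < eps -> exists psi : plane R -> R[i],
    Cc_infty Omega psi /\
    (H1norm Omega (fun x => f x - psi x)%R
       (fun h x => Df h x - cpartial h psi x)%R < eps%:E)%E.

End Plane.

Section Vectors.
Context {R : realType} {m : nat}.

(* Linear in the first argument, antilinear in the second. *)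
Definition herm (u v : 'cV[R[i]]_m) : R[i] := \sum_(i < m) u i 0 * (v i 0)^*.

Definition vnorm (u : 'cV[R[i]]_m) : R := Num.sqrt (complex.Re (herm u u)).

Definition H1_0_vec (Omega : set (plane R)) (u : plane R -> 'cV[R[i]]_m)
    (Du : 'I_2 -> plane R -> 'cV[R[i]]_m) : Prop :=
  forall i : 'I_m, H1_0 Omega (fun x => u x i 0) (fun h x => Du h x i 0).

(* The matrix A^{hk}(x) xi_h xi_k. *)
Definition symbol (A : 'I_2 -> 'I_2 -> plane R -> 'M[R[i]]_m) (x : plane R)
    (xi : 'rV[R]_2) : 'M[R[i]]_m :=
  \sum_(h < 2) \sum_(k < 2) (xi 0 h * xi 0 k)%:C *: A h k x.

End Vectors.

Section Phi.
Context {R : realType}.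

(* The function phi : (0,+oo) -> (0,+oo) is represented by a total function;
   its values on (-oo,0] are ignored. *)
Record phi_conditions (phi : R -> R) : Prop := PhiConditions {
  phi_gt0 : forall s : R, 0 < s -> 0 < phi s;
  phi_C1 : forall s : R, 0 < s ->
    derivable phi s 1 /\ {for s, continuous (derive1 phi)};
  phi_incr : forall s : R, 0 < s -> 0 < derive1 (fun t => t * phi t) s;
  phi_range : [set s * phi s | s in [set s : R | 0 < s]] = [set t : R | 0 < t];
  phi_behaviour : exists C1 C2 r s0 : R,
    [/\ 0 < C1, 0 < C2, -1 < r & 0 < s0] /\
    [/\ (forall s : R, 0 < s < s0 ->
           C1 * s `^ r <= derive1 (fun t => t * phi t) s <= C2 * s `^ r),
        (r = 0 ->
           (exists2 l : R, 0 < l & phi s @[s --> 0^'+] --> l) /\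
           s * derive1 phi s @[s --> 0^'+] --> 0) &
        exists2 s1 : R, s0 < s1 &
          (forall s : R, s1 <= s -> 0 <= derive1 phi s) \/
          (forall s : R, s1 <= s -> derive1 phi s <= 0)];
  phi_ratio : forall s t : R, 0 < s -> s <= t ->
    `|s * derive1 phi s / phi s| <= `|t * derive1 phi t / phi t|
}.

(* Lambda (s sqrt(phi s)) = - s phi'(s) / (s phi'(s) + 2 phi(s)); for t > 0
   the s chosen below is the unique preimage of t under s |-> s sqrt(phi s). *)
Definition Lambda (phi : R -> R) (t : R) : R :=
  let s := xget 0 [set s | 0 < s /\ s * Num.sqrt (phi s) = t] in
  - (s * derive1 phi s / (s * derive1 phi s + 2 * phi s)).

Definition Lambda_infty (phi : R -> R) : R := lim (Lambda phi t @[t --> +oo]).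

(* This is phi(|u|)u; where u x = 0 it is 0 whatever the value of phi 0. *)
Definition phi_mul {m : nat} (phi : R -> R) (u : plane R -> 'cV[R[i]]_m)
    (x : plane R) : 'cV[R[i]]_m :=
  (phi (vnorm (u x)))%:C *: u x.

(* Dissipativity of A = d_h (A^{hk} d_k); the quantified Du and Dv are
   the (a.e. unique) weak gradients of u and of phi(|u|)u. *)
Definition LPhi_dissipative {m : nat} (Omega : set (plane R))
    (A : 'I_2 -> 'I_2 -> plane R -> 'M[R[i]]_m) (phi : R -> R) : Prop :=
  forall (u : plane R -> 'cV[R[i]]_m) (Du Dv : 'I_2 -> plane R -> 'cV[R[i]]_m),
    H1_0_vec Omega u Du ->
    H1_0_vec Omega (phi_mul phi u) Dv ->
    0 <= complex.Re (cintegral Omega (fun x =>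
           \sum_(h < 2) \sum_(k < 2) herm (A h k x *m Du k x) (Dv h x))).

End Phi.

(* Main.v *)
Require Import Defs.
From HB Require Import structures.
From mathcomp Require Import all_boot all_order all_algebra.
From mathcomp Require Import all_classical all_reals all_analysis.
From mathcomp Require Import complex.
From mathcomp Require Import measurable_realfun ess_sup_inf ring lra.

Set Implicit Arguments.
Unset Strict Implicit.
Unset Printing Implicit Defensive.

Import Order.TTheory GRing.Theory Num.Theory.
Import numFieldNormedType.Exports.

Local Open Scope classical_set_scope.
Local Open Scope complex_scope.
Local Open Scope ring_scope.

(* Fix M > 0 and a unit vector omega. In the dissipativity inequality take
   u = rho omega + (U(y) - U(0)), where rho is a cutoff equal to M around a small
   square, y = chi sin(n <xi,x>)/n is supported in that square, and U is a curve
   in C^m leaving M omega with velocity M zeta. Where y lives, the integrand is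
   close to (chi cos(n <xi,x>))^2 q with
     q = M^2 Re <S zeta, phi(M) zeta + M phi'(M) Re<zeta,omega> omega>,
   S = A^{hk} xi_h xi_k; elsewhere it does not depend on n and chi. Adding the
   inequality for cos removes the oscillation and scaling chi removes the
   contribution of rho, so the integral of chi^2 q is nonnegative, and q >= 0
   almost everywhere. As q is linear in the entries of A, one null set serves all
   M, zeta, omega and xi. For zeta = eta + L Re<eta,omega> omega with
   L = Lambda(M sqrt(phi M)), q is a positive multiple of the form of the theorem
   with L in place of Lambda_infty; then M tends to infinity.

   Since phi is only C^1, phi(|u|)u is a composition of C^1 functions of one
   variable with smooth functions on the plane; it is put in the closure of the
   test functions by polynomial approximation in one variable. *)

(** * Polynomial approximation in one variable *)

(** The order of the limits matters. The frequency goes to infinity first, with chi fixed: y then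
    tends to 0 uniformly while its gradient does not, so the nonlinear curve enters only through its
    velocity at 0. The limit is quadratic in chi although phi is not homogeneous, and only then can
    chi be scaled. Two obstacles shape the test function, both from the requirement that phi(|u|)u
    be C^1. At the edge of the support |u| tends to 0, where (s phi(s))' may blow up; rho is
    therefore a high power of a smooth cutoff. On the perturbed square |u| must not vanish, which an
    affine curve cannot ensure when zeta is parallel to omega; hence the exponential in the omega
    direction. The gradients of rho and y are never both nonzero at a point, so there are no mixed
    terms and the energy of rho is a constant fixed before y is chosen. The value of L comes from
    requiring that zeta = eta + L s omega, with s = Re<eta,omega>, turn the second argument into eta
    - L s omega: L + al (1 + L) = - L, where al = M phi'(M) / phi(M). *)

Section Weierstrass.
Context {R : realType}.

(** The value at x is the expectation of c at a binomial variable with parameters n and x, computed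
    by conditioning on the first trial. With this recursion in place of binomial coefficients, each
    identity below is an induction closed by [ring]. *)
Fixpoint bernstein (n : nat) (c : nat -> R) : {poly R} :=
  if n is n'.+1 then
    'X * bernstein n' (fun i => c i.+1) + (1 - 'X) * bernstein n' c
  else (c 0%N)%:P.

Lemma horner_bernsteinS n c x : (bernstein n.+1 c).[x] =
  x * (bernstein n (fun i => c i.+1)).[x] + (1 - x) * (bernstein n c).[x].
Proof. by rewrite /= !hornerE. Qed.

Lemma bernstein_le n (c d : nat -> R) x : 0 <= x <= 1 ->
  (forall i, (i <= n)%N -> c i <= d i) ->
  (bernstein n c).[x] <= (bernstein n d).[x].
Proof.
move=> /andP[x0 x1]; elim: n c d => [|n IH] c d cd.
  by rewrite /= !hornerE cd.
rewrite !horner_bernsteinS lerD// ler_wpM2l ?subr_ge0//; apply: IH => i ile.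
  exact: cd.
by apply: cd; rewrite leqW.
Qed.

Lemma bernsteinD n (c d : nat -> R) x :
  (bernstein n (fun i => c i + d i)).[x]
  = (bernstein n c).[x] + (bernstein n d).[x].
Proof.
elim: n c d => [|n IH] c d; first by rewrite /= !hornerE.
by rewrite !horner_bernsteinS !IH; ring.
Qed.

Lemma bernsteinZ n (c : nat -> R) k x :
  (bernstein n (fun i => k * c i)).[x] = k * (bernstein n c).[x].
Proof.
elim: n c => [|n IH] c; first by rewrite /= !hornerE.
by rewrite !horner_bernsteinS !IH; ring.
Qed.

Lemma bernstein_cst n (k : R) x : (bernstein n (fun=> k)).[x] = k.
Proof.
elim: n => [|n IH]; first by rewrite /= hornerE.
by rewrite horner_bernsteinS !IH; ring.
Qed.

(** Variance plus squared bias. The centre c is arbitrary because the shift of indices in the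
    recursion replaces c by c - 1. *)
Lemma bernstein_var n (c x : R) :
  (bernstein n (fun i => (i%:R - c) ^+ 2)).[x]
  = n%:R * x * (1 - x) + (n%:R * x - c) ^+ 2.
Proof.
elim: n c => [|n IH] c; first by rewrite /= hornerE; ring.
rewrite horner_bernsteinS IH.
have -> : (fun i : nat => (i.+1%:R - c) ^+ 2) = (fun i => (i%:R - (c - 1)) ^+ 2).
  by apply/funext => i; rewrite -natr1; ring.
by rewrite IH -natr1; ring.
Qed.

Lemma continuous_bounded (g : R -> R) (X : R) : continuous g ->
  exists C, forall s, `|s| <= X -> `|g s| <= C.
Proof.
move=> cg.
have /compact_bounded [D [_ /(_ (`|D| + 1)) H]] : compact (g @` `[- X, X]).
  by apply: continuous_compact; [exact: continuous_subspaceT|exact: segment_compact].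
exists (`|D| + 1) => s sX; apply: H; first by rewrite (le_lt_trans (ler_norm _))// ltrDl.
by exists s => //=; rewrite in_itv/= -ler_norml.
Qed.

(** Closer than d, uniform continuity gives eps; farther apart, the trivial bound 2M is at most 2M
    (x - y)^2 / d^2. A quadratic error is what the second moment of the binomial law controls. *)
Lemma continuous_quadratic_modulus (f : R -> R) (B eps : R) :
  continuous f -> 0 < eps -> exists2 C, 0 <= C &
  forall x y, `|x| <= B -> `|y| <= B -> `|f x - f y| <= eps + C * (x - y) ^+ 2.
Proof.
move=> cf eps0.
have cK := @segment_compact R (- B) B.
have [M M0 fM] : exists2 M : R, 0 <= M & forall x, `|x| <= B -> `|f x| <= M.
  have [M HM] := continuous_bounded B cf; exists `|M| => // x xB.
  exact: le_trans (HM x xB) (ler_norm M).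
have [d d0 fd] : exists2 d : R, 0 < d & forall x y, `|x| <= B ->
    `|x - y| < d -> `|f x - f y| <= eps.
  move/compact_near_coveringP : cK => /(_ R (0:R)^'+
     (fun d x => forall y, `|x - y| < d -> `|f x - f y| <= eps)) H.
  have [|e /= e0 He] := H _.
    move=> x _; have e20 : 0 < eps / 2 by rewrite divr_gt0.
    have /cvgrPdist_le /(_ _ e20) [e /= e0 He] := cf x.
    exists (ball x (e / 2), [set d | d < e / 2]) => /=.
      split; first by exists (e / 2) => //=; rewrite divr_gt0.
      by apply: nbhs_right_lt; rewrite divr_gt0.
    move=> [z d] /= [xz de] y zy.
    rewrite /ball/= in xz.
    rewrite -(subrKA (f x)) (le_trans (ler_normD _ _))//.
    rewrite [leRHS]splitr lerD//.
      by rewrite distrC; apply: He => /=; rewrite (lt_trans xz)// gtr_pMr// invf_lt1// ltr1n.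
    apply: He => /=; rewrite -(subrKA z) (le_lt_trans (ler_normD _ _))//.
    by rewrite [ltRHS]splitr ltrD// (lt_trans zy).
  exists (e / 2); first by rewrite divr_gt0.
  move=> x y xB xy; apply: (He (e / 2)) => //=.
  - by rewrite sub0r normrN gtr0_norm ?divr_gt0// gtr_pMr// invf_lt1// ltr1n.
  - by rewrite divr_gt0.
  - by rewrite in_itv/= -ler_norml.
exists (2 * M / d ^+ 2); first by rewrite divr_ge0 ?mulr_ge0// ltW.
move=> x y xB yB; have [xy|xy] := ltP `|x - y| d.
  by rewrite (le_trans (fd _ _ xB xy))// lerDl mulr_ge0 ?sqr_ge0// divr_ge0 ?mulr_ge0// ltW.
rewrite (@le_trans _ _ (2 * M))//.
  by rewrite (le_trans (ler_normB _ _))// mulr_natl mulr2n lerD// fM.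
rewrite (@le_trans _ _ (2 * M / d ^+ 2 * (x - y) ^+ 2))//; last by rewrite lerDr ltW.
rewrite -mulrA ler_peMr ?mulr_ge0// mulrC ler_pdivlMr ?exprn_gt0// mul1r.
by rewrite -(real_normK (num_real (x - y))) lerXn2r ?nnegrE// ltW.
Qed.

(** Chebyshev's argument: the error at each node is bounded by a quadratic in the node,
    [bernstein_le] carries the bound through the expectation, and the variance x (1 - x) / n leaves
    at most eps/2 + C/n. *)
Lemma Weierstrass_unit (f : R -> R) (eps : R) : continuous f -> 0 < eps ->
  exists p : {poly R}, forall x, 0 <= x <= 1 -> `|p.[x] - f x| <= eps.
Proof.
move=> cf e0; have e20 : 0 < eps / 2 by rewrite divr_gt0.
have [C C0 HC] := continuous_quadratic_modulus 1 cf e20.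
have [n nC] : exists n : nat, 2 * C / eps <= n.+1%:R.
  have [n _ Hn] := nbhs_infty_ger (2 * C / eps).
  by exists n; rewrite (le_trans (Hn n _))//= ler_nat.
pose c i := f (i%:R / n.+1%:R); exists (bernstein n.+1 c) => x /andP[x0 x1].
have n0 : 0 < n.+1%:R :> R by rewrite ltr0n.
have key : (bernstein n.+1 (fun i => eps / 2 + C / n.+1%:R ^+ 2 *
    (i%:R - n.+1%:R * x) ^+ 2)).[x] <= eps.
  rewrite bernsteinD bernstein_cst bernsteinZ bernstein_var subrr expr0n addr0.
  rewrite [leRHS]splitr lerD2l.
  have -> : C / n.+1%:R ^+ 2 * (n.+1%:R * x * (1 - x)) = C / n.+1%:R * (x * (1 - x)).
    by field; rewrite lt0r_neq0.
  rewrite (@le_trans _ _ (C / n.+1%:R * 1))//.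
    by rewrite ler_wpM2l ?divr_ge0// ?ltW//; nra.
  rewrite mulr1 ler_pdivrMr// mulrAC ler_pdivlMr// mulrC [leRHS]mulrC.
  by rewrite -ler_pdivrMr.
have est i : (i <= n.+1)%N -> `|c i - f x| <=
    eps / 2 + C / n.+1%:R ^+ 2 * (i%:R - n.+1%:R * x) ^+ 2.
  move=> ile; have -> : C / n.+1%:R ^+ 2 * (i%:R - n.+1%:R * x) ^+ 2 = C * (i%:R / n.+1%:R - x) ^+ 2.
    by field; rewrite lt0r_neq0.
  apply: HC; last by rewrite ger0_norm.
  by rewrite ger0_norm ?divr_ge0// ler_pdivrMr// mul1r ler_nat.
have cE : (bernstein n.+1 (fun i => c i - f x)).[x] = (bernstein n.+1 c).[x] - f x.
  by rewrite bernsteinD bernstein_cst.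
rewrite -cE ler_norml; apply/andP; split.
  rewrite lerNl -[leLHS]mulN1r -bernsteinZ.
  apply: (le_trans _ key); apply: bernstein_le; rewrite ?x0// => i ile.
  by rewrite mulN1r (le_trans _ (est i ile))// -normrN ler_norm.
apply: (le_trans _ key); apply: bernstein_le; rewrite ?x0// => i ile.
by rewrite (le_trans _ (est i ile))// ler_norm.
Qed.

Lemma Weierstrass (f : R -> R) (B eps : R) : continuous f -> 0 < B -> 0 < eps ->
  exists p : {poly R}, forall x, `|x| <= B -> `|p.[x] - f x| <= eps.
Proof.
move=> cf B0 e0.
have cg : continuous (fun s => f (2 * B * s - B)).
  move=> s; apply: (@continuous_comp _ _ _ (fun s => 2 * B * s - B) f); last exact: cf.
  by apply: cvgB; [apply: cvgM; [exact: cvg_cst|exact: cvg_id]|exact: cvg_cst].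
have [p Hp] := Weierstrass_unit cg e0.
exists (p \Po ((2 * B)^-1 *: ('X + B%:P))) => x xB.
rewrite horner_comp !hornerE.
move: (Hp ((2 * B)^-1 * (x + B))).
rewrite mulrA mulfV ?gt_eqF ?mulr_gt0// mul1r addrK; apply.
move: xB; rewrite ler_norml => /andP[? ?].
rewrite mulr_ge0 ?invr_ge0 ?mulr_ge0//=; [|lra|lra].
by rewrite mulrC ler_pdivrMr ?mulr_gt0//; lra.
Qed.

Lemma poly_antiderivative (p : {poly R}) (k : R) :
  exists q : {poly R}, q^`() = p /\ q.[0] = k.
Proof.
exists (\poly_(i < (size p).+1) (if i is j.+1 then p`_j / j.+1%:R else k)); split.
  apply/polyP => i; rewrite coef_deriv coef_poly ltnS.
  case: ltnP => ip; last by rewrite mul0rn nth_default.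
  by rewrite -[LHS]mulr_natr divfK// pnatr_eq0.
by rewrite horner_coef0 coef_poly.
Qed.

(** The derivative is approximated and then integrated, so the mean value theorem controls the
    values; this costs a factor B, whence eps / B. Exact agreement at 0 preserves supports under
    composition when g 0 = 0. *)
Lemma C1_poly_approx (g dg : R -> R) (B eps : R) :
  (forall x : R, is_derive x 1 g (dg x)) -> continuous dg ->
  0 < B -> 0 < eps ->
  exists p : {poly R}, p.[0] = g 0 /\ forall x, `|x| <= B ->
    `|p.[x] - g x| <= eps /\ `|p^`().[x] - dg x| <= eps.
Proof.
move=> hg cdg B0 e0.
have e'0 : 0 < Num.min eps (eps / B) by rewrite lt_min e0 divr_gt0.
have [q Hq] := Weierstrass cdg B0 e'0.
have [p [pq p0]] := poly_antiderivative q (g 0).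
exists p; split=> // x xB; rewrite pq; split; last first.
  by rewrite (le_trans (Hq _ xB))// ge_min lexx.
have hd (y : R) : is_derive y 1 (fun y => p.[y] - g y) (q.[y] - dg y).
  by rewrite -pq; exact: is_deriveB.
have cd : continuous (fun y => p.[y] - g y).
  by move=> y; apply/differentiable_continuous/derivable1_diffP; case: (hd y).
have bnd (y : R) : `|y| <= B -> `|(q.[y] - dg y) * x| <= eps.
  move=> yB; rewrite normrM (@le_trans _ _ (eps / B * B))//.
    by rewrite ler_pM// (le_trans (Hq _ yB))// ge_min lexx orbT.
  by rewrite divfK// gt_eqF.
move: (xB); rewrite ler_norml => /andP[xB1 xB2].
have [x0|x0] := leP 0 x.
  have [c] := MVT_segment x0 (fun y _ => hd y) (continuous_subspaceT cd).
  rewrite in_itv/= => /andP[c0 cx]; rewrite p0 subrr !subr0 => ->.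
  by rewrite bnd// ger0_norm// (le_trans cx).
have [c] := MVT_segment (ltW x0) (fun y _ => hd y) (continuous_subspaceT cd).
rewrite in_itv/= => /andP[cx c0]; rewrite p0 subrr !sub0r mulrN => /oppr_inj ->.
by rewrite bnd// ler0_norm// lerNl (le_trans _ cx).
Qed.

End Weierstrass.

(** * Smooth functions of one variable and flat functions *)

Section Smooth1.
Context {R : realType}.

(** The witness is the whole sequence of derivatives, so an induction on the order of smoothness can
    pass from one member to the next. *)
Definition smooth1 (g : R -> R) := exists G : nat -> R -> R,
  G 0%N = g /\ forall n (x : R), is_derive x 1 (G n) (G n.+1 x).

Lemma smooth1_poly (p : {poly R}) : smooth1 (horner p).
Proof.
exists (fun n => horner (derivn n p)); split=> // n x.
by rewrite derivnS; exact: is_derive_poly.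
Qed.

Lemma smooth1_expR (k : R) : smooth1 (fun x => expR (k * x)).
Proof.
exists (fun n x => k ^+ n * expR (k * x)); split.
  by apply/funext => x; rewrite expr0 mul1r.
move=> n x.
have h : is_derive x 1 ( *%R k) k.
  by apply: (is_derive_eq (is_deriveZ k (is_derive_id x 1))); rewrite /GRing.scale/= mulr1.
have h2 := is_derive1_comp (is_derive_expR (k * x)) h.
apply: (is_derive_eq (is_deriveZ (k ^+ n) h2)).
by rewrite /GRing.scale/= exprSr; ring.
Qed.

Lemma smooth1_sin : smooth1 (@sin R).
Proof.
exists (fun n x => if odd n then (-1) ^+ n./2 * cos x else (-1) ^+ n./2 * sin x); split.
  by apply/funext => x /=; rewrite expr0 mul1r.
move=> n x /=; rewrite uphalf_half; case: (odd n) => /=.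
  apply: (is_derive_eq (is_deriveZ _ (is_derive_cos x))).
  rewrite /GRing.scale/= ?exprS; ring.
by apply: (is_derive_eq (is_deriveZ _ (is_derive_sin x))).
Qed.

Lemma smooth1_cos : smooth1 (@cos R).
Proof.
exists (fun n x => if odd n then (-1) ^+ (n./2).+1 * sin x else (-1) ^+ n./2 * cos x); split.
  by apply/funext => x /=; rewrite expr0 mul1r.
move=> n x /=; rewrite uphalf_half; case: (odd n) => /=.
  by apply: (is_derive_eq (is_deriveZ _ (is_derive_sin x))).
apply: (is_derive_eq (is_deriveZ _ (is_derive_cos x))).
rewrite /GRing.scale/= ?exprS; ring.
Qed.

Lemma near_ltr (x a : R) : x < a -> \near x, x < a.
Proof. by move=> xa; apply: open_nbhs_nbhs; split => //; exact: open_lt. Qed.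

Lemma near_gtr (x a : R) : a < x -> \near x, a < x.
Proof. by move=> xa; apply: open_nbhs_nbhs; split => //; exact: open_gt. Qed.

(* P(1/x) exp(-1/x) for x > 0, extended by 0; differentiation maps P to
   X^2 (P - P'), so the family is closed under it. *)
Definition flat (P : {poly R}) (x : R) : R :=
  if 0 < x then P.[x^-1] * expR (- x^-1) else 0.

(** With n the size of P, |P(t)| is at most S t^n and exp t at least t^(n+1) / (n+1)!. The spare
    power of t becomes a factor x at t = 1/x, which gives continuity of [flat] at 0. *)
Lemma poly_expRN_bound (P : {poly R}) :
  exists2 C, 0 <= C & forall t, 1 <= t -> `|P.[t] * expR (- t)| <= C / t.
Proof.
pose n := size P; pose S := \sum_(i < n) `|P`_i|.
exists (S * n.+1`!%:R); first by rewrite mulr_ge0// sumr_ge0.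
move=> t t1; have t0 : 0 < t by rewrite (lt_le_trans ltr01).
have Pt : `|P.[t]| <= S * t ^+ n.
  rewrite horner_coef (le_trans (ler_norm_sum _ _ _))// mulr_suml ler_sum// => i _.
  rewrite normrM ler_wpM2l// ger0_norm ?exprn_ge0 ?(ltW t0)//.
  by rewrite ler_weXn2l// ltnW.
rewrite normrM (ger0_norm (expR_ge0 _)) expRN.
have E := expR_ge1Dxn n (ltW t0).
have {}E : t ^+ n.+1 / n.+1`!%:R <= expR t by rewrite (le_trans _ E)// lerDr.
have f0 : 0 < n.+1`!%:R :> R by rewrite ltr0n fact_gt0.
rewrite ler_pdivrMr ?expR_gt0// (le_trans Pt)//.
have S0 : 0 <= S by rewrite sumr_ge0.
rewrite -!mulrA ler_wpM2l//.
rewrite (@le_trans _ _ (n.+1`!%:R * (t^-1 * (t ^+ n.+1 / n.+1`!%:R))))//.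
  by rewrite le_eqVlt exprS; apply/orP; left; apply/eqP; field; rewrite !lt0r_neq0.
by rewrite ler_wpM2l ?(ltW f0)// ler_wpM2l// invr_ge0 ltW.
Qed.

Lemma flat_cvg0 P : {for 0, continuous (flat P)}.
Proof.
have f0 : flat P 0 = 0 by rewrite /flat ltxx.
apply/cvgrPdist_le => e e0; rewrite f0.
have [C C0 HC] := poly_expRN_bound P.
have d0 : 0 < Num.min 1 (e / (C + 1)) by rewrite lt_min ltr01 divr_gt0// ltr_wpDl.
exists (Num.min 1 (e / (C + 1))) => //= x /=.
rewrite !sub0r !normrN lt_min => /andP[x1 xe].
rewrite /flat; case: ifPn => [x0|]; last by rewrite normr0 ltW.
rewrite gtr0_norm// in x1 xe.
have tx : 1 <= x^-1 by rewrite invf_ge1// ltW.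
rewrite (le_trans (HC _ tx))// invrK (@le_trans _ _ ((C + 1) * x))//.
  by rewrite ler_wpM2r ?(ltW x0)// lerDl.
by rewrite mulrC -ler_pdivlMr ?ltr_wpDl// ltW.
Qed.

Lemma is_derive_flat P (x : R) :
  is_derive x 1 (flat P) (flat ('X^2 * (P - P^`())) x).
Proof.
have [x0|x0|->] := ltgtP x 0.
- rewrite [X in is_derive _ _ _ X](_ : _ = 0); last by rewrite /flat ltNge (ltW x0).
  apply: near_eq_is_derive (is_derive_cst (0 : R) x 1).
  by near=> y; rewrite /flat ltNge (@ltW _ _ y 0)//; near: y; exact: near_ltr.
- rewrite {2}/flat x0.
  have hi := is_deriveV (lt0r_neq0 x0) (is_derive_id x 1).
  have h1 := is_derive1_comp (is_derive_poly P x^-1) hi.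
  have h2 := is_derive1_comp (g := fun y => - y^-1) (is_derive_expR (- x^-1))
    (is_deriveN hi).
  have h := is_deriveM h1 h2.
  apply: near_eq_is_derive (is_derive_eq h _).
    by near=> y; rewrite /flat (_ : 0 < y)//; near: y; exact: near_gtr.
  rewrite !hornerE /GRing.scale/=; field; exact: lt0r_neq0.
- rewrite [X in is_derive _ _ _ X](_ : _ = 0); last by rewrite /flat ltxx.
  (* The difference quotient at 0, flat P x / x, is again a flat function, with polynomial X P, and
     is therefore continuous at 0 with value 0. *)
  apply/is_derive1_caratheodory; exists (flat ('X * P)); split.
  + move=> z; rewrite /flat ltxx !subr0; case: ifP => z0; last by rewrite mul0r.
    by rewrite !hornerE; field; rewrite lt0r_neq0.
  + exact: flat_cvg0.
  + by rewrite /flat ltxx.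
Unshelve. all: by end_near. Qed.

Lemma smooth1_flat P : smooth1 (flat P).
Proof.
exists (fun n => flat (iter n (fun Q => 'X^2 * (Q - Q^`())) P)); split=> // n x.
exact: is_derive_flat.
Qed.

Definition expm1V (x : R) : R := flat 1 x.

Lemma expm1V_gt0 x : (0 < expm1V x) = (0 < x).
Proof. by rewrite /expm1V /flat; case: ifP; rewrite ?ltxx// hornerE mul1r expR_gt0. Qed.

Lemma expm1V_ge0 x : 0 <= expm1V x.
Proof. by rewrite /expm1V /flat; case: ifP; rewrite ?ltxx// hornerE mul1r expR_ge0. Qed.

Lemma expm1V_le0 x : x <= 0 -> expm1V x = 0.
Proof. by rewrite /expm1V /flat; case: ltP. Qed.

Lemma expm1V_homo : {homo expm1V : x y / x <= y}.
Proof.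
move=> x y xy; have [x0|x0] := leP x 0; first by rewrite expm1V_le0// expm1V_ge0.
have y0 := lt_le_trans x0 xy.
by rewrite /expm1V /flat x0 y0 !hornerE ?mul1r ler_expR lerN2 lef_pV2.
Qed.

(* Nesting two flat functions gives a smooth function that is exactly constant
   for x <= 0 and vanishes for x >= a, without any quotient. *)
Definition step_down (a x : R) : R := expm1V (expm1V a - expm1V x).

End Smooth1.

(** * Calculus and integration on the plane *)

Section DirectionalDerivative.
Context {R : realType} {V : normedModType R}.

(** Restriction to a line brings the one-variable rules to bear, so the chain rule below asks only
    for a derivative in the direction v. *)
Lemma is_derive_line (f : V -> R) (x v : V) (df : R) :
  is_derive x v f df <-> is_derive (0 : R) 1 (fun t : R => f (t *: v + x)) df.
Proof.
have E : (fun h : R => h^-1 *: ((f \o shift x) (h *: v) - f x)) =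
  (fun h : R => h^-1 *: (((fun t : R => f (t *: v + x)) \o shift 0) (h *: 1) -
     (fun t : R => f (t *: v + x)) 0)).
  by apply/funext => h /=; rewrite addr0 scale0r add0r /GRing.scale/= mulr1.
split=> -[d e]; split.
- by rewrite /derivable -E.
- by rewrite -e /derive -E.
- by rewrite /derivable E.
- by rewrite -e /derive E.
Qed.

Lemma is_derive_chain (f : V -> R) (g : R -> R) (x v : V) (a b : R) :
  is_derive x v f a -> is_derive (f x) 1 g b -> is_derive x v (g \o f) (b * a).
Proof.
move=> /is_derive_line hf hg; apply/is_derive_line.
apply: (is_derive1_comp (f := g) (g := fun t => f (t *: v + x))).
by rewrite scale0r add0r.
Qed.

End DirectionalDerivative.

Lemma ord2_cases (j : 'I_2) : j = ord0 \/ j = lift ord0 ord0.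
Proof. by case: j => [[|[|//]]] hi; [left|right]; exact/val_inj. Qed.

Section PlaneCalculus.
Context {R : realType}.
Implicit Types (f g : plane R -> R) (x : plane R) (h : 'I_2) (k : nat).

Lemma C_k_intro k f (df : 'I_2 -> plane R -> R) : continuous f ->
  (forall h x, is_derive x (basis2 h) f (df h x)) ->
  (forall h, C_k k (df h)) -> C_k k.+1 f.
Proof.
move=> cf hd hk; split=> // h; split=> [x|]; first by case: (hd h x).
rewrite (_ : (fun _ => _) = df h); first exact: hk.
by apply/funext => x; case: (hd h x).
Qed.

Lemma C_k_continuous k f : C_k k f -> continuous f.
Proof. by case: k => // k []. Qed.

Lemma C_kS_is_derive k f h x : C_k k.+1 f ->
  is_derive x (basis2 h) f ('D_(basis2 h) f x).
Proof. by move=> [_ /(_ h)[/(_ x) d _]]; exact: derivableP. Qed.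

Lemma C_kS_derive k f h : C_k k.+1 f -> C_k k (fun x => 'D_(basis2 h) f x).
Proof. by move=> [_ /(_ h)[]]. Qed.

Lemma C_kW k f : C_k k.+1 f -> C_k k f.
Proof.
elim: k f => [f /C_k_continuous//|k IH f [cf H]].
by split=> // h; split; [case: (H h)|apply: IH; case: (H h)].
Qed.

Lemma C_k_le k l f : (k <= l)%N -> C_k l f -> C_k k f.
Proof.
elim: l => [|l IH]; first by rewrite leqn0 => /eqP ->.
by rewrite leq_eqVlt ltnS => /predU1P[->//|kl /C_kW]; exact: IH.
Qed.

Lemma C_k_cst k (c : R) : C_k k (fun=> c).
Proof.
elim: k c => [c|k IH c]; first exact: cst_continuous.
by apply: (@C_k_intro _ _ (fun _ _ => 0)) => //; exact: cst_continuous.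
Qed.

Lemma C_kD k f g : C_k k f -> C_k k g -> C_k k (fun x => f x + g x).
Proof.
elim: k f g => [|k IH] f g hf hg; first by move=> x; exact: (cvgD (hf x) (hg x)).
apply: (@C_k_intro _ _ (fun h x => 'D_(basis2 h) f x + 'D_(basis2 h) g x)).
- by move=> x; apply: cvgD; [exact: (C_k_continuous hf)|exact: (C_k_continuous hg)].
- by move=> h x; apply: is_deriveD; apply: C_kS_is_derive; eassumption.
- by move=> h; apply: IH; apply: C_kS_derive.
Qed.

Lemma C_kM k f g : C_k k f -> C_k k g -> C_k k (fun x => f x * g x).
Proof.
elim: k f g => [|k IH] f g hf hg; first by move=> x; exact: (cvgM (hf x) (hg x)).
apply: (@C_k_intro _ _ (fun h x => f x * 'D_(basis2 h) g x + g x * 'D_(basis2 h) f x)).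
- by move=> x; apply: cvgM; [exact: (C_k_continuous hf)|exact: (C_k_continuous hg)].
- by move=> h x; apply: is_deriveM; apply: C_kS_is_derive; eassumption.
- by move=> h; apply: C_kD; apply: IH; (exact: C_kW || exact: C_kS_derive).
Qed.

Lemma C_kZ k (c : R) f : C_k k f -> C_k k (fun x => c * f x).
Proof. by apply: C_kM; exact: C_k_cst. Qed.

Lemma C_kB k f g : C_k k f -> C_k k g -> C_k k (fun x => f x - g x).
Proof.
move=> hf hg; rewrite (_ : (fun _ => _) = (fun x => f x + (-1) * g x)).
  by apply: C_kD => //; exact: C_kZ.
by apply/funext => x; rewrite mulN1r.
Qed.

Lemma C1_comp f (g dg : R -> R) : C_k 1 f ->
  (forall y : R, is_derive y 1 g (dg y)) -> continuous dg -> C_k 1 (g \o f).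
Proof.
move=> hf hg cdg.
apply: (@C_k_intro _ _ (fun h x => dg (f x) * 'D_(basis2 h) f x)).
- move=> x; apply: continuous_comp; first exact: (C_k_continuous hf).
  by apply/differentiable_continuous/derivable1_diffP; case: (hg (f x)).
- by move=> h x; apply: is_derive_chain => //; exact: C_kS_is_derive hf.
- move=> h; apply: (@C_kM 0 (dg \o f)); last exact: C_kS_derive.
  by move=> x; apply: continuous_comp; [exact: (C_k_continuous hf)|exact: cdg].
Qed.

Lemma smooth1_comp k f (g : R -> R) : C_k k f -> smooth1 g -> C_k k (g \o f).
Proof.
move=> hf [G [<- hG]].
have cG n : continuous (G n).
  by move=> y; apply/differentiable_continuous/derivable1_diffP; case: (hG n y).
(* The index of the derivative is generalised together with k: differentiating G n composed with f
   produces G n.+1 composed with f. *)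
elim: k f hf 0%N => [|k IH] f hf n.
  by move=> x; apply: continuous_comp; [exact: (C_k_continuous hf)|exact: cG].
apply: (@C_k_intro _ _ (fun h x => G n.+1 (f x) * 'D_(basis2 h) f x)).
- by move=> x; apply: continuous_comp; [exact: (C_k_continuous hf)|exact: cG].
- by move=> h x; apply: is_derive_chain => //; exact: C_kS_is_derive hf.
- by move=> h; apply: C_kM; [apply: IH; exact: C_kW|exact: C_kS_derive].
Qed.

Lemma is_derive_linear2 (a b : R) x h :
  is_derive x (basis2 h) (fun z : plane R => a * z.1 + b * z.2)
    (a * (basis2 h : plane R).1 + b * (basis2 h : plane R).2).
Proof.
apply/is_derive_line.
rewrite (_ : (fun t : R => _) = (fun t : R => t * (a * (basis2 h : plane R).1 + b * (basis2 h : plane R).2)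
   + (a * x.1 + b * x.2))); last by apply/funext => t /=; rewrite /GRing.scale/=; ring.
have := is_deriveD (is_deriveM (is_derive_id (0:R) 1) (is_derive_cst
  (a * (basis2 h : plane R).1 + b * (basis2 h : plane R).2) (0:R) 1)) (is_derive_cst (a * x.1 + b * x.2) (0:R) 1).
move=> H; apply: (is_derive_eq H).
by rewrite /GRing.scale/=; ring.
Qed.

Lemma C_k_linear2 k (a b : R) : C_k k (fun z : plane R => a * z.1 + b * z.2).
Proof.
have cl : continuous (fun z : plane R => a * z.1 + b * z.2).
  move=> z; apply: cvgD; (apply: cvgM; first exact: cvg_cst).
    exact: cvg_fst.
  exact: cvg_snd.
case: k => // k; apply: (C_k_intro cl) => [h x|h]; first exact: is_derive_linear2.
exact: C_k_cst.
Qed.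

Lemma is_derive_xline f x (s : R) (d : R) :
  is_derive ((s, x.2) : plane R) (basis2 ord0) f d -> is_derive s 1 (fun t : R => f (t, x.2)) d.
Proof.
move=> /is_derive_line H; apply/(is_derive_line (V := R)).
rewrite (_ : (fun t : R => _) = (fun t : R => f (t *: basis2 ord0 + (s, x.2))))//.
apply/funext => t; congr f; apply/pair_equal_spec; split => //=.
by rewrite /GRing.scale/= mulr0 add0r.
Qed.

Lemma is_derive_yline f x (s : R) (d : R) :
  is_derive ((x.1, s) : plane R) (basis2 (lift ord0 ord0)) f d -> is_derive s 1 (fun t : R => f (x.1, t)) d.
Proof.
move=> /is_derive_line H; apply/(is_derive_line (V := R)).
rewrite (_ : (fun t : R => _) = (fun t : R => f (t *: basis2 (lift ord0 ord0) + (x.1, s))))//.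
apply/funext => t; congr f; apply/pair_equal_spec; split => //=.
by rewrite /GRing.scale/= mulr0 add0r.
Qed.

End PlaneCalculus.

(** * Measurability and integrability on the plane *)

Section PlaneMeasure.
Context {R : realType}.
Implicit Types (f g : plane R -> R) (x : plane R).

Definition rbox (p q : rat) (n : nat) : set (plane R) :=
  (`](ratr p - n.+1%:R^-1), (ratr p + n.+1%:R^-1)[ : set (measurableTypeR R)) `*`
  (`](ratr q - n.+1%:R^-1), (ratr q + n.+1%:R^-1)[ : set (measurableTypeR R)).

Lemma ratr_close (x e : R) : 0 < e -> exists q : rat, `|ratr q - x| < e.
Proof.
move=> e0; have /rat_in_itvoo[q] : x - e < x + e by rewrite ltrBlDr -addrA ltrDl addr_gt0.
by rewrite in_itv/= => /andP[q1 q2]; exists q; rewrite ltr_norml; apply/andP; split; lra.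
Qed.

(** An open set is the union of the countably many rational boxes inside it, and boxes belong to the
    product sigma-algebra. Boxes that leave U are replaced by the empty set. *)
Lemma open_measurable_plane (U : set (plane R)) : open U -> measurable U.
Proof.
move=> oU.
pose F (i : rat * rat * nat) : set (plane R) :=
  if `[< rbox i.1.1 i.1.2 i.2 `<=` U >] then rbox i.1.1 i.1.2 i.2 else set0.
have -> : U = \bigcup_i F i.
  apply/seteqP; split => [x Ux|x [i _]]; last first.
    by rewrite /F; case: asboolP => // H; exact: H.
  move: (oU); rewrite openE => /(_ _ Ux) /nbhs_ballP[e /= e0 He].
  (* A box of half-width 1/(n+1) whose centre is that close to x reaches points at distance less
     than 2/(n+1) from x. *)
  have [n _ Hn] := nbhs_infty_gtr (2 / e).
  have n0 : 0 < n.+1%:R^-1 :> R by rewrite invr_gt0 ltr0n.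
  have ne : n.+1%:R^-1 < e / 2.
    rewrite -[ltRHS]invrK ltf_pV2 ?posrE ?ltr0n ?invr_gt0 ?divr_gt0// invf_div.
    by have := Hn n.+1 (leqnSn n).
  have [p Hp] := ratr_close x.1 n0; have [q Hq] := ratr_close x.2 n0.
  exists (p, q, n) => //; rewrite /F ifT.
    rewrite /rbox/=; move: (n.+1%:R^-1) n0 ne Hp Hq => d n0 ne.
    rewrite !ltr_norml => /andP[? ?] /andP[? ?].
    by split; rewrite /= in_itv/=; apply/andP; split; lra.
  apply/asboolP => z; rewrite /rbox; move: (n.+1%:R^-1) n0 ne Hp Hq => d n0 ne Hp Hq.
  move=> [/=]; rewrite !in_itv/= => /andP[? ?] /andP[? ?].
  move: Hp Hq; rewrite !ltr_norml => /andP[? ?] /andP[? ?].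
  by apply: He; split; rewrite /ball/= ltr_norml; apply/andP; split; lra.
apply: countable_bigcupT_measurable => // -[[p q] n]; rewrite /F.
by case: asboolP => // _; apply: measurableX; exact: measurable_itv.
Qed.

Lemma continuous_measurable_plane f : continuous f -> measurable_fun setT f.
Proof.
move=> cf; apply: (measurability _ (RGenOInfty.measurableE R)).
move=> /= _ [_ [a ->] <-]; rewrite setTI; apply: open_measurable_plane.
by apply: open_comp => // *; exact: cf.
Qed.

Definition sqbox (B : R) : set (plane R) := [set x | `|x.1| <= B /\ `|x.2| <= B].

Lemma sqboxE B : sqbox B = (`[(- B), B] : set (measurableTypeR R)) `*`
  (`[(- B), B] : set (measurableTypeR R)).
Proof.
by apply/seteqP; split => x; rewrite /sqbox/= !in_itv/= -!ler_norml => -[].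
Qed.

Lemma measurable_sqbox B : measurable (sqbox B).
Proof. by rewrite sqboxE; apply: measurableX; exact: measurable_itv. Qed.

Lemma leb2_sqbox B : (leb2 (sqbox B) < +oo)%E.
Proof.
rewrite sqboxE; set A := [set` _].
have -> : leb2 (A `*` A) = (@lebesgue_measure R A * @lebesgue_measure R A)%E.
  by apply: product_measure1E; exact: measurable_itv.
by rewrite lebesgue_measure_itv; case: ifP => _; rewrite ?mul0e// -EFinB -EFinM ltry.
Qed.

(** Coefficients of the operator fall in the first class and derivatives of test functions in the
    second; a product with one factor in the second class is integrable on the plane. *)
Definition bmeas f := measurable_fun setT f /\ exists C, forall x, `|f x| <= C.
Definition bsupp f := bmeas f /\ exists B, forall x, f x != 0 -> sqbox B x.

Lemma bmeasM f g : bmeas f -> bmeas g -> bmeas (fun x => f x * g x).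
Proof.
move=> [mf [C HC]] [mg [D HD]]; split; first exact: measurable_funM.
by exists (C * D) => x; rewrite normrM ler_pM.
Qed.

Lemma bmeasD f g : bmeas f -> bmeas g -> bmeas (fun x => f x + g x).
Proof.
move=> [mf [C HC]] [mg [D HD]]; split; first exact: measurable_funD.
by exists (C + D) => x; rewrite (le_trans (ler_normD _ _))// lerD.
Qed.

Lemma bmeas_cst c : bmeas (fun=> c).
Proof. by split; [exact: measurable_cst|exists `|c|]. Qed.

Lemma bsuppMl f g : bmeas f -> bsupp g -> bsupp (fun x => f x * g x).
Proof.
move=> bf [bg [B HB]]; split; first exact: bmeasM.
by exists B => x; rewrite mulf_eq0 negb_or => /andP[_ /HB].
Qed.

Lemma bsuppMr f g : bsupp f -> bmeas g -> bsupp (fun x => f x * g x).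
Proof.
move=> [bf [B HB]] bg; split; first exact: bmeasM.
by exists B => x; rewrite mulf_eq0 negb_or => /andP[/HB].
Qed.

Lemma bsuppD f g : bsupp f -> bsupp g -> bsupp (fun x => f x + g x).
Proof.
move=> [bf [B HB]] [bg [D HD]]; split; first exact: bmeasD.
exists (Num.max B D) => x fg0; have [f0|/HB[? ?]] := eqVneq (f x) 0.
  by move: fg0; rewrite f0 add0r => /HD[? ?]; split; rewrite le_max; apply/orP; right.
by split; rewrite le_max; apply/orP; left.
Qed.

Lemma bsupp0 : bsupp (fun=> 0).
Proof. by split; [exact: bmeas_cst|exists 0 => x; rewrite eqxx]. Qed.

Lemma bsupp_sum (I : finType) (F : I -> plane R -> R) :
  (forall i, bsupp (F i)) -> bsupp (fun x => \sum_i F i x).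
Proof.
move=> H; rewrite (_ : (fun x => _) = \sum_(i <- enum I) F i); last first.
  by apply/funext => x; rewrite fct_sumE big_enum.
elim: (enum I) => [|i s IH]; first by rewrite big_nil; exact: bsupp0.
by rewrite big_cons; exact: bsuppD.
Qed.

Lemma bsupp_integrable f : bsupp f -> leb2.-integrable setT (EFin \o f).
Proof.
move=> [[mf [C HC]] [B HB]].
have -> : EFin \o f = (EFin \o f) \_ (sqbox B).
  apply/funext => x; rewrite patchE/=; have [//|] := boolP (x \in sqbox B).
  rewrite notin_setE => nB; congr EFin; apply/eqP; apply: contrapT => /negP.
  by move=> /HB.
have /(integrable_mkcond (mu := leb2) (EFin \o f)) [+ _] := measurable_sqbox B; apply.
apply: measurable_bounded_integrable => //.
- exact: measurable_sqbox.
- exact: leb2_sqbox.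
- exact: measurable_funTS.
- exists C; split; first by rewrite num_real.
  by move=> M CM x _ /=; rewrite (le_trans (HC x))// ltW.
Qed.

Lemma Rintegral_sum_bsupp (I : finType) (F : I -> plane R -> R) :
  (forall i, bsupp (F i)) ->
  \int[leb2]_(x in setT) (\sum_i F i x) = \sum_i \int[leb2]_(x in setT) F i x.
Proof.
move=> H.
transitivity (\int[leb2]_(x in setT) (\sum_(i <- enum I) F i x)).
  by apply: eq_Rintegral => x _; rewrite big_enum.
rewrite -[RHS]big_enum/=.
have Hs (s : seq I) : bsupp (fun x => \sum_(i <- s) F i x).
  elim: s => [|i s IH].
    by rewrite (_ : (fun x => _) = (fun=> 0)); [exact: bsupp0|apply/funext => x; rewrite big_nil].
  rewrite (_ : (fun x => _) = (fun x => F i x + \sum_(i <- s) F i x)).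
    exact: bsuppD.
  by apply/funext => x; rewrite big_cons.
elim: (enum I) => [|i s IH].
  rewrite big_nil; under eq_Rintegral do rewrite big_nil.
  by rewrite Rintegral_cst// mul0r.
rewrite big_cons -IH; under eq_Rintegral do rewrite big_cons.
by rewrite RintegralD//; exact: bsupp_integrable.
Qed.

Lemma C_k_supp_derive f h x (K : set (plane R)) : closed K ->
  (forall x, f x != 0 -> K x) -> ~ K x -> 'D_(basis2 h) f x = 0.
Proof.
move=> cK fK nK; have H : is_derive x (basis2 h) f 0.
  apply: near_eq_is_derive (is_derive_cst (0:R) x (basis2 h)).
  have : \near x, (~` K) x by apply: open_nbhs_nbhs; split => //; exact: closed_openC.
  apply: filterS => y nKy; apply/esym/eqP; apply: contrapT => /negP /fK.
  exact: nKy.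
by case: H.
Qed.

Lemma closed_sqbox B : closed (sqbox B).
Proof.
rewrite (_ : sqbox B = [set x : plane R | `|x.1| <= B] `&` [set x | `|x.2| <= B])//.
apply: closedI.
  apply: (@closed_comp _ _ (fun x : plane R => `|x.1|) [set t | t <= B]); last exact: closed_le.
  by move=> x _; apply: continuous_comp; [exact: cvg_fst|exact: norm_continuous].
apply: (@closed_comp _ _ (fun x : plane R => `|x.2|) [set t | t <= B]); last exact: closed_le.
by move=> x _; apply: continuous_comp; [exact: cvg_snd|exact: norm_continuous].
Qed.

Lemma compact_sqbox B : compact (sqbox B).
Proof. by rewrite sqboxE; apply: compact_setX; exact: segment_compact. Qed.

Lemma C0_bsupp f B : continuous f -> (forall x, f x != 0 -> sqbox B x) -> bsupp f.
Proof.
move=> cf fB; split; last by exists B.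
split; first exact: continuous_measurable_plane.
have /compact_bounded [M [_ /(_ (`|M| + 1)) H]] : compact (f @` sqbox B).
  apply: continuous_compact => //; first exact: continuous_subspaceT.
  exact: compact_sqbox.
exists (`|M| + 1) => x; have [->|/fB fx] := eqVneq (f x) 0.
  by rewrite normr0 addr_ge0.
apply: H; first by rewrite (le_lt_trans (ler_norm _))// ltrDl.
by exists x.
Qed.

Lemma C1_bsupp_derive f B h : C_k 1 f -> (forall x, f x != 0 -> sqbox B x) ->
  bsupp (fun x => 'D_(basis2 h) f x).
Proof.
move=> /C_kS_derive cf fB; apply: (@C0_bsupp _ B); first exact: cf.
move=> x; apply: contra_neqP; apply: C_k_supp_derive fB.
exact: closed_sqbox.
Qed.

End PlaneMeasure.

(** * Integration by parts on the plane *)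

Section IntegralOfDerivative.
Context {R : realType}.
Implicit Types (f g : plane R -> R) (x : plane R).

Lemma integral_derive_supp1 (g dg : R -> R) (B : R) :
  (forall s : R, is_derive s 1 g (dg s)) -> continuous dg ->
  (forall s, g s != 0 -> `|s| <= B) ->
  (\int[@lebesgue_measure R]_(s in setT) (dg s)%:E = 0)%E.
Proof.
(* B may be negative; this B' is positive and exceeds B, so g vanishes at both ends of
   [- B', B']. *)
move=> hg cdg gB; pose B' := `|B| + 1.
have B'B : B < B' by rewrite (le_lt_trans (ler_norm _))// ltrDl.
have g0 s : B < `|s| -> g s = 0.
  move=> Bs; apply/eqP; apply: contrapT => /negP /gB; rewrite leNgt.
  by rewrite Bs.
have dg0 s : B < `|s| -> dg s = 0.
  move=> Bs; have H : is_derive s 1 g 0.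
    apply: near_eq_is_derive (is_derive_cst (0:R) s 1).
    have : \near s, B < `|s|.
      apply: (open_nbhs_nbhs (A := (fun s : R => `|s|) @^-1` [set t | B < t])); split => //.
      by apply: open_comp; [move=> + _; exact: norm_continuous|exact: open_gt].
    by apply: filterS => t Bt; rewrite g0.
  by have [_ <-] := hg s; case: H.
have -> : (fun s => (dg s)%:E) = (fun s => (dg s)%:E) \_ `[- B', B'].
  apply/funext => s; rewrite patchE/=; have [//|] := boolP (s \in `[- B', B']%classic).
  rewrite notin_setE/= in_itv/= -ler_norml => /negP; rewrite -ltNge => sB.
  by rewrite dg0// (lt_trans B'B).
rewrite -integral_mkcond (@continuous_FTC2 _ dg g).
- have B'n : B < `|B'| by rewrite (lt_le_trans B'B)// ler_norm.
  by rewrite !g0 ?normrN// sube0.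
- by rewrite -subr_gt0 opprK addr_gt0// ltr_wpDl.
- exact: continuous_subspaceT.
- have cg : continuous g.
    by move=> s; apply/differentiable_continuous/derivable1_diffP; case: (hg s).
  split; first by move=> s _; case: (hg s).
    by apply: cvg_at_right_filter; exact: cg.
  by apply: cvg_at_left_filter; exact: cg.
- by move=> s _; rewrite derive1E; case: (hg s).
Qed.

Lemma continuous_section f (y : R) : continuous f ->
  continuous (fun s : R => f (s, y)) /\ continuous (fun s : R => f (y, s)).
Proof.
move=> cf; split => s.
  have cp : {for s, continuous (fun s : R => (s, y) : plane R)}.
    move=> A; apply: (cvg_pair (G := nbhs s) (H := nbhs y) (f := id) (g := fun=> y)); [exact: cvg_id|exact: cvg_cst].
  exact: (@continuous_comp _ _ _ (fun s : R => (s, y) : plane R) f s cp (cf (s, y))).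
have cp : {for s, continuous (fun s : R => (y, s) : plane R)}.
  move=> A; apply: (cvg_pair (G := nbhs y) (H := nbhs s) (f := fun=> y) (g := id)); [exact: cvg_cst|exact: cvg_id].
exact: (@continuous_comp _ _ _ (fun s : R => (y, s) : plane R) f s cp (cf (y, s))).
Qed.

(** Fubini's theorem is applied in the order whose inner integral runs along the axis h; that
    integral is 0 by the fundamental theorem of calculus. *)
Lemma Rintegral_derive0 f (B : R) h : C_k 1 f -> (forall x, f x != 0 -> sqbox B x) ->
  \int[leb2]_(x in setT) ('D_(basis2 h) f x) = 0.
Proof.
move=> hf fB; rewrite /Rintegral.
have intf := bsupp_integrable (C1_bsupp_derive h hf fB).
have cdf : continuous (fun x => 'D_(basis2 h) f x) by exact: C_kS_derive hf.
have [hE|hE] := ord2_cases h.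
- rewrite -(integral21_prod_meas1 intf) /fubini_G (eq_integral (fun=> 0%E)).
    by rewrite integral0.
  move=> y _ /=; apply: (@integral_derive_supp1 (fun s => f (s, y)) _ B).
  + by move=> s; apply: (is_derive_xline (x := (s, y))); rewrite hE; exact: C_kS_is_derive hf.
  + exact: (continuous_section y cdf).1.
  + by move=> s /fB[].
- rewrite -(integral12_prod_meas1 intf) /fubini_F (eq_integral (fun=> 0%E)).
    by rewrite integral0.
  move=> y _ /=; apply: (@integral_derive_supp1 (fun s => f (y, s)) _ B).
  + by move=> s; apply: (is_derive_yline (x := (y, s))); rewrite hE; exact: C_kS_is_derive hf.
  + exact: (continuous_section y cdf).2.
  + by move=> s /fB[].
Qed.

Lemma Rintegral_supp (D : set (plane R)) f : (forall x, f x != 0 -> D x) ->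
  \int[leb2]_(x in D) f x = \int[leb2]_(x in setT) f x.
Proof.
move=> fD; rewrite Rintegral_mkcond; apply: eq_Rintegral => x _.
rewrite patchE; have [//|] := boolP (x \in D).
by rewrite notin_setE => nD; apply/esym/eqP; apply: contrapT => /negP /fD.
Qed.

Lemma Re_mulc (z w : R[i]) : complex.Re (z * w) =
  complex.Re z * complex.Re w - complex.Im z * complex.Im w.
Proof. by case: z; case: w. Qed.

Lemma Im_mulc (z w : R[i]) : complex.Im (z * w) =
  complex.Re z * complex.Im w + complex.Im z * complex.Re w.
Proof. by case: z; case: w. Qed.

Lemma Re_subc (z w : R[i]) : complex.Re (z - w) = complex.Re z - complex.Re w.
Proof. by case: z; case: w. Qed.

Lemma Im_subc (z w : R[i]) : complex.Im (z - w) = complex.Im z - complex.Im w.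
Proof. by case: z; case: w. Qed.

Lemma complex_neq0 (z : R[i]) : z != 0 -> complex.Re z != 0 \/ complex.Im z != 0.
Proof.
move=> z0; have [r0|r0] := eqVneq (complex.Re z) 0; [right|by left].
by apply: contra_neq z0; case: z r0 => /= a b -> ->.
Qed.

Lemma C1_weak_gradient (Omega K : set (plane R)) (f : plane R -> R[i]) B :
  closed K -> K `<=` Omega -> K `<=` sqbox B ->
  C_k 1 (cre f) -> C_k 1 (cim f) -> (forall x, f x != 0 -> K x) ->
  weak_gradient Omega f (fun h => cpartial h f).
Proof.
move=> cK KO KB hre him fK h psi [/(_ 1%N) pre /(_ 1%N) pim _ _].
have reK x : cre f x != 0 -> K x.
  by move=> fx; apply: fK; apply: contra_neq fx; rewrite /cre => ->.
have imK x : cim f x != 0 -> K x.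
  by move=> fx; apply: fK; apply: contra_neq fx; rewrite /cim => ->.
have f0 x : ~ K x -> cre f x = 0 /\ cim f x = 0.
  by move=> nK; split; apply/eqP; apply: contrapT => /negP; [move=> /reK|move=> /imK].
have df0 x : ~ K x -> 'D_(basis2 h) (cre f) x = 0 /\ 'D_(basis2 h) (cim f) x = 0.
  by move=> nK; split; apply: (C_k_supp_derive h cK _ nK).
(* The real and imaginary parts of f times the derivative of psi both have the form a c' - b d'; for
   the imaginary part b is - Im f and d is Re psi. The support K of f bounds every product, whatever
   the support of psi. *)
have key (a b c d : plane R -> R) : C_k 1 a -> C_k 1 b -> C_k 1 c -> C_k 1 d ->
    (forall x, a x != 0 -> K x) -> (forall x, b x != 0 -> K x) ->
    \int[leb2]_(x in Omega) (a x * 'D_(basis2 h) c x - b x * 'D_(basis2 h) d x) =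
    - \int[leb2]_(x in Omega) ('D_(basis2 h) a x * c x - 'D_(basis2 h) b x * d x).
  move=> ha hb hc hd aK bK.
  have a0 x : ~ K x -> a x = 0 by move=> nK; apply/eqP; apply: contrapT => /negP /aK.
  have b0 x : ~ K x -> b x = 0 by move=> nK; apply/eqP; apply: contrapT => /negP /bK.
  have da0 x : ~ K x -> 'D_(basis2 h) a x = 0 by exact: C_k_supp_derive.
  have db0 x : ~ K x -> 'D_(basis2 h) b x = 0 by exact: C_k_supp_derive.
  rewrite !(@Rintegral_supp Omega); first last.
  - by move=> x Fx; apply: KO; apply: contrapT => nK; move: Fx; rewrite a0// b0// !mul0r subrr eqxx.
  - by move=> x Fx; apply: KO; apply: contrapT => nK; move: Fx; rewrite da0// db0// !mul0r subrr eqxx.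
  have s1 : bsupp (fun x => a x * 'D_(basis2 h) c x - b x * 'D_(basis2 h) d x).
    apply: (@C0_bsupp _ _ B).
      apply: (@C_kB _ 0); apply: (@C_kM _ 0); [exact: C_kW|exact: C_kS_derive|exact: C_kW|exact: C_kS_derive].
    by move=> x Fx; apply: KB; apply: contrapT => nK; move: Fx; rewrite a0// b0// !mul0r subrr eqxx.
  have s2 : bsupp (fun x => 'D_(basis2 h) a x * c x - 'D_(basis2 h) b x * d x).
    apply: (@C0_bsupp _ _ B).
      apply: (@C_kB _ 0); apply: (@C_kM _ 0); [exact: C_kS_derive|exact: C_kW|exact: C_kS_derive|exact: C_kW].
    by move=> x Fx; apply: KB; apply: contrapT => nK; move: Fx; rewrite da0// db0// !mul0r subrr eqxx.
  apply/eqP; rewrite -addr_eq0 -RintegralD//; [|exact: bsupp_integrable..].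
  rewrite -[eqbRHS](@Rintegral_derive0 (fun x => a x * c x - b x * d x) B h).
  - apply/eqP; apply: eq_Rintegral => x _.
    have H := is_deriveB (is_deriveM (C_kS_is_derive h x ha) (C_kS_is_derive h x hc))
      (is_deriveM (C_kS_is_derive h x hb) (C_kS_is_derive h x hd)).
    transitivity (a x *: 'D_(basis2 h) c x + c x *: 'D_(basis2 h) a x
      - (b x *: 'D_(basis2 h) d x + d x *: 'D_(basis2 h) b x)).
      by rewrite /GRing.scale/=; ring.
    by case: H.
  - by apply: C_kB; apply: C_kM.
  - by move=> x Fx; apply: KB; apply: contrapT => nK; move: Fx; rewrite a0// b0// !mul0r subrr eqxx.
rewrite /cintegral; apply/eqP; rewrite eq_complex/=; apply/andP; split; apply/eqP.
  transitivity (\int[leb2]_(x in Omega) (cre f x * 'D_(basis2 h) (cre psi) x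
     - cim f x * 'D_(basis2 h) (cim psi) x)).
    by apply: eq_Rintegral => x _; rewrite /cre Re_mulc.
  rewrite key//; congr (- _); apply: eq_Rintegral => x _.
  by rewrite [RHS]/cre Re_mulc.
transitivity (\int[leb2]_(x in Omega) (cre f x * 'D_(basis2 h) (cim psi) x
     - (-1 * cim f x) * 'D_(basis2 h) (cre psi) x)).
  by apply: eq_Rintegral => x _; rewrite /cim Im_mulc/= mulN1r mulNr opprK.
rewrite key//; [congr (- _); apply: eq_Rintegral => x _|exact: C_kZ|].
  rewrite [RHS]/cim Im_mulc/=.
  have -> : 'D_(basis2 h) (fun x0 => -1 * cim f x0) x = -1 * 'D_(basis2 h) (cim f) x.
    by case: (is_deriveZ (-1) (C_kS_is_derive h x him)).
  by rewrite mulN1r mulNr opprK.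
by move=> x; rewrite mulN1r oppr_eq0 => /imK.
Qed.

End IntegralOfDerivative.

(** * Functions in the closure of the test functions *)

Section Sobolev.
Context {R : realType}.
Implicit Types (Omega K : set (plane R)) (f : plane R -> R[i]).

Lemma normc_sqr (z : R[i]) : Normc.normc z ^+ 2 = complex.Re z ^+ 2 + complex.Im z ^+ 2.
Proof. by case: z => a b; rewrite sqr_sqrtr// addr_ge0// sqr_ge0. Qed.

(** This converts uniform closeness of functions living in one fixed box into closeness in L^2, and
    so C^1 approximation into H^1 approximation. *)
Lemma LpNorm2_le Omega f (B C : R) : measurable Omega ->
  measurable_fun Omega (cre f) -> measurable_fun Omega (cim f) ->
  (forall x, Omega x -> f x != 0 -> sqbox B x) ->
  (forall x, `|cre f x| <= C /\ `|cim f x| <= C) ->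
  (LpNorm Omega 2%:E f ^+ 2 <= (2 * C ^+ 2 * fine (@leb2 R (sqbox B)))%:E)%E.
Proof.
move=> mO mre mim fB fC; set N := LpNorm _ _ _.
have N0 : (0 <= N)%E by exact: Lnorm_ge0.
have C0 : 0 <= C by rewrite (le_trans _ (fC (0, 0)).1).
have : (N `^ 2 <= (2 * C ^+ 2 * fine (@leb2 R (sqbox B)))%:E)%E.
  rewrite /N /LpNorm powR_Lnorm// EFinM fineK; last first.
    by rewrite ge0_fin_numE// leb2_sqbox.
  rewrite -integral_cst//; last exact: measurable_sqbox.
  rewrite [leRHS]integral_mkcond; apply: ge0_le_integral => //.
  - by move=> x _; exact: poweR_ge0.
  - apply: (measurableT_comp (measurable_poweR _)).
    apply: (measurableT_comp (@abse_measurable _ _)).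
    apply/(measurable_restrictT _ mO); apply/measurable_EFinP.
    rewrite (_ : (fun x => _) = (fun x => Num.sqrt (cre f x ^+ 2 + cim f x ^+ 2))).
      apply: (measurableT_comp (continuous_measurable_fun (@sqrt_continuous R))).
      by apply: measurable_funD; exact: measurable_funX.
    by apply/funext => x; rewrite /cre /cim; case: (f x).
  - apply/(measurable_restrictT _ (measurable_sqbox B)); exact: measurable_cst.
  - move=> x _; rewrite !patchE; have [xO|xO] := boolP (x \in Omega); last first.
      by rewrite abse0 poweR0r//; case: ifP => // _; rewrite lee_fin mulr_ge0 ?sqr_ge0.
    have [f0|f0] := eqVneq (f x) 0.
      by rewrite f0 Normc.normc0 abse0 poweR0r//; case: ifP => // _; rewrite lee_fin mulr_ge0 ?sqr_ge0.
    rewrite ifT; last by apply/mem_set/fB => //; exact: set_mem.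
    rewrite /= ?poweR_EFin lee_fin powR_mulrn// real_normK ?num_real// normc_sqr.
    have [h1 h2] := fC x; rewrite mulr_natl mulr2n lerD// -[leLHS]real_normK ?num_real//.
      by rewrite lerXn2r ?nnegrE.
    by rewrite lerXn2r ?nnegrE.
case: N N0 => [r||]//; last by rewrite poweRyr ?leye_eq.
by rewrite lee_fin => r0; rewrite poweR_EFin powR_mulrn// -EFin_expe.
Qed.

Lemma bsupp_in_Lp Omega f : measurable Omega -> bsupp (cre f) -> bsupp (cim f) ->
  in_Lp Omega 2%:E f.
Proof.
move=> mO [[m1 [C1 H1]] [B1 HB1]] [[m2 [C2 H2]] [B2 HB2]].
have n1 : measurable_fun Omega (cre f) by exact: measurable_funTS.
have n2 : measurable_fun Omega (cim f) by exact: measurable_funTS.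
split => //.
have fB x : Omega x -> f x != 0 -> sqbox (Num.max B1 B2) x.
  by move=> _ /complex_neq0[/HB1|/HB2] [h1 h2]; split; rewrite le_max ?h1 ?h2 ?orbT.
have fC x : `|cre f x| <= Num.max C1 C2 /\ `|cim f x| <= Num.max C1 C2.
  by split; rewrite le_max ?H1 ?H2 ?orbT.
have H := LpNorm2_le mO n1 n2 fB fC; move: (le_lt_trans H (ltry _)).
have : (0 <= LpNorm Omega 2%:E f)%E by exact: Lnorm_ge0.
by case: (LpNorm _ _ _) => [r _ _||]//; rewrite ltry.
Qed.

(** The C^1 closure of the smooth functions vanishing off K. All approximants share the same K, so
    for closed bounded K inside Omega they are test functions on Omega and uniform errors give L^2
    errors. *)
Definition smooth_lim K (f : plane R -> R) := [/\ C_k 1 f,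
  forall x, f x != 0 -> K x &
  forall eps : R, 0 < eps -> exists p : plane R -> R,
    [/\ forall k, C_k k p, forall x, p x != 0 -> K x &
     forall x, `|f x - p x| <= eps /\
       forall h, `|'D_(basis2 h) f x - 'D_(basis2 h) p x| <= eps]].

Lemma smooth_lim_smooth K (f : plane R -> R) : (forall k, C_k k f) ->
  (forall x, f x != 0 -> K x) -> smooth_lim K f.
Proof.
move=> hf fK; split => // eps e0; exists f; split => // x.
by split=> [|h]; rewrite subrr normr0 ltW.
Qed.

Lemma derive_basisD (f g : plane R -> R) x h : C_k 1 f -> C_k 1 g ->
  'D_(basis2 h) (fun x => f x + g x) x = 'D_(basis2 h) f x + 'D_(basis2 h) g x.
Proof.
move=> hf hg.
by case: (is_deriveD (C_kS_is_derive h x hf) (C_kS_is_derive h x hg)).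
Qed.

Lemma derive_basisZ (c : R) (f : plane R -> R) x h : C_k 1 f ->
  'D_(basis2 h) (fun x => c * f x) x = c * 'D_(basis2 h) f x.
Proof. by move=> hf; case: (is_deriveZ c (C_kS_is_derive h x hf)). Qed.

Lemma derive_basisM (f g : plane R -> R) x h : C_k 1 f -> C_k 1 g ->
  'D_(basis2 h) (fun x => f x * g x) x =
  f x * 'D_(basis2 h) g x + g x * 'D_(basis2 h) f x.
Proof.
move=> hf hg.
by case: (is_deriveM (C_kS_is_derive h x hf) (C_kS_is_derive h x hg)).
Qed.

Lemma smooth_limD K (f g : plane R -> R) : smooth_lim K f -> smooth_lim K g ->
  smooth_lim K (fun x => f x + g x).
Proof.
have supp (a b : plane R -> R) : (forall x, a x != 0 -> K x) -> (forall x, b x != 0 -> K x) ->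
    forall x, a x + b x != 0 -> K x.
  move=> aK bK x; have [->|/aK//] := eqVneq (a x) 0.
  by rewrite add0r => /bK.
move=> [hf fK fa] [hg gK ga]; split; [exact: C_kD|exact: supp|].
move=> e e0; have e20 : 0 < e / 2 by rewrite divr_gt0.
have [p [sp pK Hp]] := fa _ e20; have [q [sq qK Hq]] := ga _ e20.
exists (fun x => p x + q x); split; [by move=> k; exact: C_kD|exact: supp|].
move=> x; split=> [|h].
  rewrite opprD addrACA (le_trans (ler_normD _ _))// [leRHS]splitr lerD//.
    exact: (Hp x).1.
  exact: (Hq x).1.
rewrite !derive_basisD// opprD addrACA (le_trans (ler_normD _ _))// [leRHS]splitr lerD//.
  exact: (Hp x).2.
exact: (Hq x).2.
Qed.

Lemma smooth_limZ K (c : R) (f : plane R -> R) : smooth_lim K f ->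
  smooth_lim K (fun x => c * f x).
Proof.
have supp (a : plane R -> R) : (forall x, a x != 0 -> K x) ->
    forall x, c * a x != 0 -> K x.
  by move=> aK x; rewrite mulf_eq0 negb_or => /andP[_ /aK].
move=> [hf fK fa]; split; [exact: C_kZ|exact: supp|].
move=> e e0; have d0 : 0 < e / (`|c| + 1) by rewrite divr_gt0// ltr_wpDl.
have [p [sp pK Hp]] := fa _ d0.
have est (t : R) : `|t| <= e / (`|c| + 1) -> `|c * t| <= e.
  move=> te; rewrite normrM (@le_trans _ _ ((`|c| + 1) * (e / (`|c| + 1))))//.
    by rewrite ler_pM// lerDl.
  by rewrite mulrC divfK// gt_eqF// ltr_wpDl.
exists (fun x => c * p x); split; [by move=> k; exact: C_kZ|exact: supp|].
move=> x; split=> [|h]; first by rewrite -mulrBr est//; exact: (Hp x).1.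
by rewrite !derive_basisZ// -mulrBr est//; exact: (Hp x).2.
Qed.

(** A polynomial p close to g in C^1 on the range of s is composed with s. The gradient error is the
    error of p' times the gradient of s, so accuracy e / D suffices, with D a bound of that
    gradient; D is taken at least 1 to cover the values too. From p 0 = g 0 = 0 the support stays in
    K. *)
Lemma smooth_lim_comp K (s : plane R -> R) (g dg : R -> R) B :
  (forall k, C_k k s) -> (forall x, s x != 0 -> K x) -> K `<=` sqbox B ->
  (forall y : R, is_derive y 1 g (dg y)) -> continuous dg -> g 0 = 0 ->
  smooth_lim K (g \o s).
Proof.
move=> hs sK KB hg cdg g0.
have supp (a : R -> R) : a 0 = 0 -> forall x, (a \o s) x != 0 -> K x.
  by move=> a0 x; have [/= ->|/sK//] := eqVneq (s x) 0; rewrite a0 eqxx.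
have hs1 := hs 1%N.
split; [exact: C1_comp hg cdg|exact: supp|].
have sB x : s x != 0 -> sqbox B x by move=> /sK /KB.
have [[_ [M HM]] _] := C0_bsupp (C_k_continuous hs1) sB.
have [D D1 HD] : exists2 D : R, 1 <= D & forall x h, `|'D_(basis2 h) s x| <= D.
  have [[_ [D0 H0]] _] := C1_bsupp_derive ord0 hs1 sB.
  have [[_ [D1 H1]] _] := C1_bsupp_derive (lift ord0 ord0) hs1 sB.
  exists (Num.max 1 (Num.max D0 D1)); first by rewrite le_max lexx.
  move=> x h; have [->|->] := ord2_cases h.
    by rewrite !le_max H0 orbT.
  by rewrite !le_max H1 !orbT.
have D0 : 0 < D by rewrite (lt_le_trans ltr01).
have M'0 : 0 < `|M| + 1 by rewrite ltr_wpDl.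
move=> e e0; have d0 : 0 < e / D by rewrite divr_gt0.
have [p [p0 Hp]] := C1_poly_approx hg cdg M'0 d0.
have sM x : `|s x| <= `|M| + 1.
  by rewrite (le_trans (HM x))// (le_trans (ler_norm _))// lerDl.
exists (horner p \o s); split.
- by move=> k; apply: smooth1_comp; [exact: hs|exact: smooth1_poly].
- by apply: supp; rewrite p0.
move=> x; have [h1 h2] := Hp _ (sM x); split.
  by rewrite /= distrC (le_trans h1)// ler_pdivrMr// ler_peMr// ltW.
move=> h; have Ds := C_kS_is_derive h x hs1.
have [_ ->] := is_derive_chain Ds (hg (s x)).
have [_ ->] := is_derive_chain Ds (is_derive_poly p (s x)).
rewrite -mulrBl normrM distrC (@le_trans _ _ (e / D * D))//.
  by rewrite ler_pM.
by rewrite divfK// gt_eqF.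
Qed.

Lemma H1_0_smooth_lim Omega K f (B : R) : open Omega -> closed K ->
  K `<=` Omega -> K `<=` sqbox B ->
  smooth_lim K (cre f) -> smooth_lim K (cim f) ->
  H1_0 Omega f (fun h => cpartial h f).
Proof.
move=> oO cK KO KB [h1 k1 a1] [h2 k2 a2].
have mO := open_measurable_plane oO.
have fK x : f x != 0 -> K x by move=> /complex_neq0[/k1|/k2].
have b1 : bsupp (cre f).
  by apply: (@C0_bsupp _ _ B (C_k_continuous h1)) => x /k1 /KB.
have b2 : bsupp (cim f).
  by apply: (@C0_bsupp _ _ B (C_k_continuous h2)) => x /k2 /KB.
have d1 h : bsupp (fun x => 'D_(basis2 h) (cre f) x).
  by apply: (@C1_bsupp_derive _ _ B) => // x /k1 /KB.
have d2 h : bsupp (fun x => 'D_(basis2 h) (cim f) x).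
  by apply: (@C1_bsupp_derive _ _ B) => // x /k2 /KB.
split.
  split; [exact: bsupp_in_Lp|by move=> h; apply: bsupp_in_Lp => //; [exact: d1|exact: d2]|].
  exact: (@C1_weak_gradient _ _ K _ B).
move=> eps e0.
pose mu := fine (@leb2 R (sqbox B)).
have mu0 : 0 <= mu by rewrite fine_ge0.
(* The squared H^1 norm has three terms, the function and two partials, each at most 2 d^2 mu. As d
   <= 1, d^2 <= d, and the added 1 in the denominator makes the inequality strict even when mu =
   0. *)
pose d := Num.min 1 (eps ^+ 2 / (6 * mu + 1)).
have mu1 : 0 < 6 * mu + 1 by rewrite ltr_wpDl// mulr_ge0.
have d0 : 0 < d by rewrite lt_min ltr01 divr_gt0// exprn_gt0.
have dmu : 6 * (d ^+ 2 * mu) < eps ^+ 2.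
  have dd : d ^+ 2 <= d by rewrite expr2 ler_piMl// ?(ltW d0)// ge_min lexx.
  have de : d * (6 * mu + 1) <= eps ^+ 2 by rewrite -ler_pdivlMr// ge_min lexx orbT.
  by nra.
have [p1 [s1 q1 H1]] := a1 _ d0; have [p2 [s2 q2 H2]] := a2 _ d0.
pose psi x := p1 x +i* p2 x.
have psiK : [set x | psi x != 0] `<=` K.
  by move=> x /complex_neq0[/q1|/q2].
have clK : closure [set x | psi x != 0] `<=` K.
  by rewrite (closure_id K).1//; exact: closureS.
exists psi; split.
  split; [exact: s1|exact: s2| |exact: subset_trans clK KO].
  apply: (subclosed_compact _ (@compact_sqbox R B)); first exact: closed_closure.
  exact: subset_trans clK KB.
have mc (k : nat) (p : plane R -> R) : C_k k p -> measurable_fun setT p.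
  by move=> /C_k_continuous; exact: continuous_measurable_plane.
have suppD (g : plane R -> R[i]) : (forall x, ~ K x -> g x = 0) ->
    forall x, Omega x -> g x != 0 -> sqbox B x.
  by move=> g0 x _ gx; apply: KB; apply: contrapT => nK; move: gx; rewrite g0// eqxx.
have f0 x : ~ K x -> f x = 0 by move=> nK; apply/eqP; apply: contrapT => /negP /fK.
have psi0 x : ~ K x -> psi x = 0.
  by move=> nK; apply/eqP; apply: contrapT => /negP /psiK.
have Df0 x h : ~ K x -> cpartial h f x = 0.
  by move=> nK; rewrite /cpartial !(C_k_supp_derive _ cK _ nK).
have Dpsi0 x h : ~ K x -> cpartial h psi x = 0.
  by move=> nK; rewrite /cpartial !(C_k_supp_derive _ cK _ nK).
have N0 : (LpNorm Omega 2%:E (fun x => f x - psi x)%R ^+ 2 <= (2 * d ^+ 2 * mu)%:E)%E.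
  apply: LpNorm2_le => //.
  - rewrite (_ : cre _ = fun x => cre f x - p1 x); last by apply/funext => x; rewrite /cre Re_subc.
    by apply: measurable_funTS; apply: measurable_funB; [case: b1 => -[]|exact: mc (s1 0%N)].
  - rewrite (_ : cim _ = fun x => cim f x - p2 x); last by apply/funext => x; rewrite /cim Im_subc.
    by apply: measurable_funTS; apply: measurable_funB; [case: b2 => -[]|exact: mc (s2 0%N)].
  - by apply: suppD => x nK; rewrite f0// psi0// subrr.
  - by move=> x; rewrite /cre /cim Re_subc Im_subc; split; [exact: (H1 x).1|exact: (H2 x).1].
have Nh h : (LpNorm Omega 2%:E (fun x => cpartial h f x - cpartial h psi x)%R ^+ 2 <=
    (2 * d ^+ 2 * mu)%:E)%E.
  apply: LpNorm2_le => //.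
  - rewrite (_ : cre _ = fun x => 'D_(basis2 h) (cre f) x - 'D_(basis2 h) p1 x).
      apply: measurable_funTS; apply: measurable_funB; [by case: (d1 h) => -[]|].
      exact: mc (C_kS_derive h (s1 1%N)).
    by apply/funext => x; rewrite [LHS]/cre Re_subc.
  - rewrite (_ : cim _ = fun x => 'D_(basis2 h) (cim f) x - 'D_(basis2 h) p2 x).
      apply: measurable_funTS; apply: measurable_funB; [by case: (d2 h) => -[]|].
      exact: mc (C_kS_derive h (s2 1%N)).
    by apply/funext => x; rewrite [LHS]/cim Im_subc.
  - by apply: suppD => x nK; rewrite Df0// Dpsi0// subrr.
  - move=> x; rewrite [cre _ x]/cre [cim _ x]/cim Re_subc Im_subc.
    by split; [exact: (H1 x).2|exact: (H2 x).2].
rewrite /H1norm big_ord_recl big_ord1.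
set S := (_ + _)%E.
have S0 : (0 <= S)%E.
  by rewrite /S !adde_ge0// expe_ge0//; exact: Lnorm_ge0.
have Sle : (S <= (6 * (d ^+ 2 * mu))%:E)%E.
  rewrite (_ : 6 * (d ^+ 2 * mu) = 2 * d ^+ 2 * mu + (2 * d ^+ 2 * mu + 2 * d ^+ 2 * mu)); last by ring.
  by rewrite 2!EFinD; apply: leeD => //; apply: leeD.
have c0 : 0 <= 6 * (d ^+ 2 * mu) by rewrite !mulr_ge0// ltW.
apply: (@le_lt_trans _ _ ((6 * (d ^+ 2 * mu))%:E `^ 2^-1)%E).
  by apply: gt0_ler_poweR; rewrite ?in_itv/= ?S0 ?lee_fin ?c0 ?leey ?invr_ge0.
rewrite poweR_EFin powR12_sqrt// lte_fin -(@ltr_pXn2r _ 2)// ?nnegrE ?sqrtr_ge0 ?(ltW e0)//.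
by rewrite sqr_sqrtr.
Qed.

End Sobolev.

(** * Positivity almost everywhere *)

Section AlmostEverywherePositivity.
Context {R : realType}.
Local Notation leb := (@lebesgue_measure R).

Lemma ae_forall_count d (T : measurableType d) (mu : {measure set T -> \bar R})
    (I : countType) (P : I -> T -> Prop) :
  (forall i, {ae mu, forall x, P i x}) -> {ae mu, forall x, forall i, P i x}.
Proof.
move=> H; have : {ae mu, forall x n, if @unpickle I n is Some i then P i x else True}.
  apply: (ae_foralln (P := fun n x => if @unpickle I n is Some i then P i x else True)).
  move=> n; case: (unpickle n) => [i|]; first exact: H.
  exact: aeW.
by apply: filterS => x Hx i; move: (Hx (pickle i)); rewrite pickleK.
Qed.

Lemma bounded_itv_integrable (f : R -> R) (C s t : R) : measurable_fun setT f ->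
  (forall x, `|f x| <= C) -> leb.-integrable `]s, t[ (EFin \o f).
Proof.
move=> mf fC; apply: measurable_bounded_integrable => //.
- rewrite [ltLHS](@lebesgue_measure_itv R `]s, t[)/=.
  by case: ifP => _; rewrite -?EFinD ltry.
- exact: measurable_funTS.
- exists C; split; first by rewrite num_real.
  by move=> M CM x _ /=; rewrite (le_trans (fC x))// ltW.
Qed.

(** At a Lebesgue point where f is negative, a short interval around it with rational ends has a
    negative integral. *)
Lemma ae_ge0_itv (f : R -> R) (C : R) : measurable_fun setT f ->
  (forall x, `|f x| <= C) ->
  (forall s t : rat, 0 <= \int[leb]_(x in `]ratr s, ratr t[) f x) ->
  {ae leb, forall x, 0 <= f x}.
Proof.
move=> mf fC H.
have locf : locally_integrable setT f.
  split => //; first exact: openT.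
  move=> K _ cK; have mK := compact_measurable cK.
  rewrite (@le_lt_trans _ _ (\int[leb]_(x in K) C%:E)%E)//.
    apply: ge0_le_integral => //.
    - by apply/measurable_EFinP; apply: measurableT_comp => //; exact: measurable_funTS.
    - by move=> x _; rewrite lee_fin.
  rewrite integral_cst// lte_mul_pinfty ?lee_fin//.
    by rewrite (le_trans _ (fC 0)).
  exact: compact_finite_measure.
apply: (@filterS _ _ (ae_filter_ringOfSetsType leb) _ _ _ (lebesgue_differentiation locf)) => x xf.
rewrite leNgt; apply/negP => fx0.
pose e := - f x; have e0 : 0 < e by rewrite oppr_gt0.
have [r r0 Hr] : exists2 r : R, 0 < r &
    (\int[leb]_(y in ball x r) `|f y - f x|%:E <= (e * r / 4)%:E)%E.
  (* The ball has length 2 r, so a mean deviation of at most e / 8 is an integral of at most e r /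
     4. *)
  move: xf; rewrite /lebesgue_pt => /fine_cvgP[fin /cvgrPdist_le /(_ (e / 8))].
  have e8 : 0 < e / 8 by rewrite divr_gt0.
  move=> /(_ e8) cv.
  near (0:R)^'+ => r; have r0 : 0 < r by near: r; exact: nbhs_right_gt.
  exists r => //.
  have fr : davg f x r \is a fin_num by near: r.
  have : `|0 - fine (davg f x r)| <= e / 8 by near: r.
  rewrite sub0r normrN => /(le_trans (ler_norm _)); rewrite -lee_fin fineK//.
  rewrite /davg /iavg lebesgue_measure_ball ?(ltW r0)//.
  have r2 : 0 < r *+ 2 by rewrite pmulrn_lgt0.
  rewrite inver gt_eqF// lee_pdivrMl// -EFinM.
  by move=> /le_trans; apply; rewrite lee_fin -mulr_natr le_eqVlt; apply/orP; left; apply/eqP; field.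
(* The ends lie between r / 2 and r away from x: the interval stays in the ball and is longer than
   r, so the integral of f over it is less than e r / 4 - e r. *)
have [s] : exists s : rat, ratr s \in `]x - r, x - r / 2[ by apply: rat_in_itvoo; lra.
rewrite in_itv/= => /andP[h1 h2].
have [t] : exists t : rat, ratr t \in `]x + r / 2, x + r[ by apply: rat_in_itvoo; lra.
rewrite in_itv/= => /andP[h3 h4].
have fi : leb.-integrable `](ratr s), (ratr t)[ (EFin \o f).
  exact: bounded_itv_integrable fC.
have gi : leb.-integrable `](ratr s), (ratr t)[ (EFin \o (fun y => f y - f x)).
  apply: (@bounded_itv_integrable _ (C + `|f x|)).
    by apply: measurable_funB => //; exact: measurable_cst.
  by move=> y; rewrite (le_trans (ler_normB _ _))// lerD2r.
have ci : leb.-integrable `](ratr s), (ratr t)[ (EFin \o (fun=> f x)).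
  by apply: (@bounded_itv_integrable _ (`|f x|)) => //; exact: measurable_cst.
have st : ratr s < ratr t :> R by lra.
have tsr : r < ratr t - ratr s by lra.
have JB : `](ratr s), (ratr t)[ `<=` ball x r.
  move=> y /=; rewrite in_itv/= /ball/= => /andP[sy yt].
  by rewrite ltr_norml; apply/andP; split; lra.
have I1 : \int[leb]_(y in `](ratr s), (ratr t)[) (f y - f x) <= e * r / 4.
  rewrite (@le_trans _ _ (\int[leb]_(y in `](ratr s), (ratr t)[) `|f y - f x|))//.
    by rewrite (le_trans (ler_norm _))// le_normr_Rintegral.
  rewrite -lee_fin fineK; last first.
    by apply: integrable_fin_num => //; exact: (integrable_norm gi).
  apply: le_trans Hr; apply: ge0_subset_integral => //.
    exact: measurable_ball.
  apply/measurable_EFinP; apply: measurableT_comp => //; apply: measurable_funTS.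
  by apply: measurable_funB => //; exact: measurable_cst.
have fE : \int[leb]_(y in `](ratr s), (ratr t)[) f y =
    \int[leb]_(y in `](ratr s), (ratr t)[) (f y - f x) + f x * (ratr t - ratr s).
  have mE : leb `](ratr s), (ratr t)[%classic = ((ratr t - ratr s)%:E : \bar R).
    by rewrite [LHS](@lebesgue_measure_itv R `](ratr s), (ratr t)[)/= lte_fin st EFinB.
  rewrite RintegralB// (@Rintegral_cst _ _ _ leb)// [X in fine X]mE/=.
  by rewrite subrK.
move: (H s t); apply/negP; rewrite -ltNge fE.
have key (a d I : R) : 0 < - a -> I <= - a * r / 4 -> r < d -> I + a * d < 0.
  by clear -r0 => a0 Ia rd; nra.
exact: key.
Unshelve. all: by end_near. Qed.


Lemma bmeas_section (g : plane R -> R) (x : R) : bmeas g ->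
  measurable_fun setT (fun y : R => g (x, y)).
Proof.
move=> [mg _].
exact: (measurableT_comp mg (pair1_measurable (x : measurableTypeR R))).
Qed.

Definition rect (a b c d : R) : set (plane R) :=
  (`]a, b[ : set (measurableTypeR R)) `*` (`]c, d[ : set (measurableTypeR R)).

Lemma measurable_rect a b c d : measurable (rect a b c d).
Proof. by apply: measurableX; exact: measurable_itv. Qed.

Lemma bmeas_indic_fst (J : set (measurableTypeR R)) : measurable J ->
  bmeas (fun z : plane R => \1_J z.1 : R).
Proof.
move=> mJ; split; last by exists 1 => z; rewrite ger0_norm// indicE; case: (_ \in _).
rewrite (_ : (fun z => _) = \1_(J `*` setT)); last first.
  by apply/funext => z; rewrite !indicE in_setX in_setT andbT.
by apply: measurable_indic; apply: measurableX.
Qed.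

Lemma bmeas_indic_snd (J : set (measurableTypeR R)) : measurable J ->
  bmeas (fun z : plane R => \1_J z.2 : R).
Proof.
move=> mJ; split; last by exists 1 => z; rewrite ger0_norm// indicE; case: (_ \in _).
rewrite (_ : (fun z => _) = \1_(setT `*` J)); last first.
  by apply/funext => z; rewrite !indicE in_setX in_setT.
by apply: measurable_indic; apply: measurableX.
Qed.

(** The one-dimensional result is used twice: on x -> the integral of g (x, y) over y in a rational
    interval, and then on the section g (x, .) for almost every x. Rational ends keep the number of
    null sets countable between the two uses. *)
Lemma ae_ge0_rect (g : plane R -> R) : bsupp g ->
  (forall a b c d : rat,
     0 <= \int[leb2]_(z in rect (ratr a) (ratr b) (ratr c) (ratr d)) g z) ->
  {ae @leb2 R, forall z, 0 <= g z}.
Proof.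
move=> bg H; have [[mg [C gC]] [B gB]] := bg.
have C0 : 0 <= C by rewrite (le_trans _ (gC (0, 0))).
have sec : {ae leb, forall x : R, forall cd : rat * rat,
    0 <= \int[leb]_(y in `]ratr cd.1, ratr cd.2[) g (x, y)}.
  apply: ae_forall_count => -[c d] /=.
  pose J : set (measurableTypeR R) := `]ratr c, ratr d[%classic.
  have mJ : measurable J by exact: measurable_itv.
  pose gJ (z : plane R) := g z * \1_J z.2.
  have bJ : bmeas (fun z : plane R => \1_J z.2 : R).
    exact: (bmeas_indic_snd (measurable_itv _)).
  have bgJ : bsupp gJ by exact: bsuppMr.
  have igJ := bsupp_integrable bgJ.
  pose F x := \int[leb]_(y in J) g (x, y).
  have gJi x : leb.-integrable J (EFin \o (fun y : R => g (x, y))).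
    by apply: (@bounded_itv_integrable _ C) => //; exact: (bmeas_section _ bg.1).
  have FE x : fubini_F leb (EFin \o gJ) x = (F x)%:E.
    rewrite /F /Rintegral fineK; last by apply: (integrable_fin_num _ (gJi x)); exact: measurable_itv.
    rewrite /fubini_F [RHS]integral_mkcond; apply: eq_integral => y _ /=.
    rewrite patchE /gJ/= indicE.
    by case: (y \in J); rewrite ?mulr1 ?mulr0.
  apply: (@ae_ge0_itv F (C * fine (leb J))).
  - rewrite (_ : F = fine \o fubini_F leb (EFin \o gJ)).
      have mF := measurable_fubini_F igJ.
      exact: (measurableT_comp (fine_measurable measurableT) mF).
    by apply/funext => x /=; rewrite FE.
  - move=> x; rewrite /F -(Rintegral_cst leb (measurable_itv `]ratr c, ratr d[)).
    apply: (le_trans (le_normr_Rintegral mJ (gJi x))).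
    apply: le_Rintegral => //.
    - exact: (integrable_norm (gJi x)).
    - by apply: (@bounded_itv_integrable _ C) => // y; rewrite ger0_norm.
  - move=> a b; have := H a b c d; congr (0 <= _).
    pose I : set (measurableTypeR R) := `]ratr a, ratr b[%classic.
    pose gIJ (z : plane R) := gJ z * \1_I z.1.
    have bI : bmeas (fun z : plane R => \1_I z.1 : R).
      exact: (bmeas_indic_fst (measurable_itv _)).
    have bgIJ : bsupp gIJ by exact: bsuppMr.
    have igIJ := bsupp_integrable bgIJ.
    rewrite Rintegral_mkcond [RHS]Rintegral_mkcond.
    transitivity (\int[leb2]_(z in setT) gIJ z).
      apply: eq_Rintegral => z _; rewrite patchE /gIJ /gJ !indicE.
      have -> : (z \in rect (ratr a) (ratr b) (ratr c) (ratr d)) = (z.1 \in I) && (z.2 \in J).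
        by rewrite /rect in_setX.
      by case: (z.1 \in I); case: (z.2 \in J); rewrite /= ?mulr1 ?mulr0 ?mul0r.
    rewrite /Rintegral -(integral12_prod_meas1 igIJ); congr fine.
    apply: eq_integral => x _; rewrite /= patchE.
    have [xI|xI] := boolP (x \in I).
      rewrite -FE /fubini_F; apply: eq_integral => y _.
      by rewrite /= /gIJ/= indicE xI mulr1.
    rewrite /fubini_F (eq_integral (fun=> 0%E)) ?integral0// => y _.
    by rewrite /= /gIJ/= indicE (negbTE xI) mulr0.
have mN : measurable [set z | g z < 0].
  rewrite (_ : [set z | g z < 0] = setT `&` g @^-1` `]-oo, 0[).
    by apply: mg => //; exact: measurable_itv.
  by rewrite setTI; apply/seteqP; split => z /=; rewrite in_itv.
exists [set z | g z < 0]; split => //; last by move=> z /= /negP; rewrite -ltNge.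
suff : {ae leb, forall x, leb (xsection [set z | g z < 0] x) = 0%E}.
  move=> ae0.
  (* The product measure is by definition the integral of the measures of the sections, so almost
     all sections being null is enough. *)
  transitivity (\int[leb]_x (leb \o xsection [set z | (g z < 0)%R]) x)%E; first by [].
  rewrite -(integral0 leb setT); apply: ge0_ae_eq_integral => //.
    exact: measurable_fun_xsection.
  by apply: filterS ae0 => x /= -> _.
apply: (@filterS _ _ (ae_filter_ringOfSetsType leb) _ _ _ sec) => x Hx.
have [N [mN' N0 sN]] : {ae leb, forall y, 0 <= g (x, y)}.
  apply: (@ae_ge0_itv _ C) => [|y|s t]; [exact: (bmeas_section _ bg.1)|exact: gC|].
  exact: (Hx (s, t)).
apply/eqP; rewrite eq_le measure_ge0 andbT -N0 le_measure ?inE//.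
  exact: measurable_xsection.
move=> y; rewrite /xsection/= inE/= => gxy; apply: sN => /= H0.
by move: gxy; rewrite ltNge H0.
Qed.

End AlmostEverywherePositivity.

Section CoefficientCone.
Context {R : realType}.

(** The quantifier over c moves inside the almost-everywhere statement. Working with coefficient
    vectors, rather than with the parameters that produce them, reduces this to linearity in c and
    separability of a finite-dimensional space. *)
Lemma ae_ge0_cone (I : finType) (a : I -> plane R -> R) (G : (I -> R) -> Prop) :
  (forall i, bsupp (a i)) ->
  (forall c, G c -> forall p q s t : rat,
     0 <= \int[leb2]_(z in rect (ratr p) (ratr q) (ratr s) (ratr t))
            (\sum_i c i * a i z)) ->
  {ae @leb2 R, forall z, forall c, G c -> 0 <= \sum_i c i * a i z}.
Proof.
move=> ba H; have [[c0 Gc0]|nG] := pselect (exists c0, G c0); last first.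
  by apply: aeW => z c Gc; exfalso; apply: nG; exists c.
(* The values of D are dense in G, so countably many null sets suffice. *)
pose D (k : {ffun I -> rat} * nat) : I -> R :=
  xget c0 [set c | G c /\ forall i, `|c i - ratr (k.1 i)| < k.2.+1%:R^-1].
have GD k : G (D k).
  by rewrite /D; case: xgetP => [c _ []|].
have : {ae @leb2 R, forall z, forall k, 0 <= \sum_i D k i * a i z}.
  apply: ae_forall_count => k; apply: ae_ge0_rect; last exact: H.
  apply: bsupp_sum => i; apply: bsuppMl; [exact: bmeas_cst|exact: ba].
apply: filterS => z Hz c Gc; rewrite leNgt; apply/negP => c_lt0.
pose A := \sum_i `|a i z| + 1; pose e := - \sum_i c i * a i z.
have A0 : 0 < A by rewrite ltr_wpDl// sumr_ge0.
have e0 : 0 < e by rewrite oppr_gt0.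
have [n _ /(_ n.+1 (leqnSn n)) Hn] := nbhs_infty_gtr (2 * A / e).
have n0 : 0 < n.+1%:R^-1 :> R by rewrite invr_gt0 ltr0n.
have [q Hq] : exists q : {ffun I -> rat}, forall i, `|c i - ratr (q i)| < n.+1%:R^-1.
  have H1 i : exists q : rat, `|c i - ratr q| < n.+1%:R^-1.
    by have [q Hq] := ratr_close (c i) n0; exists q; rewrite distrC.
  by exists [ffun i => xchoose (H1 i)] => i; rewrite ffunE; exact: xchooseP (H1 i).
have close i : `|D (q, n) i - c i| <= 2 * n.+1%:R^-1.
  have [_ /(_ i) HD] : [set c | G c /\ forall i, `|c i - ratr (q i)| < n.+1%:R^-1] (D (q, n)).
    exact: (xgetPex c0 (ex_intro _ c (conj Gc Hq))).
  rewrite -(subrKA (ratr (q i))) (le_trans (ler_normD _ _))// mulr_natl mulr2n.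
  by rewrite lerD ?(ltW HD)// distrC ltW.
have := Hz (q, n); apply/negP; rewrite -ltNge.
rewrite (_ : \sum_i _ = \sum_i (D (q, n) i - c i) * a i z - e); last first.
  by rewrite opprK -big_split/=; apply: eq_bigr => i _; rewrite -mulrDl subrK.
rewrite subr_lt0 (@le_lt_trans _ _ (2 * n.+1%:R^-1 * A))//; last first.
  by rewrite mulrAC ltr_pdivrMr ?ltr0n// [ltRHS]mulrC -ltr_pdivrMr.
rewrite (@le_trans _ _ (\sum_i 2 * n.+1%:R^-1 * `|a i z|))//.
  apply: ler_sum => i _; rewrite (le_trans (ler_norm _))// normrM.
  by rewrite ler_wpM2r.
by rewrite -mulr_sumr ler_wpM2l ?mulr_ge0 ?(ltW n0)// lerDl.
Qed.

End CoefficientCone.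

(** * The function phi and the limit of Lambda *)

Section PhiCalculus.
Context {R : realType} (phi : R -> R) (hphi : phi_conditions phi).

Local Notation f := (fun s : R => s * phi s).
Local Notation df := (fun s : R => phi s + s * derive1 phi s).

Lemma phi_is_derive (s : R) : 0 < s -> is_derive s 1 phi (derive1 phi s).
Proof.
by move=> s0; rewrite derive1E; apply: derivableP; case: (phi_C1 hphi s0).
Qed.

Lemma sphi_is_derive (s : R) : 0 < s -> is_derive s 1 f (df s).
Proof.
move=> s0; apply: (is_derive_eq (is_deriveM (is_derive_id s 1) (phi_is_derive s0))).
by rewrite /GRing.scale/=; ring.
Qed.

Lemma sphi_derive1 (s : R) : 0 < s -> derive1 f s = df s.
Proof. by move=> s0; rewrite derive1E; case: (sphi_is_derive s0). Qed.

Lemma dsphi_gt0 (s : R) : 0 < s -> 0 < df s.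
Proof. by move=> s0; have := phi_incr hphi s0; rewrite sphi_derive1. Qed.

Lemma sphi_gt0 (s : R) : 0 < s -> 0 < f s.
Proof. by move=> s0; rewrite mulr_gt0//; exact: (phi_gt0 hphi). Qed.

Lemma phi_continuous (s : R) : 0 < s -> {for s, continuous phi}.
Proof.
move=> s0; apply/differentiable_continuous/derivable1_diffP.
by case: (phi_is_derive s0).
Qed.

Lemma dsphi_continuous (s : R) : 0 < s -> {for s, continuous df}.
Proof.
move=> s0; apply: cvgD; first exact: phi_continuous.
by apply: cvgM; [exact: cvg_id|case: (phi_C1 hphi s0)].
Qed.

Lemma sphi_continuous (s : R) : 0 < s -> {for s, continuous f}.
Proof.
move=> s0; apply/differentiable_continuous/derivable1_diffP.
by case: (sphi_is_derive s0).
Qed.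

Lemma sphi_lt (s t : R) : 0 < s -> s < t -> f s < f t.
Proof.
move=> s0 st.
have pos (x : R) : x \in `]s, t[ -> 0 < x.
  by rewrite in_itv/= => /andP[sx _]; rewrite (lt_trans s0).
have [c|x cx|c cst E] := @MVT R f df s t st.
- by move=> /pos; exact: sphi_is_derive.
- apply: continuous_in_subspaceT x cx => y; rewrite inE/= in_itv/= => /andP[sy _].
  by apply: sphi_continuous; rewrite (lt_le_trans s0).
- by rewrite -subr_gt0 E mulr_gt0 ?subr_gt0// dsphi_gt0// pos.
Qed.

Lemma sphi_le (s t : R) : 0 < s -> s <= t -> f s <= f t.
Proof. by move=> s0; rewrite le_eqVlt => /predU1P[->//|/(sphi_lt s0)/ltW]. Qed.

(** By condition (iii) the value e is attained at some d, and s phi(s) is smaller to the left of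
    d. *)
Lemma sphi_cvg0 (e : R) : 0 < e -> exists2 d : R, 0 < d & forall s, 0 < s -> s < d -> f s < e.
Proof.
move=> e0; have : [set f s | s in [set s : R | 0 < s]] e by rewrite (phi_range hphi).
by case=> d /= d0 fd; exists d => // s s0 sd; rewrite -fd sphi_lt.
Qed.

(* Condition (iv) only bounds (s phi(s))' by a possibly singular power of s;
   after the substitution s = M t^N with N large, s phi(s) is C^1 up to t = 0. *)
Definition sphi_pow (M : R) (N : nat) (t : R) : R := if 0 < t then f (M * t ^+ N) else 0.
Definition dsphi_pow (M : R) (N : nat) (t : R) : R :=
  if 0 < t then df (M * t ^+ N) * (M * (N%:R * t ^+ N.-1)) else 0.

Lemma sphi_pow_is_derive_gt0 (M : R) N (t : R) : 0 < M -> 0 < t -> is_derive t 1 (sphi_pow M N) (dsphi_pow M N t).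
Proof.
move=> M0 t0; rewrite /dsphi_pow t0.
have s0 : 0 < M * t ^+ N by rewrite mulr_gt0// exprn_gt0.
have h1 : is_derive t 1 (fun t : R => M * t ^+ N) (M * (N%:R * t ^+ N.-1)).
  rewrite (_ : (fun t : R => _) = horner (M *: 'X^N)).
    apply: is_derive_eq; rewrite derivZ derivXn !hornerE hornerMn hornerXn.
    by rewrite /= -mulrA mulr_natl.
  by apply/funext => u; rewrite !hornerE.
have h2 := is_derive1_comp (f := f) (g := fun t : R => M * t ^+ N) (sphi_is_derive s0) h1.
apply: near_eq_is_derive h2.
by near=> u; rewrite /sphi_pow (_ : 0 < u)//; near: u; exact: near_gtr.
Unshelve. all: by end_near. Qed.

(** By condition (iv) the derivative is at most a constant times t^(N r) t^(N - 1). The exponent N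
    (r + 1) - 1 is at least 1 once N >= 2 / (r + 1), which is possible since r > -1. The bound d <=
    s0 / M keeps M t^N below s0. *)
Lemma dsphi_pow_bound (M : R) : 0 < M -> exists N : nat, (0 < N)%N /\
  exists C d : R, [/\ 0 <= C, 0 < d & forall t : R, 0 < t -> t < d -> `|dsphi_pow M N t| <= C * t].
Proof.
move=> M0; have [C1 [C2 [r [s0 [[C10 C20 r1 s00] [H _ _]]]]]] := phi_behaviour hphi.
have r10 : 0 < r + 1 by lra.
have [n _ /(_ n.+1 (leqnSn n)) Hn] := nbhs_infty_gtr (2 / (r + 1)).
exists n.+1; split => //.
pose d := Num.min 1 (s0 / M).
exists (C2 * (M `^ r * M * n.+1%:R)), d; split.
- by rewrite !mulr_ge0// ?powR_ge0 ?ltW.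
- by rewrite lt_min ltr01 divr_gt0.
move=> t t0; rewrite lt_min => /andP[t1 ts].
have Mt : M * t ^+ n.+1 < s0.
  rewrite mulrC -ltr_pdivlMr// (le_lt_trans _ ts)// exprS ler_piMr ?(ltW t0)//.
  by rewrite exprn_ile1// ltW.
have s0' : 0 < M * t ^+ n.+1 by rewrite mulr_gt0// exprn_gt0.
have tn0 : 0 < M * (n.+1%:R * t ^+ n) by rewrite !mulr_gt0 ?ltr0n ?exprn_gt0.
rewrite /dsphi_pow t0 /= ger0_norm; last by rewrite mulr_ge0 ?(ltW (dsphi_gt0 s0')) ?(ltW tn0).
have := H (M * t ^+ n.+1); rewrite s0' Mt => /(_ isT) /andP[_].
rewrite sphi_derive1// => Hub.
apply: (le_trans (ler_wpM2r (ltW tn0) Hub)).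
rewrite powRM ?(ltW M0) ?exprn_ge0 ?(ltW t0)// -powR_mulrn ?(ltW t0)// -powRrM.
rewrite [leLHS](_ : _ = C2 * (M `^ r * M * n.+1%:R) * (t `^ (n.+1%:R * r) * t ^+ n)); last by ring.
rewrite ler_wpM2l ?mulr_ge0 ?powR_ge0 ?(ltW C20) ?(ltW M0)// -powR_mulrn ?(ltW t0)// -powRD; last first.
  by apply/implyP => _; rewrite gt_eqF.
rewrite -[leRHS]powRr1 ?(ltW t0)//; apply: ger_powR; first by rewrite t0 ltW.
move: Hn; rewrite ltr_pdivrMr// -natr1; lra.
Qed.

Lemma sphi_pow_C1 (M : R) : 0 < M -> exists N : nat, [/\ (0 < N)%N,
  forall t : R, is_derive t 1 (sphi_pow M N) (dsphi_pow M N t) & continuous (dsphi_pow M N)].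
Proof.
move=> M0; have [N [N0 [C [d [C0 d0 Hd]]]]] := dsphi_pow_bound M0.
exists N.
have cflow0 : {for 0, continuous (sphi_pow M N)}.
  have f0 : sphi_pow M N 0 = 0 by rewrite /sphi_pow ltxx.
  apply/cvgrPdist_le => e e0; rewrite f0.
  have [b b0 Hb] := sphi_cvg0 e0.
  have b'0 : 0 < Num.min 1 (b / M) by rewrite lt_min ltr01 divr_gt0.
  exists (Num.min 1 (b / M)) => //= t /=.
  rewrite !sub0r !normrN lt_min => /andP[t1 tb].
  rewrite /sphi_pow; case: ifPn => [t0|_]; last by rewrite normr0 ltW.
  rewrite gtr0_norm// in t1 tb.
  have s0 : 0 < M * t ^+ N by rewrite mulr_gt0// exprn_gt0.
  rewrite gtr0_norm; last exact: sphi_gt0.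
  apply/ltW/Hb => //; rewrite mulrC -ltr_pdivlMr// (le_lt_trans _ tb)//.
  by rewrite -(prednK N0) exprS ler_piMr ?(ltW t0)// exprn_ile1// ltW.
have hd (t : R) : is_derive t 1 (sphi_pow M N) (dsphi_pow M N t).
  have [t0|t0|->] := ltgtP t 0; last first.
  - clear t; rewrite [dsphi_pow _ _ _](_ : _ = 0); last by rewrite /dsphi_pow ltxx.
    (* The difference quotient at 0 equals the derivative at a point between 0 and t, hence is at
       most C t; the mean value theorem needs only continuity at 0, which is [cflow0]. *)
    apply/is_derive1_caratheodory; exists (fun t => sphi_pow M N t / t); split.
    + move=> z; rewrite {2}/sphi_pow ltxx !subr0; have [->|z0] := eqVneq z 0.
        by rewrite /sphi_pow ltxx mulr0.
      by rewrite divfK.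
    + have q0 : sphi_pow M N 0 / 0 = 0 by rewrite /sphi_pow ltxx mul0r.
      apply/cvgrPdist_le => e e0; rewrite q0.
      have b0 : 0 < Num.min d (e / (C + 1)) by rewrite lt_min d0 divr_gt0// ltr_wpDl.
      exists (Num.min d (e / (C + 1))) => //= t /=.
      rewrite !sub0r !normrN lt_min => /andP[td te].
      have [t0|t0] := ltP 0 t; last by rewrite /sphi_pow ltNge t0/= mul0r normr0 ltW.
      rewrite gtr0_norm// in td te.
      have [c|x cx|c] := @MVT R (sphi_pow M N) (dsphi_pow M N) 0 t t0.
      * by rewrite in_itv/= => /andP[c0 _]; exact: sphi_pow_is_derive_gt0.
      * apply: continuous_in_subspaceT x cx => y; rewrite inE/= in_itv/= => /andP[y0 _].
        move: y0; rewrite le_eqVlt => /predU1P[<-//|y0].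
        apply/differentiable_continuous/derivable1_diffP.
        by case: (sphi_pow_is_derive_gt0 N M0 y0).
      * rewrite in_itv/= => /andP[c0 ct]; rewrite {2}/sphi_pow ltxx !subr0 => ->.
        rewrite mulfK ?gt_eqF// (le_trans (Hd _ c0 _)) ?(lt_trans ct)//.
        rewrite (@le_trans _ _ ((C + 1) * t))//; last first.
          by rewrite mulrC -ler_pdivlMr ?ltr_wpDl// ltW.
        by rewrite ler_pM// ?lerDl// ltW.
    + by rewrite /sphi_pow ltxx mul0r.
  - exact: sphi_pow_is_derive_gt0.
  - rewrite [dsphi_pow _ _ _](_ : _ = 0); last by rewrite /dsphi_pow ltNge (ltW t0).
    apply: near_eq_is_derive (is_derive_cst (0 : R) t 1).
    by near=> u; rewrite /sphi_pow ltNge (@ltW _ _ u 0)//; near: u; exact: near_ltr.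
split=> // t.
have [t0|t0|->] := ltgtP t 0.
- have E : dsphi_pow M N t = 0 by rewrite /dsphi_pow ltNge (ltW t0).
  apply/cvgrPdist_le => e e0; rewrite E.
  near=> u; rewrite /dsphi_pow ltNge (@ltW _ _ u 0) ?subrr ?normr0 ?ltW//.
  by near: u; exact: near_ltr.
- have s0 : 0 < M * t ^+ N by rewrite mulr_gt0// exprn_gt0.
  have cp : {for t, continuous (horner (M *: 'X^N))} by exact: continuous_horner.
  have pE : (M *: 'X^N).[t] = M * t ^+ N by rewrite !hornerE.
  have cdf : {for (M *: 'X^N).[t], continuous df} by rewrite pE; exact: dsphi_continuous.
  have c1 := continuous_comp cp cdf.
  have c2 : {for t, continuous (horner (M *: (N%:R *: 'X^(N.-1))))} by exact: continuous_horner.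
  pose g (u : R) := df ((M *: 'X^N : {poly R}).[u]) * (M *: (N%:R *: 'X^(N.-1)) : {poly R}).[u].
  have c3 : {for t, continuous g} := continuousM c1 c2.
  have gE (u : R) : 0 < u -> dsphi_pow M N u = g u.
    by move=> u0; rewrite /dsphi_pow u0 /g !hornerE.
  rewrite /continuous_at gE//.
  apply: cvg_trans c3; apply: near_eq_cvg.
  by near=> u; rewrite gE//; near: u; exact: near_gtr.
- have E : dsphi_pow M N 0 = 0 by rewrite /dsphi_pow ltxx.
  apply/cvgrPdist_le => e e0; rewrite E.
  have b0 : 0 < Num.min d (e / (C + 1)) by rewrite lt_min d0 divr_gt0// ltr_wpDl.
  exists (Num.min d (e / (C + 1))) => //= u /=.
  rewrite !sub0r !normrN lt_min => /andP[td te].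
  have [u0|u0] := ltP 0 u; last by rewrite /dsphi_pow ltNge u0/= normr0 ltW.
  rewrite gtr0_norm// in td te.
  rewrite (le_trans (Hd _ u0 td))// (@le_trans _ _ ((C + 1) * u))//.
    by rewrite ler_wpM2r ?(ltW u0)// lerDl.
  by rewrite mulrC -ler_pdivlMr ?ltr_wpDl// ltW.
Unshelve. all: by end_near. Qed.

Lemma phi_comp_C1 (n dn : R -> R) : (forall y, 0 < n y) ->
  (forall y : R, is_derive y 1 n (dn y)) -> continuous dn ->
  (forall y : R, is_derive y 1 (phi \o n) (derive1 phi (n y) * dn y)) /\
  continuous (fun y => derive1 phi (n y) * dn y).
Proof.
move=> n0 hn cdn; split=> y.
  by apply: is_derive1_comp; exact: phi_is_derive.
have cn : {for y, continuous n}.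
  by apply/differentiable_continuous/derivable1_diffP; case: (hn y).
have cphi : {for n y, continuous (derive1 phi)} by case: (phi_C1 hphi (n0 y)).
exact: (continuousM (continuous_comp cn cphi) (cdn y)).
Qed.

(** The derivative of log phi with respect to log s. For phi(s) = s^(p-2) it is the constant p - 2,
    and Lambda is then - (1 - 2/p). *)
Definition elasticity (s : R) : R := s * derive1 phi s / phi s.

Lemma elasticity_gtN1 (s : R) : 0 < s -> -1 < elasticity s.
Proof.
move=> s0; rewrite ltr_pdivlMr ?(phi_gt0 hphi)// mulN1r ltrNl -subr_gt0 opprK.
by rewrite addrC addrC; have := dsphi_gt0 s0.
Qed.

Lemma Lambda_elasticity (s : R) : 0 < s ->
  s * derive1 phi s / (s * derive1 phi s + 2 * phi s) =
  elasticity s / (elasticity s + 2).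
Proof.
move=> s0; have p0 := phi_gt0 hphi s0; have d0 := dsphi_gt0 s0.
by rewrite /elasticity; field; rewrite !lt0r_neq0//; lra.
Qed.

Local Notation T := (fun s : R => s * Num.sqrt (phi s)).

Lemma sqr_ssqrt (s : R) : 0 < s -> T s ^+ 2 = s * f s.
Proof. by move=> s0; rewrite exprMn sqr_sqrtr ?ltW ?(phi_gt0 hphi)//; ring. Qed.

Lemma ssqrt_gt0 (s : R) : 0 < s -> 0 < T s.
Proof. by move=> s0; rewrite mulr_gt0// sqrtr_gt0 (phi_gt0 hphi). Qed.

Lemma ssqrt_lt (s t : R) : 0 < s -> s < t -> T s < T t.
Proof.
move=> s0 st; have t0 := lt_trans s0 st.
rewrite -(@ltr_pXn2r _ 2)// ?nnegrE ?ltW ?ssqrt_gt0// !sqr_ssqrt//.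
by rewrite ltr_pM ?sphi_lt// ltW// sphi_gt0.
Qed.

Lemma ssqrt_surj (t : R) : 0 < t -> exists2 s, 0 < s & T s = t.
Proof.
move=> t0; pose g s := s * f s.
have f1 : 0 < f 1 by rewrite sphi_gt0.
have t20 : 0 < t ^+ 2 by rewrite exprn_gt0.
(* The equation is squared to s f(s) = t^2. Since f increases, a <= 1 gives a f(a) <= a f(1) <= t^2,
   and b >= 1 gives the reverse inequality. *)
pose a := Num.min 1 (t ^+ 2 / f 1); pose b := Num.max 1 (t ^+ 2 / f 1).
have a0 : 0 < a by rewrite lt_min ltr01 divr_gt0.
have ab : a <= b by rewrite ge_min le_max lexx.
have ga : g a <= t ^+ 2.
  rewrite /g (@le_trans _ _ (a * f 1))//.
    by rewrite ler_wpM2l ?(ltW a0)//; apply: sphi_le => //; rewrite ge_min lexx.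
  by rewrite -ler_pdivlMr// ge_min lexx orbT.
have gb : t ^+ 2 <= g b.
  rewrite /g (@le_trans _ _ (b * f 1))//.
    by rewrite -ler_pdivrMr// le_max lexx orbT.
  rewrite ler_wpM2l ?(le_trans (ltW a0) ab)//.
  by apply: sphi_le => //; rewrite le_max lexx.
have cg : {within `[a, b], continuous g}.
  apply: continuous_in_subspaceT => y; rewrite inE/= in_itv/= => /andP[ay _].
  by apply: cvgM; [exact: cvg_id|exact: sphi_continuous (lt_le_trans a0 ay)].
have [|c] := IVT ab cg (v := t ^+ 2).
  by rewrite ge_min le_max ga gb orbT.
rewrite in_itv/= => /andP[ac _] gc; have c0 := lt_le_trans a0 ac.
exists c => //; apply/eqP; rewrite -(@eqrXn2 _ 2)// ?ltW ?ssqrt_gt0//.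
by rewrite sqr_ssqrt// -gc.
Qed.

Lemma Lambda_val (t : R) : 0 < t -> exists2 s, 0 < s &
  T s = t /\ Lambda phi t = - (elasticity s / (elasticity s + 2)).
Proof.
move=> t0; have [s s0 Ts] := ssqrt_surj t0; exists s => //; split => //.
rewrite /Lambda (_ : xget _ _ = s) ?Lambda_elasticity//.
case: xgetP => [u _ [u0 Tu]|/(_ s)[]//].
have [us|su|//] := ltgtP u s.
  by have := ssqrt_lt u0 us; rewrite /= Tu Ts ltxx.
by have := ssqrt_lt s0 su; rewrite /= Tu Ts ltxx.
Qed.

Lemma monotone_cvgy (L : R -> R) (t1 C : R) :
  (forall t u, t1 <= t -> t <= u -> L t <= L u) ->
  (forall t, t1 <= t -> L t <= C) -> exists l : R, L t @[t --> +oo%R] --> l.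
Proof.
move=> mono LC; pose S := [set L t | t in [set t | t1 <= t]].
have S0 : has_sup S.
  split; first by exists (L t1); exists t1 => /=.
  by exists C => _ [t /= t1t <-]; exact: LC.
exists (sup S); apply/cvgrPdist_le => e e0.
have [_ [u /= t1u <-] ue] := sup_adherent e0 S0.
near=> t; have ut : u <= t by near: t; apply: nbhs_pinfty_ge; rewrite num_real.
have Lt : L t <= sup S.
  by apply: sup_upper_bound => //; exists t => //=; rewrite (le_trans t1u).
rewrite ger0_norm ?subr_ge0// lerBlDr -lerBlDl (le_trans (ltW ue))//.
exact: mono.
Unshelve. all: by end_near. Qed.

(** Condition (v) fixes the sign of phi' beyond s1, so the absolute values in (vi) can be removed
    and the elasticity is monotone there. The map x / (x + 2) preserves order and is bounded by 1 in
    absolute value for x > -1. *)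
Lemma Lambda_cvg : Lambda phi t @[t --> +oo%R] --> Lambda_infty phi.
Proof.
have [C1 [C2 [r [s0 [[_ _ _ s00] [_ _ [s1 s01 sgn]]]]]]] := phi_behaviour hphi.
have s10 : 0 < s1 by rewrite (lt_trans s00).
have sT (s u : R) : 0 < s -> 0 < u -> T s <= T u -> s <= u.
  by move=> s0' u0; rewrite leNgt [in X in _ -> X]leNgt; apply: contra => /(ssqrt_lt u0).
have bnd (s : R) : 0 < s -> `|elasticity s / (elasticity s + 2)| <= 1.
  move=> sp; have e1 := elasticity_gtN1 sp.
  have e2 : 0 < elasticity s + 2 by lra.
  by rewrite normrM normfV (gtr0_norm e2) ler_pdivrMr// mul1r ler_norml; apply/andP; split; lra.
have mono (x y : R) : -1 < x -> x <= y -> x / (x + 2) <= y / (y + 2).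
  move=> x1 xy; have x2 : 0 < x + 2 by lra.
  have y2 : 0 < y + 2 by lra.
  by rewrite ler_pdivrMr// mulrAC ler_pdivlMr//; lra.
have cv : exists l : R, Lambda phi t @[t --> +oo%R] --> l; last first.
  by have [l cvl] := cv; rewrite /Lambda_infty (cvg_lim _ cvl).
case: sgn => sgn.
- have nn w : 0 < w -> s1 <= w -> 0 <= w * derive1 phi w / phi w.
    move=> w0 s1w; rewrite divr_ge0 ?mulr_ge0 ?sgn ?(ltW w0)//.
    by rewrite ltW// (phi_gt0 hphi).
  (* For phi' >= 0 the elasticity is nondecreasing and Lambda nonincreasing, so the convergence
     criterion is applied to - Lambda. *)
  have [l Hl] : exists l : R, (- Lambda phi t) @[t --> +oo%R] --> l.
    apply: (@monotone_cvgy _ (T s1) 1) => [t u ts tu|t ts].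
      have t0 : 0 < t by rewrite (lt_le_trans (ssqrt_gt0 s10)).
      have [s sp [Ts ->]] := Lambda_val t0.
      have [v vp [Tv ->]] := Lambda_val (lt_le_trans t0 tu).
      rewrite !opprK; apply: mono; first exact: elasticity_gtN1.
      have sv : s <= v by apply: sT => //; rewrite Ts Tv.
      have s1s : s1 <= s by apply: sT => //; rewrite Ts.
      have := phi_ratio hphi sp sv.
      by rewrite !ger0_norm ?nn// (le_trans s1s sv).
    have t0 : 0 < t by rewrite (lt_le_trans (ssqrt_gt0 s10)).
    have [s sp [Ts ->]] := Lambda_val t0; rewrite opprK.
    by rewrite (le_trans (ler_norm _))// bnd.
  by exists (- l); move/cvgN : Hl; under eq_fun do rewrite opprK.
- have nn w : 0 < w -> s1 <= w -> w * derive1 phi w / phi w <= 0.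
    move=> w0 s1w; rewrite mulr_le0_ge0 ?invr_ge0 ?mulr_ge0_le0 ?sgn ?(ltW w0)//.
    by rewrite ltW// (phi_gt0 hphi).
  apply: (@monotone_cvgy _ (T s1) 1) => [t u ts tu|t ts].
    have t0 : 0 < t by rewrite (lt_le_trans (ssqrt_gt0 s10)).
    have [s sp [Ts ->]] := Lambda_val t0.
    have [v vp [Tv ->]] := Lambda_val (lt_le_trans t0 tu).
    rewrite lerN2; apply: mono; first exact: elasticity_gtN1.
    have sv : s <= v by apply: sT => //; rewrite Ts Tv.
    have s1s : s1 <= s by apply: sT => //; rewrite Ts.
    have := phi_ratio hphi sp sv.
    by rewrite !ler0_norm ?nn ?lerN2// (le_trans s1s sv).
  have t0 : 0 < t by rewrite (lt_le_trans (ssqrt_gt0 s10)).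
  have [s sp [Ts ->]] := Lambda_val t0.
  by rewrite (le_trans (ler_norm _))// normrN bnd.
Qed.

End PhiCalculus.

(** * Real form of the dissipativity inequality *)

Section RealEntries.
Context {R : realType} {m : nat}.

(* Re (a p q^* ) is bilinear in (Re a, Im a) and (p, q); the last component of
   an index selects Im a. *)
Notation idx := ('I_2 * 'I_2 * ('I_m * 'I_m) * bool)%type.

Definition entry (A : 'I_2 -> 'I_2 -> plane R -> 'M[R[i]]_m) (t : idx) (x : plane R) : R :=
  let a := A t.1.1.1 t.1.1.2 x t.1.2.1 t.1.2.2 in
  if t.2 then complex.Im a else complex.Re a.

(** For [false], the real part of p times the conjugate of q; for [true], minus its imaginary
    part. *)
Definition bil (b : bool) (p q : R[i]) : R :=
  if b then complex.Re p * complex.Im q - complex.Im p * complex.Re q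
  else complex.Re p * complex.Re q + complex.Im p * complex.Im q.

Lemma Re_sum (J : Type) (s : seq J) (P : pred J) (F : J -> R[i]) :
  complex.Re (\sum_(j <- s | P j) F j) = \sum_(j <- s | P j) complex.Re (F j).
Proof. by apply: (big_morph _ _ (erefl _)) => -[? ?] [? ?]. Qed.

Lemma Re_mul3 (a p q : R[i]) :
  complex.Re (a * p * q^*) = complex.Re a * bil false p q + complex.Im a * bil true p q.
Proof. by case: a p q => [a1 a2] [p1 p2] [q1 q2]; rewrite /bil/=; ring. Qed.

Lemma Re_herm_mulmx (M : 'M[R[i]]_m) (u v : 'cV[R[i]]_m) :
  complex.Re (herm (M *m u) v) =
  \sum_(ij : 'I_m * 'I_m) \sum_(b : bool)
     (if b then complex.Im (M ij.1 ij.2) else complex.Re (M ij.1 ij.2))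
     * bil b (u ij.2 0) (v ij.1 0).
Proof.
rewrite /herm Re_sum.
rewrite -(pair_bigA _ (fun i j => \sum_(b : bool)
     (if b then complex.Im (M i j) else complex.Re (M i j)) * bil b (u j 0) (v i 0)))/=.
apply: eq_bigr => i _; rewrite mxE mulr_suml Re_sum; apply: eq_bigr => j _.
by rewrite Re_mul3 big_bool/= addrC.
Qed.

Lemma Re_sum_herm (A : 'I_2 -> 'I_2 -> plane R -> 'M[R[i]]_m) x
    (p q : 'I_2 -> 'cV[R[i]]_m) :
  complex.Re (\sum_(h < 2) \sum_(k < 2) herm (A h k x *m p k) (q h)) =
  \sum_(t : idx) entry A t x * bil t.2 (p t.1.1.2 t.1.2.2 0) (q t.1.1.1 t.1.2.1 0).
Proof.
rewrite pair_bigA/= Re_sum.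
pose F (t : idx) := entry A t x * bil t.2 (p t.1.1.2 t.1.2.2 0) (q t.1.1.1 t.1.2.1 0).
rewrite -(pair_bigA _ (fun s b => F (s, b)))/= -(pair_bigA _ (fun hk ij => \sum_b F ((hk, ij), b)))/=.
by apply: eq_bigr => -[h k] _; rewrite Re_herm_mulmx.
Qed.

Lemma in_Lpy_bounded (Omega : set (plane R)) (f : plane R -> R[i]) :
  in_Lp Omega +oo%E f -> exists2 C : R, 0 <= C &
  {ae @leb2 R, forall x, Omega x -> `|complex.Re (f x)| <= C /\ `|complex.Im (f x)| <= C}.
Proof.
move=> [_ _]; rewrite /LpNorm unlock /Lnorm.
have Re_le (z : R[i]) : `|complex.Re z| <= Normc.normc z /\ `|complex.Im z| <= Normc.normc z.
  by case: z => a b /=; split; rewrite -sqrtr_sqr ler_sqrt ?addr_ge0 ?sqr_ge0// ?lerDl ?lerDr sqr_ge0.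
(* The norm with exponent +oo branches on whether the whole plane has positive measure; in the other
   branch the plane itself is the exceptional null set. *)
case: ifPn => [_|]; last first.
  rewrite -leNgt measure_le0 => /eqP m0 _; exists 0 => //.
  by exists setT; split.
set S := ess_sup _ _ => Sy.
have H : {ae @leb2 R, forall x, ((abse \o ((fun x0 => (Normc.normc (f x0))%:E) \_ Omega)) x <= S)%E}.
  exact: ess_sup_ge.
exists (fine (maxe S 0%E)); first by rewrite fine_ge0// le_max lexx orbT.
apply: filterS H => x /= + Ox; rewrite patchE mem_set// => Hx.
suff N : Normc.normc (f x) <= fine (maxe S 0%E).
  by have [h1 h2] := Re_le (f x); split; [exact: le_trans h1 N|exact: le_trans h2 N].
rewrite -lee_fin fineK; last first.
  rewrite fin_numElt (lt_le_trans (ltNy0))/= ?le_max ?lexx ?orbT//.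
  by rewrite gt_max Sy ltry.
rewrite le_max; apply/orP; left; apply: le_trans Hx.
by rewrite /= lee_fin ler_norm.
Qed.

(** The form in which dissipativity is used from here on: real coefficients, classical partial
    derivatives and an integral over the whole plane. *)
Definition entries_dissipative (Omega : set (plane R)) (phi : R -> R)
    (a : idx -> plane R -> R) : Prop :=
  forall (K : set (plane R)) B (u : plane R -> 'cV[R[i]]_m),
    closed K -> K `<=` Omega -> K `<=` sqbox B ->
    (forall i, smooth_lim K (cre (fun x => u x i 0)) /\
               smooth_lim K (cim (fun x => u x i 0))) ->
    (forall i, smooth_lim K (cre (fun x => phi_mul phi u x i 0)) /\
               smooth_lim K (cim (fun x => phi_mul phi u x i 0))) ->
    0 <= \int[leb2]_(x in setT) \sum_t (a t x *
        bil t.2 (cpartial t.1.1.2 (fun x => u x t.1.2.2 0) x)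
                (cpartial t.1.1.1 (fun x => phi_mul phi u x t.1.2.1 0) x)).

Lemma dissipative_entries (Omega : set (plane R))
    (A : 'I_2 -> 'I_2 -> plane R -> 'M[R[i]]_m) (phi : R -> R) :
  open Omega ->
  (forall h k i j, in_Lp Omega +oo%E (fun x => A h k x i j)) ->
  LPhi_dissipative Omega A phi ->
  exists a : idx -> plane R -> R, [/\ forall t, bmeas (a t),
    {ae @leb2 R, forall x, Omega x -> forall t, a t x = entry A t x} &
    entries_dissipative Omega phi a].
Proof.
move=> oO hA hdiss; have mO := open_measurable_plane oO.
have me t : measurable_fun Omega (entry A t).
  case: t => [[[h k] [i j]] b]; have [h1 h2 _] := hA h k i j.
  by case: b.
have [C HC] : exists C : idx -> R, forall t, 0 <= C t /\
    {ae @leb2 R, forall x, Omega x -> `|entry A t x| <= C t}.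
  suff H t : exists c : R, 0 <= c /\ {ae @leb2 R, forall x, Omega x -> `|entry A t x| <= c}.
    by have [C HC] := boolp.choice H; exists C.
  case: t => [[[h k] [i j]] b]; have [c c0 Hc] := in_Lpy_bounded (hA h k i j).
  exists c; split => //; apply: filterS Hc => x Hx Ox.
  by have [h1 h2] := Hx Ox; case: b.
(* The entries are measurable only on Omega and bounded only almost everywhere. Truncating at the
   essential bound and extending by 0 makes them bounded and measurable on the plane, without
   changing them almost everywhere in Omega. *)
pose a t := (fun x => Num.max (- C t) (Num.min (C t) (entry A t x))) \_ Omega.
have ba t : bmeas (a t).
  split; last first.
    exists (C t) => x; rewrite /a patchE; case: ifP => _; last by rewrite normr0 (HC t).1.
    rewrite ler_norml le_max lexx /= ge_max ge_min lexx andbT /=.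
    by rewrite (le_trans _ (HC t).1)// oppr_le0 (HC t).1.
  apply/(measurable_restrictT _ mO); apply: measurable_maxr; first exact: measurable_cst.
  by apply: measurable_minr; [exact: measurable_cst|exact: me].
have aE : {ae @leb2 R, forall x, Omega x -> forall t, a t x = entry A t x}.
  have : {ae @leb2 R, forall x, forall t, Omega x -> `|entry A t x| <= C t}.
    (* For m = 0 there is no index; otherwise t0 is the default value for [nth] in an enumeration of
       the indices. *)
    have [n0|/card_gt0P[t0 _]] := posnP #|{: idx}|.
      by apply: aeW => x t; have := fintype0 t n0.
    suff : {ae @leb2 R, forall x, forall n, Omega x -> `|entry A (nth t0 (enum {: idx}) n) x| <= C (nth t0 (enum {: idx}) n)}.
      by apply: filterS => x Hx t; move: (Hx (index t (enum {: idx}))); rewrite nth_index// mem_enum.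
    by apply: (ae_foralln (P := fun n x => Omega x -> `|entry A (nth t0 (enum {: idx}) n) x| <= C (nth t0 (enum {: idx}) n))) => n; exact: (HC _).2.
  apply: filterS => x Hx Ox t; move: (Hx t Ox); rewrite ler_norml => /andP[h1 h2].
  by rewrite /a patchE mem_set// (min_idPr h2) (max_idPr h1).
exists a; split => // K B u cK KO KB su sv.
have H1u : H1_0_vec Omega u (fun h x => \col_i cpartial h (fun x => u x i 0) x).
  move=> i; rewrite [X in H1_0 _ _ X](_ : _ = fun h => cpartial h (fun x => u x i 0)).
    by apply: (H1_0_smooth_lim oO cK KO KB); case: (su i).
  by apply/funext => h; apply/funext => x; rewrite mxE.
have H1v : H1_0_vec Omega (phi_mul phi u) (fun h x => \col_i cpartial h (fun x => phi_mul phi u x i 0) x).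
  move=> i; rewrite [X in H1_0 _ _ X](_ : _ = fun h => cpartial h (fun x => phi_mul phi u x i 0)).
    by apply: (H1_0_smooth_lim oO cK KO KB); case: (sv i).
  by apply/funext => h; apply/funext => x; rewrite mxE.
have := hdiss u _ _ H1u H1v; congr (0 <= _).
pose G t x := bil t.2 (cpartial t.1.1.2 (fun x => u x t.1.2.2 0) x)
                  (cpartial t.1.1.1 (fun x => phi_mul phi u x t.1.2.1 0) x).
have bG (t : idx) : bsupp (G t).
  have sl (f : plane R -> R[i]) h : smooth_lim K (cre f) -> smooth_lim K (cim f) ->
      bsupp (fun x => 'D_(basis2 h) (cre f) x) /\ bsupp (fun x => 'D_(basis2 h) (cim f) x).
    by move=> [c1 k1 _] [c2 k2 _]; split; apply: (@C1_bsupp_derive _ _ B) => // x;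
       [move=> /k1 /KB|move=> /k2 /KB].
  have [u1 u2] := sl _ t.1.1.2 (su t.1.2.2).1 (su t.1.2.2).2.
  have [v1 v2] := sl _ t.1.1.1 (sv t.1.2.1).1 (sv t.1.2.1).2.
  rewrite /G /bil; case: t.2.
    apply: bsuppD; first exact: bsuppMr u1 v2.1.
    rewrite (_ : (fun x => _) = (fun x => (-1) * (complex.Im (cpartial t.1.1.2 (fun x => u x t.1.2.2 0) x) *
      complex.Re (cpartial t.1.1.1 (fun x => phi_mul phi u x t.1.2.1 0) x)))).
      by apply: bsuppMl; [exact: bmeas_cst|exact: bsuppMr u2 v1.1].
    by apply/funext => x; rewrite mulN1r.
  by apply: bsuppD; [exact: bsuppMr u1 v1.1|exact: bsuppMr u2 v2.1].
rewrite /cintegral /=.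
transitivity (\int[leb2]_(x in Omega) (\sum_t a t x * G t x)); last first.
  apply: Rintegral_supp => x; apply: contra_neqP => nO.
  by rewrite big1// => t _; rewrite /a patchE memNset// mul0r.
rewrite /Rintegral; congr fine; apply: ae_eq_integral => //.
- apply/measurable_EFinP.
  rewrite (_ : cre _ = (fun x => \sum_t entry A t x * G t x)).
    apply: measurable_sum => t; apply: measurable_funM; first exact: me.
    by apply: measurable_funTS; case: (bG t) => -[].
  apply/funext => x; rewrite /cre (Re_sum_herm A x (fun k => \col_j cpartial k (fun x => u x j 0) x)
     (fun h => \col_i cpartial h (fun x => phi_mul phi u x i 0) x)).
  by apply: eq_bigr => t _; rewrite !mxE.
- apply/measurable_EFinP; apply: measurable_funTS.
  by have [[]] : bsupp (fun x => \sum_t a t x * G t x)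
    by apply: bsupp_sum => t; apply: bsuppMl.
apply: filterS aE => x Hx Ox; congr EFin.
rewrite /cre (Re_sum_herm A x (fun k => \col_j cpartial k (fun x => u x j 0) x)
     (fun h => \col_i cpartial h (fun x => phi_mul phi u x i 0) x)).
by apply: eq_bigr => t _; rewrite !mxE Hx.
Qed.

End RealEntries.

(** * Test functions and their energy *)

Section Curve.
Context {R : realType} (phi : R -> R) (hphi : phi_conditions phi).
Context (M b c : R) (M0 : 0 < M) (c0 : 0 <= c).

(* With b = Re<zeta,omega>, zeta' = zeta - b omega and c = |zeta'|^2, the curve
   e^{bs} omega + s zeta' has velocity zeta at s = 0, has modulus [cnorm s] and
   never vanishes. [curve w z] is a real coordinate of M times this curve and
   [pcurve w z] the same coordinate after multiplication by phi(modulus). *)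
Definition cnorm (s : R) : R := Num.sqrt (expR (2 * b * s) + c * s ^+ 2).
Definition dcnorm (s : R) : R :=
  (b * expR (2 * b * s) + c * s) / cnorm s.
Definition curve (w z s : R) : R := M * (w * expR (b * s) + z * s).
Definition dcurve (w z s : R) : R := M * (w * (b * expR (b * s)) + z).
Definition pcurve (w z s : R) : R := phi (M * cnorm s) * curve w z s.
Definition dpcurve (w z s : R) : R :=
  phi (M * cnorm s) * dcurve w z s +
  curve w z s * (derive1 phi (M * cnorm s) * (M * dcnorm s)).

Lemma cnorm_gt0 s : 0 < cnorm s.
Proof. by rewrite sqrtr_gt0 ltr_wpDr ?expR_gt0// mulr_ge0// sqr_ge0. Qed.

Lemma cnorm0 : cnorm 0 = 1.
Proof. by rewrite /cnorm mulr0 expR0 expr0n mulr0 addr0 sqrtr1. Qed.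

Lemma is_derive_expR_scale (k s : R) : is_derive s 1 (fun s => expR (k * s)) (k * expR (k * s)).
Proof.
have h : is_derive s 1 ( *%R k) k.
  by apply: (is_derive_eq (is_deriveZ k (is_derive_id s 1))); rewrite /GRing.scale/= mulr1.
apply: (is_derive_eq (is_derive1_comp (is_derive_expR (k * s)) h)).
by rewrite mulrC.
Qed.

Lemma continuous_expR_scale (k : R) : continuous (fun s => expR (k * s)).
Proof.
move=> s; apply/differentiable_continuous/derivable1_diffP.
by case: (is_derive_expR_scale k s).
Qed.

Lemma is_derive_cnorm (s : R) : is_derive s 1 cnorm (dcnorm s).
Proof.
have q0 : 0 < expR (2 * b * s) + c * s ^+ 2.
  by rewrite ltr_wpDr ?expR_gt0// mulr_ge0// sqr_ge0.
have h2 : is_derive s 1 (fun s => c * s ^+ 2) (c * (2 * s)).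
  rewrite (_ : (fun s => _) = horner (c *: 'X^2)).
    apply: is_derive_eq; rewrite derivZ derivXn !hornerE.
    by rewrite /= -mulrA; congr (_ * _); ring.
  by apply/funext => u; rewrite !hornerE.
have h := is_derive1_comp (g := fun s => expR (2 * b * s) + c * s ^+ 2) (is_derive1_sqrt q0)
  (is_deriveD (is_derive_expR_scale (2 * b) s) h2).
apply: (is_derive_eq h); rewrite /dcnorm/=.
have := cnorm_gt0 s; rewrite /cnorm => n0.
by rewrite /cnorm; field; rewrite lt0r_neq0.
Qed.

Lemma continuous_cnorm : continuous cnorm.
Proof.
move=> s; apply/differentiable_continuous/derivable1_diffP.
by case: (is_derive_cnorm s).
Qed.

Lemma continuous_dcnorm : continuous dcnorm.
Proof.
move=> s; apply: cvgM; last first.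
  by apply: cvgV; [rewrite lt0r_neq0// cnorm_gt0|exact: continuous_cnorm].
apply: cvgD; apply: cvgM; [exact: cvg_cst|exact: continuous_expR_scale|exact: cvg_cst|exact: cvg_id].
Qed.

Lemma smooth1D (f g : R -> R) : smooth1 f -> smooth1 g -> smooth1 (fun s => f s + g s).
Proof.
move=> [F [<- HF]] [G [<- HG]]; exists (fun n s => F n s + G n s); split => // n x.
by apply: is_deriveD.
Qed.

Lemma smooth1Z (k : R) (f : R -> R) : smooth1 f -> smooth1 (fun s => k * f s).
Proof.
move=> [F [<- HF]]; exists (fun n s => k * F n s); split => // n x.
by apply: is_deriveZ.
Qed.

Lemma smooth1_curve w z : smooth1 (curve w z).
Proof.
apply: smooth1Z; apply: smooth1D; first by apply: smooth1Z; exact: smooth1_expR.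
have sid : smooth1 (id : R -> R).
  rewrite (_ : id = horner ('X : {poly R})); first exact: smooth1_poly.
  by apply/funext => s; rewrite hornerX.
exact: (smooth1Z z sid).
Qed.

Lemma is_derive_curve w z (s : R) : is_derive s 1 (curve w z) (dcurve w z s).
Proof.
have h := is_deriveZ M (is_deriveD (is_deriveZ w (is_derive_expR_scale b s))
  (is_deriveZ z (is_derive_id s 1))).
by apply: (is_derive_eq h); rewrite /dcurve /GRing.scale/= mulr1.
Qed.

Lemma continuous_dcurve w z : continuous (dcurve w z).
Proof.
move=> s; apply: cvgM; first exact: cvg_cst.
apply: cvgD; last exact: cvg_cst.
apply: cvgM; first exact: cvg_cst.
by apply: cvgM; [exact: cvg_cst|exact: continuous_expR_scale].
Qed.

Lemma is_derive_pcurve w z (s : R) : is_derive s 1 (pcurve w z) (dpcurve w z s).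
Proof.
have n0 y : 0 < M * cnorm y by rewrite mulr_gt0// cnorm_gt0.
have hn (y : R) : is_derive y 1 (fun s => M * cnorm s) (M * dcnorm y).
  exact: is_deriveZ (is_derive_cnorm y).
have cn : continuous (fun y => M * dcnorm y).
  by move=> y; apply: cvgM; [exact: cvg_cst|exact: continuous_dcnorm].
have [hp _] := phi_comp_C1 hphi n0 hn cn.
apply: (is_derive_eq (is_deriveM (hp s) (is_derive_curve w z s))).
by rewrite /dpcurve /GRing.scale.
Qed.

Lemma continuous_dpcurve w z : continuous (dpcurve w z).
Proof.
have n0 y : 0 < M * cnorm y by rewrite mulr_gt0// cnorm_gt0.
have hn (y : R) : is_derive y 1 (fun s => M * cnorm s) (M * dcnorm y).
  exact: is_deriveZ (is_derive_cnorm y).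
have cn : continuous (fun y => M * dcnorm y).
  by move=> y; apply: cvgM; [exact: cvg_cst|exact: continuous_dcnorm].
have [hp cp] := phi_comp_C1 hphi n0 hn cn.
move=> s; apply: cvgD; apply: cvgM.
- by apply/differentiable_continuous/derivable1_diffP; case: (hp s).
- exact: continuous_dcurve.
- by apply/differentiable_continuous/derivable1_diffP; case: (is_derive_curve w z s).
- exact: cp.
Qed.

Lemma curve0 w z : curve w z 0 = M * w.
Proof. by rewrite /curve !mulr0 expR0 mulr1 addr0. Qed.

Lemma dcurve0 w z : dcurve w z 0 = M * (w * b + z).
Proof. by rewrite /dcurve !mulr0 expR0 mulr1. Qed.

Lemma dpcurve0 w z : dpcurve w z 0 =
  M * (phi M * (w * b + z) + M * derive1 phi M * b * w).
Proof.
rewrite /dpcurve dcurve0 curve0 /dcnorm cnorm0 !mulr0 expR0 !mulr1 addr0 divr1.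
by ring.
Qed.

End Curve.

(** * Smooth cutoffs of squares *)

Section Cutoff.
Context {R : realType}.

Definition csq (p q r : R) : set (plane R) :=
  [set x | `|x.1 - p| <= r /\ `|x.2 - q| <= r].

Lemma closed_csq p q r : closed (csq p q r).
Proof.
rewrite (_ : csq p q r = [set x : plane R | `|x.1 - p| <= r] `&` [set x | `|x.2 - q| <= r])//.
apply: closedI.
  apply: (@closed_comp _ _ (fun x : plane R => `|x.1 - p|) [set t | t <= r]); last exact: closed_le.
  move=> x _; apply: (@continuous_comp _ _ _ (fun x : plane R => x.1 - p) (fun t => `|t|)).
    by apply: cvgB; [exact: cvg_fst|exact: cvg_cst].
  exact: norm_continuous.
apply: (@closed_comp _ _ (fun x : plane R => `|x.2 - q|) [set t | t <= r]); last exact: closed_le.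
move=> x _; apply: (@continuous_comp _ _ _ (fun x : plane R => x.2 - q) (fun t => `|t|)).
  by apply: cvgB; [exact: cvg_snd|exact: cvg_cst].
exact: norm_continuous.
Qed.

Lemma csq_sqbox p q r : csq p q r `<=` sqbox (Num.max `|p| `|q| + r).
Proof.
move=> x [h1 h2]; split.
  rewrite -(subrK p x.1) (le_trans (ler_normD _ _))// addrC lerD//.
  by rewrite le_max lexx.
rewrite -(subrK q x.2) (le_trans (ler_normD _ _))// addrC lerD//.
by rewrite le_max lexx orbT.
Qed.

(** Equal to 1 for |s| <= 2 r and to 0 for |s| >= 3 r: between them s^2 - 4 r^2 runs from 0 to 5
    r^2. The square avoids the corner of |s|, and the leading factor normalises the plateau. *)
Definition cutoff1 (r s : R) : R :=
  (expm1V (expm1V (5 * r ^+ 2)))^-1 * step_down (5 * r ^+ 2) (s * s - 4 * r ^+ 2).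

Lemma cutoff1_ge0 r s : 0 <= cutoff1 r s.
Proof. by rewrite mulr_ge0 ?invr_ge0 ?expm1V_ge0. Qed.

Lemma cutoff1_in r s : 0 < r -> `|s| <= 2 * r -> cutoff1 r s = 1.
Proof.
move=> r0 sr; have a0 : 0 < 5 * r ^+ 2 by rewrite mulr_gt0// exprn_gt0.
rewrite /cutoff1 /step_down (expm1V_le0 (x := s * s - _)); last first.
  rewrite subr_le0 -expr2 -(real_normK (num_real s)).
  by rewrite (_ : 4 * r ^+ 2 = (2 * r) ^+ 2) ?lerXn2r ?nnegrE ?mulr_ge0// ?ltW//; ring.
by rewrite subr0 mulVf// gt_eqF// !expm1V_gt0.
Qed.

Lemma cutoff1_supp r s : 0 < r -> cutoff1 r s != 0 -> `|s| <= 3 * r.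
Proof.
move=> r0; apply: contra_neqT; rewrite -ltNge => sr.
rewrite /cutoff1 /step_down (expm1V_le0 (x := _ - expm1V _)) ?mulr0//.
rewrite subr_le0; apply: expm1V_homo.
have : (3 * r) ^+ 2 <= `|s| ^+ 2 by rewrite lerXn2r ?nnegrE ?mulr_ge0// ltW.
by rewrite real_normK ?num_real//; nra.
Qed.

Lemma C_k_cutoff1 k r (f : plane R -> R) : C_k k f -> C_k k (fun x => cutoff1 r (f x)).
Proof.
move=> hf; apply: C_kZ.
have h1 : C_k k (fun x => f x * f x - 4 * r ^+ 2).
  by apply: C_kB; [exact: C_kM|exact: C_k_cst].
have h2 : C_k k (fun x => expm1V (5 * r ^+ 2) - expm1V (f x * f x - 4 * r ^+ 2)).
  by apply: C_kB; [exact: C_k_cst|exact: (smooth1_comp h1 (smooth1_flat 1))].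
exact: (smooth1_comp h2 (smooth1_flat 1)).
Qed.

Lemma C_k_fst k : C_k k (fun x : plane R => x.1 : R).
Proof.
rewrite (_ : (fun x => _) = (fun x : plane R => 1 * x.1 + 0 * x.2)); first exact: C_k_linear2.
by apply/funext => x; rewrite mul1r mul0r addr0.
Qed.

Lemma C_k_snd k : C_k k (fun x : plane R => x.2 : R).
Proof.
rewrite (_ : (fun x => _) = (fun x : plane R => 0 * x.1 + 1 * x.2)); first exact: C_k_linear2.
by apply/funext => x; rewrite mul1r mul0r add0r.
Qed.

Definition cutoff (p q r : R) (x : plane R) : R := cutoff1 r (x.1 - p) * cutoff1 r (x.2 - q).

Lemma C_k_cutoff k p q r : C_k k (cutoff p q r).
Proof.
apply: C_kM; apply: C_k_cutoff1; apply: C_kB; try exact: C_k_cst.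
  exact: C_k_fst.
exact: C_k_snd.
Qed.

Lemma cutoff_ge0 p q r x : 0 <= cutoff p q r x.
Proof. by rewrite mulr_ge0 ?cutoff1_ge0. Qed.

Lemma cutoff_in p q r x : 0 < r -> csq p q (2 * r) x -> cutoff p q r x = 1.
Proof. by move=> r0 [h1 h2]; rewrite /cutoff !cutoff1_in// mulr1. Qed.

Lemma cutoff_supp p q r x : 0 < r -> cutoff p q r x != 0 -> csq p q (3 * r) x.
Proof.
move=> r0; rewrite mulf_eq0 negb_or => /andP[h1 h2].
by split; exact: cutoff1_supp.
Qed.

Lemma near_csq p q r x : 0 < r -> csq p q r x -> \near x, csq p q (2 * r) x.
Proof.
move=> r0 [h1 h2]; exists (ball x.1 r, ball x.2 r) => /=.
  by split; exists r.
move=> z [/=]; rewrite /ball/= => z1 z2; split.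
  by rewrite -(subrKA x.1) (le_trans (ler_normD _ _))// mulr_natl mulr2n lerD// distrC ltW.
by rewrite -(subrKA x.2) (le_trans (ler_normD _ _))// mulr_natl mulr2n lerD// distrC ltW.
Qed.

Lemma derive_near_cst (f : plane R -> R) x h (k : R) :
  (\near x, f x = k) -> 'D_(basis2 h) f x = 0.
Proof.
move=> fk; have H : is_derive x (basis2 h) f 0.
  apply: near_eq_is_derive (is_derive_cst k x (basis2 h)).
  by apply: filterS fk => z ->.
by case: H.
Qed.

End Cutoff.

Section Energy.
Context {R : realType}.

Lemma derive_profile (w : R) (rho y : plane R -> R) (g dg : R -> R) x h :
  C_k 1 rho -> C_k 1 y -> (forall s : R, is_derive s 1 g (dg s)) ->
  'D_(basis2 h) (fun x => w * rho x + (g (y x) - g 0)) x =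
  w * 'D_(basis2 h) rho x + dg (y x) * 'D_(basis2 h) y x.
Proof.
move=> hr hy hg.
have H := is_deriveD (is_deriveZ w (C_kS_is_derive h x hr))
  (is_deriveB (is_derive_chain (C_kS_is_derive h x hy) (hg (y x)))
     (is_derive_cst (g 0) x (basis2 h))).
by have [_ /= E] := H; rewrite subr0 in E; exact: E.
Qed.

(** The shape of a real coordinate of phi(|u|)u: one function of the cutoff plus one function of the
    perturbation. Each is a C^1 function of one variable composed with a smooth function, so the two
    are approximated separately. *)
Lemma smooth_lim_profile (K : set (plane R)) B (w : R) (t y : plane R -> R) (f df g dg : R -> R) :
  K `<=` sqbox B ->
  (forall k, C_k k t) -> (forall x, t x != 0 -> K x) ->
  (forall k, C_k k y) -> (forall x, y x != 0 -> K x) ->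
  (forall s : R, is_derive s 1 f (df s)) -> continuous df -> f 0 = 0 ->
  (forall s : R, is_derive s 1 g (dg s)) -> continuous dg ->
  smooth_lim K (fun x => w * f (t x) + (g (y x) - g 0)).
Proof.
move=> KB ht tK hy yK hf cdf f0 hg cdg; apply: smooth_limD.
  by apply: smooth_limZ; exact: (smooth_lim_comp ht tK KB hf cdf f0).
have hg' (s : R) : is_derive s 1 (fun s => g s - g 0) (dg s).
  by apply: (is_derive_eq (is_deriveB (hg s) (is_derive_cst (g 0) s 1))); rewrite subr0.
by apply: (smooth_lim_comp hy yK KB hg' cdg); rewrite subrr.
Qed.

Lemma bmeas_comp (g : R -> R) (y : plane R -> R) : continuous g -> continuous y ->
  (exists C, forall x, `|y x| <= C) -> bmeas (g \o y).
Proof.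
move=> cg cy [C yC]; split.
  apply: continuous_measurable_plane => x.
  by apply: continuous_comp; [exact: cy|exact: cg].
have [D HD] := continuous_bounded C cg.
by exists D => x; exact: HD.
Qed.

Context {m : nat}.
Notation idx := ('I_2 * 'I_2 * ('I_m * 'I_m) * bool)%type.

Lemma vnormE (u : 'cV[R[i]]_m) :
  vnorm u = Num.sqrt (\sum_i (complex.Re (u i 0) ^+ 2 + complex.Im (u i 0) ^+ 2)).
Proof.
rewrite /vnorm /herm Re_sum; congr Num.sqrt; apply: eq_bigr => i _.
by case: (u i 0) => a b /=; rewrite mulrN opprK !expr2.
Qed.

Definition rdot (u v : 'cV[R[i]]_m) : R := complex.Re (herm u v).

Lemma rdotE u v : rdot u v = \sum_i (complex.Re (u i 0) * complex.Re (v i 0) +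
  complex.Im (u i 0) * complex.Im (v i 0)).
Proof.
rewrite /rdot /herm Re_sum; apply: eq_bigr => i _.
by case: (u i 0) => a b; case: (v i 0) => c d /=; rewrite mulrN opprK.
Qed.

Lemma rdot_ge0 (u : 'cV[R[i]]_m) : 0 <= rdot u u.
Proof. by rewrite rdotE sumr_ge0// => i _; rewrite -!expr2 addr_ge0 ?sqr_ge0. Qed.

Lemma rdot_vnorm1 (u : 'cV[R[i]]_m) : vnorm u = 1 -> rdot u u = 1.
Proof.
by move=> u1; rewrite -[LHS]sqr_sqrtr ?rdot_ge0// [Num.sqrt _]u1 expr1n.
Qed.

(* [coef] is the bilinear form on the velocities of the two curves of section
   [Curve], attached to omega and to zeta' = zeta - Re<zeta,omega> omega. *)
Definition perp (omega zeta : 'cV[R[i]]_m) : 'cV[R[i]]_m :=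
  \col_i (zeta i 0 - (rdot zeta omega)%:C * omega i 0).

Definition coef (phi : R -> R) (M : R) (omega zeta : 'cV[R[i]]_m) (t : idx) (s : R) : R :=
  let b := rdot zeta omega in let z := perp omega zeta in let c := rdot z z in
  let i := t.1.2.1 in let j := t.1.2.2 in
  bil t.2
    (dcurve M b (complex.Re (omega j 0)) (complex.Re (z j 0)) s +i*
     dcurve M b (complex.Im (omega j 0)) (complex.Im (z j 0)) s)
    (dpcurve phi M b c (complex.Re (omega i 0)) (complex.Re (z i 0)) s +i*
     dpcurve phi M b c (complex.Im (omega i 0)) (complex.Im (z i 0)) s).

Lemma continuous_coef phi M (omega zeta : 'cV[R[i]]_m) t :
  phi_conditions phi -> 0 < M -> continuous (coef phi M omega zeta t).
Proof.
move=> hphi M0.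
have cd w zz : continuous (dcurve M (rdot zeta omega) w zz) by exact: continuous_dcurve.
have cp w zz : continuous (dpcurve phi M (rdot zeta omega)
    (rdot (perp omega zeta) (perp omega zeta)) w zz).
  by apply: continuous_dpcurve => //; exact: rdot_ge0.
rewrite /coef /bil => s.
by case: t.2; [apply: cvgB|apply: cvgD]; apply: cvgM; (exact: cd || exact: cp).
Qed.

(** Here al and ga stand for derivatives of the cutoff terms, be and de for derivatives of y. At
    every point one of the two pairs vanishes, and with it the mixed terms. *)
Lemma bil_profile b (w1 w2 w3 w4 u1 u2 v1 v2 al be ga de : R) :
  (al = 0 /\ ga = 0) \/ (be = 0 /\ de = 0) ->
  bil b ((w1 * al + u1 * be) +i* (w2 * al + u2 * be))
        ((w3 * ga + v1 * de) +i* (w4 * ga + v2 * de)) =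
  bil b (w1 +i* w2) (w3 +i* w4) * al * ga + bil b (u1 +i* u2) (v1 +i* v2) * be * de.
Proof.
by case: b => -[[-> ->]|[-> ->]]; rewrite /bil/=; ring.
Qed.

Lemma rdot_sub_scale (u v : 'cV[R[i]]_m) (b : R) :
  rdot (\col_i (u i 0 - b%:C * v i 0)) v = rdot u v - b * rdot v v.
Proof.
rewrite !rdotE mulr_sumr -sumrB; apply: eq_bigr => i _.
by rewrite mxE Re_subc Im_subc Re_mulc Im_mulc /=; ring.
Qed.

Lemma rdot_perp (omega zeta : 'cV[R[i]]_m) : vnorm omega = 1 ->
  rdot (perp omega zeta) omega = 0.
Proof.
move=> /rdot_vnorm1 w1.
by rewrite rdot_sub_scale w1 mulr1 subrr.
Qed.


(** Pythagoras: z is orthogonal to omega for the real inner product, so no term in s exp(b s)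
    survives in the squared modulus. *)
Lemma vnorm_curve M b (omega z : 'cV[R[i]]_m) s (u : 'cV[R[i]]_m) : 0 < M ->
  rdot omega omega = 1 -> rdot z omega = 0 ->
  (forall i, u i 0 = curve M b (complex.Re (omega i 0)) (complex.Re (z i 0)) s +i*
                     curve M b (complex.Im (omega i 0)) (complex.Im (z i 0)) s) ->
  vnorm u = M * cnorm b (rdot z z) s.
Proof.
move=> M0 w1 zw uE.
have -> : vnorm u = Num.sqrt (M ^+ 2 * (expR (2 * b * s) + rdot z z * s ^+ 2)).
  rewrite vnormE; congr Num.sqrt.
  transitivity (\sum_i (M ^+ 2 * expR (b * s) ^+ 2 * (complex.Re (omega i 0) * complex.Re (omega i 0) +
      complex.Im (omega i 0) * complex.Im (omega i 0)) +
    (M ^+ 2 * (2 * s * expR (b * s)) * (complex.Re (z i 0) * complex.Re (omega i 0) +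
      complex.Im (z i 0) * complex.Im (omega i 0)) +
     M ^+ 2 * s ^+ 2 * (complex.Re (z i 0) * complex.Re (z i 0) +
      complex.Im (z i 0) * complex.Im (z i 0))))).
    by apply: eq_bigr => i _; rewrite uE /= /curve; ring.
  rewrite !big_split/= -!mulr_sumr -!rdotE w1 zw mulr0 add0r mulr1.
  have -> : expR (2 * b * s) = expR (b * s) ^+ 2 by rewrite -expRM_natl mulrA.
  by ring.
by rewrite sqrtrM ?sqr_ge0// sqrtr_sqr gtr0_norm.
Qed.

Lemma vnorm_scale k (omega u : 'cV[R[i]]_m) : 0 <= k -> rdot omega omega = 1 ->
  (forall i, u i 0 = (complex.Re (omega i 0) * k) +i* (complex.Im (omega i 0) * k)) ->
  vnorm u = k.
Proof.
move=> k0 w1 uE; rewrite vnormE (_ : \sum_i _ = k ^+ 2 * rdot omega omega).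
  by rewrite w1 mulr1 sqrtr_sqr ger0_norm.
by rewrite rdotE mulr_sumr; apply: eq_bigr => i _; rewrite uE /=; ring.
Qed.

(** The point is the order of the quantifiers: E0, the energy of the cutoff alone, is chosen before
    y, so y can be oscillated and scaled against a fixed constant. *)
Lemma energy_bound (Omega : set (plane R)) (a : idx -> plane R -> R) (phi : R -> R)
    (M : R) (omega zeta : 'cV[R[i]]_m) (p q r : R) :
  phi_conditions phi -> 0 < M -> vnorm omega = 1 -> 0 < r ->
  csq p q (3 * r) `<=` Omega ->
  (forall t, bmeas (a t)) ->
  entries_dissipative Omega phi a ->
  exists E0 : R, forall y : plane R -> R, (forall k, C_k k y) ->
    (forall x, y x != 0 -> csq p q r x) ->
    0 <= E0 + \int[leb2]_(x in setT) \sum_t (a t x * (coef phi M omega zeta t (y x) *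
        ('D_(basis2 t.1.1.2) y x * 'D_(basis2 t.1.1.1) y x))).
Proof.
move=> hphi M0 w1 r0 KO ba H.
have [N [N0 hflow cflow]] := sphi_pow_C1 hphi M0.
have ww := rdot_vnorm1 w1.
set b := rdot zeta omega; set z := perp omega zeta; set c := rdot z z.
have zw : rdot z omega = 0 by exact: rdot_perp.
have c0 : 0 <= c by exact: rdot_ge0.
pose tau := cutoff p q r.
have htau k : C_k k tau by exact: C_k_cutoff.
(* With this power, phi(rho) rho is the C^1 function [sphi_pow] of tau, even at points where tau
   vanishes. *)
pose rho x := M * tau x ^+ N.
pose flo x := sphi_pow phi M N (tau x).
have hrho k : C_k k rho.
  have -> : rho = horner (M *: 'X^N) \o tau by apply/funext => x; rewrite /= !hornerE.
  by apply: smooth1_comp => //; exact: smooth1_poly.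
have hflo : C_k 1 flo by exact: (C1_comp (htau 1%N) hflow cflow).
pose wr i := complex.Re (omega i 0); pose wi i := complex.Im (omega i 0).
pose zr i := complex.Re (z i 0); pose zi i := complex.Im (z i 0).
pose K := csq p q (3 * r).
pose B := Num.max `|p| `|q| + 3 * r.
have cK : closed K by exact: closed_csq.
have KB : K `<=` sqbox B by exact: csq_sqbox.
have tauK x : tau x != 0 -> K x by exact: cutoff_supp.
have tau0 : forall x, tau x = 0 -> rho x = 0 /\ flo x = 0.
  move=> x; rewrite /rho /flo /sphi_pow => ->; rewrite ltxx expr0n.
  by rewrite gtn_eqF// mulr0.
pose E (x : plane R) := \sum_(t : idx) (a t x * (bil t.2 (omega t.1.2.2 0) (omega t.1.2.1 0) *
   ('D_(basis2 t.1.1.2) rho x * 'D_(basis2 t.1.1.1) flo x))).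
exists (\int[leb2]_(x in setT) E x) => y hy yQ.
have y0K x : ~ csq p q r x -> y x = 0.
  by move=> nQ; apply/eqP; apply: contrapT => /negP /yQ.
have csqS : csq p q r `<=` K.
  by move=> x [h1 h2]; split; rewrite (le_trans (y := r))// ler_peMl ?ltW// ltr1n.
have yK x : y x != 0 -> K x by move=> /yQ /csqS.
have tau1 x : csq p q r x -> \near x, tau x = 1.
  by move=> /(near_csq r0); apply: filterS => v; exact: cutoff_in.
pose re_u (w zz : R) x := w * rho x + (curve M b w zz (y x) - curve M b w zz 0).
pose re_v (w zz : R) x := w * flo x + (pcurve phi M b c w zz (y x) - pcurve phi M b c w zz 0).
pose u x : 'cV[R[i]]_m := \col_i (re_u (wr i) (zr i) x +i* re_u (wi i) (zi i) x).
have uE i : (fun x => u x i 0) = (fun x => re_u (wr i) (zr i) x +i* re_u (wi i) (zi i) x).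
  by apply/funext => x; rewrite mxE.
have vE i : (fun x => phi_mul phi u x i 0) =
    (fun x => re_v (wr i) (zr i) x +i* re_v (wi i) (zi i) x).
  apply/funext => x; rewrite mxE.
  have scal (k d1 d2 : R) : k%:C * (d1 +i* d2) = (k * d1) +i* (k * d2).
    by apply/eqP; rewrite eq_complex/= !mul0r subr0 addr0 !eqxx.
  (* Where y vanishes, u is rho omega, of modulus rho. Elsewhere x lies in the small square, so tau
     = 1, the terms at parameter 0 cancel and u lies on the curve. *)
  have [yx|yx] := eqVneq (y x) 0.
    have rho0 : 0 <= rho x by rewrite mulr_ge0 ?(ltW M0)// exprn_ge0// cutoff_ge0.
    rewrite (@vnorm_scale (rho x) omega)//; last first.
      by move=> j; rewrite mxE /re_u yx !subrr !addr0.
    rewrite mxE scal /re_u /re_v yx !subrr !addr0.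
    have -> : flo x = phi (rho x) * rho x.
      rewrite /flo /sphi_pow; case: ifPn => [_|]; first by rewrite /rho mulrC.
      rewrite -leNgt => t0; have t00 : tau x = 0 by apply/eqP; rewrite eq_le t0 cutoff_ge0.
      by rewrite (tau0 x t00).1 mulr0.
    by congr (_ +i* _); ring.
  have t1 := nbhs_singleton (tau1 x (yQ x yx)).
  have rhoM : rho x = M by rewrite /rho t1 expr1n mulr1.
  have floM : flo x = M * phi M by rewrite /flo /sphi_pow t1 ltr01 expr1n mulr1.
  have ruE w zz : re_u w zz x = curve M b w zz (y x).
    by rewrite /re_u rhoM curve0 mulrC addrC subrK.
  have rvE w zz : re_v w zz x = pcurve phi M b c w zz (y x).
    by rewrite /re_v floM /pcurve curve0 cnorm0 mulr1; ring.
  rewrite (@vnorm_curve M b omega z (y x))//; last by move=> j; rewrite mxE !ruE.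
  by rewrite mxE scal !ruE !rvE.
have supp_u (w zz : R) x : re_u w zz x != 0 -> K x.
  apply: contra_neqP => nK.
  have y0 : y x = 0 by apply: y0K => /csqS.
  have t0 : tau x = 0 by apply/eqP; apply: contrapT => /negP /tauK.
  by rewrite /re_u y0 subrr (tau0 x t0).1 mulr0 addr0.
have sl_u (w zz : R) : smooth_lim K (re_u w zz).
  apply: smooth_lim_smooth; last exact: supp_u.
  move=> k; apply: C_kD; first exact: C_kZ.
  by apply: C_kB; [apply: smooth1_comp => //; exact: smooth1_curve|exact: C_k_cst].
have sl_v (w zz : R) : smooth_lim K (re_v w zz).
  apply: (@smooth_lim_profile K B w tau y (sphi_pow phi M N) (dsphi_pow phi M N)
    (pcurve phi M b c w zz) (dpcurve phi M b c w zz)) => //.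
  - by rewrite /sphi_pow ltxx.
  - by move=> s; exact: is_derive_pcurve.
  - exact: continuous_dpcurve.
have Hu i : smooth_lim K (cre (fun x => u x i 0)) /\ smooth_lim K (cim (fun x => u x i 0)).
  by rewrite uE; split; exact: sl_u.
have Hv i : smooth_lim K (cre (fun x => phi_mul phi u x i 0)) /\
    smooth_lim K (cim (fun x => phi_mul phi u x i 0)).
  by rewrite vE; split; exact: sl_v.
have := H K B u cK KO KB Hu Hv; congr (0 <= _).
have bDrho h : bsupp (fun x => 'D_(basis2 h) rho x).
  apply: (@C1_bsupp_derive _ _ B) => // x; apply: contra_neqP => nK.
  by apply: (tau0 x _).1; apply/eqP; apply: contrapT => /negP /tauK /KB.
have bDflo h : bsupp (fun x => 'D_(basis2 h) flo x).
  apply: (@C1_bsupp_derive _ _ B) => // x; apply: contra_neqP => nK.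
  by apply: (tau0 x _).2; apply/eqP; apply: contrapT => /negP /tauK /KB.
have yB x : y x != 0 -> sqbox B x by move=> /yK /KB.
have bDy h : bsupp (fun x => 'D_(basis2 h) y x).
  exact: (@C1_bsupp_derive _ _ B).
have by_ : exists C, forall x, `|y x| <= C.
  by have [[]] := C0_bsupp (C_k_continuous (hy 0%N)) yB.
have cy : continuous y by exact: C_k_continuous (hy 0%N).
have ccoef t : continuous (coef phi M omega zeta t) by exact: continuous_coef.
rewrite -RintegralD//.
- apply: eq_Rintegral => x _; rewrite /E -big_split/=; apply: eq_bigr => t _.
  rewrite -mulrDr; congr (_ * _).
  have cuE k j : cpartial k (fun x => u x j 0) x =
      (wr j * 'D_(basis2 k) rho x + dcurve M b (wr j) (zr j) (y x) * 'D_(basis2 k) y x) +i*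
      (wi j * 'D_(basis2 k) rho x + dcurve M b (wi j) (zi j) (y x) * 'D_(basis2 k) y x).
    rewrite uE /cpartial; congr (_ +i* _).
      exact: (derive_profile _ x k (hrho 1%N) (hy 1%N) (is_derive_curve M b (wr j) (zr j))).
    exact: (derive_profile _ x k (hrho 1%N) (hy 1%N) (is_derive_curve M b (wi j) (zi j))).
  have cvE k j : cpartial k (fun x => phi_mul phi u x j 0) x =
      (wr j * 'D_(basis2 k) flo x + dpcurve phi M b c (wr j) (zr j) (y x) * 'D_(basis2 k) y x) +i*
      (wi j * 'D_(basis2 k) flo x + dpcurve phi M b c (wi j) (zi j) (y x) * 'D_(basis2 k) y x).
    have hp w zz (s : R) : is_derive s 1 (pcurve phi M b c w zz) (dpcurve phi M b c w zz s).
      exact: is_derive_pcurve.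
    rewrite vE /cpartial; congr (_ +i* _).
      exact: (derive_profile _ x k hflo (hy 1%N) (hp (wr j) (zr j))).
    exact: (derive_profile _ x k hflo (hy 1%N) (hp (wi j) (zi j))).
  rewrite cuE cvE bil_profile.
    have ceta (d : R[i]) : complex.Re d +i* complex.Im d = d by case: d.
    by rewrite /coef -/b -/z -/c /wr /wi !ceta !mulrA.
  (* On the closed small square, boundary included, tau is 1 in a whole neighbourhood because its
     plateau has twice the radius; off the square, y is 0 in a neighbourhood. *)
  have [xQ|nQ] := pselect (csq p q r x).
    left; split.
      apply: (@derive_near_cst _ _ _ _ M); apply: filterS (tau1 x xQ) => v tv.
      by rewrite /rho tv expr1n mulr1.
    apply: (@derive_near_cst _ _ _ _ (sphi_pow phi M N 1)); apply: filterS (tau1 x xQ) => v tv.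
    by rewrite /flo tv.
  by right; split; apply: C_k_supp_derive nQ => //; exact: closed_csq.
- apply: bsupp_integrable; apply: bsupp_sum => t; apply: bsuppMl => //.
  apply: bsuppMl; first exact: bmeas_cst.
  by apply: bsuppMl; case: (bDrho t.1.1.2).
- apply: bsupp_integrable; apply: bsupp_sum => t; apply: bsuppMl => //.
  apply: bsuppMl; first exact: bmeas_comp.
  by apply: bsuppMl; case: (bDy t.1.1.2).
Qed.

End Energy.

(** * High frequency limit *)

Section Oscillation.
Context {R : realType}.

Lemma cvgn_sum (T : finType) (u : T -> nat -> R) (l : T -> R) :
  (forall t, u t n @[n --> \oo] --> l t) ->
  \sum_t u t n @[n --> \oo] --> \sum_t l t.
Proof.
move=> H; rewrite -big_enum/=.
rewrite (_ : (fun n => _) = (fun n => \sum_(t <- enum T) u t n)); last first.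
  by apply/funext => n; rewrite big_enum.
elim: (enum T) => [|t s IH].
  rewrite big_nil (_ : (fun n => _) = (fun=> 0)); first exact: cvg_cst.
  by apply/funext => n; rewrite big_nil.
rewrite big_cons (_ : (fun n => _) = (fun n => u t n + \sum_(t <- s) u t n)).
  by apply: cvgD.
by apply/funext => n; rewrite big_cons.
Qed.

(** Dominated convergence with C times the indicator of a box as majorant. It serves for the high
    frequency limit and again for approximating the indicator of a rectangle. *)
Lemma Rintegral_limit_ge (F : nat -> plane R -> R) (G : plane R -> R) (B C E : R) :
  (forall n, measurable_fun setT (F n)) -> measurable_fun setT G ->
  (forall x, F n x @[n --> \oo] --> G x) ->
  (forall n x, `|F n x| <= C) -> (forall n x, F n x != 0 -> sqbox B x) ->
  (forall n, 0 <= E + \int[leb2]_(x in setT) F n x) ->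
  0 <= E + \int[leb2]_(x in setT) G x.
Proof.
move=> mF mG FG FC FB H.
have C0 : 0 <= C by rewrite (le_trans _ (FC 0%N (0, 0))).
pose g (x : plane R) : R := C * \1_(sqbox B) x.
have ig : leb2.-integrable setT (EFin \o g).
  apply: bsupp_integrable; apply: bsuppMl; first exact: bmeas_cst.
  split; last by exists B => x; rewrite indicE; case: (boolP (x \in sqbox B)); rewrite ?inE// eqxx.
  split; first by apply: measurable_indic; exact: measurable_sqbox.
  by exists 1 => x; rewrite indicE ger0_norm//; case: (_ \in _).
have Fg n x : `|F n x| <= g x.
  rewrite /g indicE; have [/FB xB|] := boolP (F n x != 0).
    by rewrite mem_set// mulr1.
  by rewrite negbK => /eqP ->; rewrite normr0 mulr_ge0.
have cvE x : (EFin \o F n) x @[n --> \oo] --> (EFin \o G) x.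
  by apply: cvg_EFin; [exact: nearW|exact: FG].
have [iG _ cv] := dominated_convergence (mu := @leb2 R) measurableT
  (f_ := fun n => EFin \o F n) (f := EFin \o G) (g := EFin \o g)
  (fun n => (measurable_EFinP _ _).2 (mF n)) ((measurable_EFinP _ _).2 mG)
  (aeW _ (fun x _ => cvE x)) ig
  (aeW _ (fun x n _ => Fg n x)).
have iF n : leb2.-integrable setT (EFin \o F n).
  apply: le_integrable ig => //; first exact/measurable_EFinP.
  by move=> x _ /=; rewrite lee_fin (le_trans (Fg n x))// ler_norm.
suff : ((- E)%:E <= \int[leb2]_(x in setT) (EFin \o G) x)%E.
  rewrite -[X in (_ <= X)%E]fineK; last exact: integrable_fin_num.
  by rewrite lee_fin -subr_ge0 opprK addrC.
apply: cvge_ge cv; apply: nearW => n.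
rewrite -[X in (_ <= X)%E]fineK; last exact: integrable_fin_num.
by rewrite lee_fin -subr_ge0 opprK addrC; exact: H.
Qed.

Lemma ge0_quadratic (E I : R) : (forall n : nat, 0 <= E + n%:R ^+ 2 * I) -> 0 <= I.
Proof.
move=> H; rewrite leNgt; apply/negP => I0.
have [n _ /(_ n.+1 (leqnSn n)) Hn] := nbhs_infty_gtr (`|E| / - I).
have := H n.+1; apply/negP; rewrite -ltNge.
have n1 : 1 <= n.+1%:R :> R by rewrite ler1n.
move: Hn; rewrite ltr_pdivrMr ?oppr_gt0//.
have := ler_norm E; move: n1; move: (n.+1%:R : R) `|E| => N A N1 EA AN.
have N0 : 0 <= N by rewrite (le_trans ler01).
have le2 : N * - I <= N * (N * - I) by rewrite ler_peMl// mulr_ge0// oppr_ge0 ltW.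
have -> : N ^+ 2 * I = - (N * (N * - I)) by ring.
by rewrite mulrC in AN; lra.
Qed.

(* The energies of chi sin(n l)/n and chi cos(n l)/n have a sum without
   oscillating leading term, because sin^2 + cos^2 = 1. *)
Lemma oscillation_limit (d : R -> R) (eps chi dk dh xk xh : R) (S C : R) :
  S ^+ 2 + C ^+ 2 = 1 ->
  d (eps * (chi * S)) * ((eps * (dk * S) + chi * xk * C) * (eps * (dh * S) + chi * xh * C))
  + d (eps * (chi * C)) * ((eps * (dk * C) - chi * xk * S) * (eps * (dh * C) - chi * xh * S))
  - d 0 * (xk * xh * chi ^+ 2) =
  (d (eps * (chi * S)) - d 0) * ((eps * (dk * S) + chi * xk * C) * (eps * (dh * S) + chi * xh * C))
  + (d (eps * (chi * C)) - d 0) * ((eps * (dk * C) - chi * xk * S) * (eps * (dh * C) - chi * xh * S))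
  + d 0 * (eps ^+ 2 * (dk * dh)).
Proof.
move=> SC; have -> : xk * xh * chi ^+ 2 = xk * xh * chi ^+ 2 * (S ^+ 2 + C ^+ 2).
  by rewrite SC mulr1.
by rewrite -[in RHS](mulr1 (dk * dh)) -[in RHS]SC; ring.
Qed.


(** By [oscillation_limit] the distance to the limit is a sum of null sequences times bounded ones.
    The convergence is thus pointwise, as dominated convergence requires; the sine term alone would
    in general converge only in the mean. *)
Lemma oscillation_cvg (d : R -> R) (chi dk dh xk xh l : R) : continuous d ->
  (fun n : nat => let e := n.+1%:R^-1 in let S := sin (n.+1%:R * l) in let C := cos (n.+1%:R * l) in
  d (e * (chi * S)) * ((e * (dk * S) + chi * xk * C) * (e * (dh * S) + chi * xh * C))
  + d (e * (chi * C)) * ((e * (dk * C) - chi * xk * S) * (e * (dh * C) - chi * xh * S)))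
  @ \oo --> d 0 * (xk * xh * chi ^+ 2).
Proof.
move=> cd.
pose e (n : nat) : R := n.+1%:R^-1.
pose S n := sin (n.+1%:R * l); pose C n := cos (n.+1%:R * l).
have ce : e n @[n --> \oo] --> (0 : R) by exact: cvg_harmonic.
have e1 n : 0 <= e n <= 1 by rewrite invr_ge0 ler0n/= invf_le1 ?ltr0n// ler1n.
have Sb n : `|S n| <= 1 by rewrite ler_norml sin_geN1 sin_le1.
have Cb n : `|C n| <= 1 by rewrite ler_norml cos_geN1 cos_le1.
have bnd0 (u v : nat -> R) (K : R) : u n @[n --> \oo] --> (0 : R) -> (forall n, `|v n| <= K) ->
    u n * v n @[n --> \oo] --> (0 : R).
  move=> u0 vK; apply/cvgr0Pnorm_le => eps eps0.
  have K0 : 0 <= K by rewrite (le_trans _ (vK 0%N)).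
  have /cvgr0Pnorm_le /(_ (eps / (K + 1))) := u0.
  have -> : 0 < eps / (K + 1) by rewrite divr_gt0// ltr_wpDl.
  move=> /(_ isT); apply: filterS => n un.
  rewrite normrM (@le_trans _ _ (eps / (K + 1) * (K + 1)))//.
    by rewrite ler_pM// (le_trans (vK n))// lerDl.
  by rewrite divfK// gt_eqF// ltr_wpDl.
have dlim (v : nat -> R) : (forall n, `|v n| <= 1) ->
    d (e n * (chi * v n)) - d 0 @[n --> \oo] --> (0 : R).
  move=> v1; apply/subr_cvg0.
  apply: (@cvg_comp _ _ _ (fun n => e n * (chi * v n)) d _ (nbhs (0 : R))); last exact: cd.
  apply: (bnd0 _ _ `|chi|) => // n.
  by rewrite normrM ler_piMr.
have fb (x y : R) n (s t : R) : `|s| <= 1 -> `|t| <= 1 -> `|e n * (x * s) + y * t| <= `|x| + `|y|.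
  move=> s1 t1; rewrite (le_trans (ler_normD _ _))// !normrM lerD//.
    have /andP[e0 e1'] := e1 n; rewrite (ger0_norm e0) -[leRHS]mul1r ler_pM ?mulr_ge0//.
    by rewrite ler_piMr.
  by rewrite ler_piMr.
have key : (fun n => (d (e n * (chi * S n)) - d 0) *
     ((e n * (dk * S n) + chi * xk * C n) * (e n * (dh * S n) + chi * xh * C n))
  + (d (e n * (chi * C n)) - d 0) *
     ((e n * (dk * C n) + (- (chi * xk)) * S n) * (e n * (dh * C n) + (- (chi * xh)) * S n))
  + d 0 * (e n ^+ 2 * (dk * dh))) @ \oo --> (0 + 0 + d 0 * (0 ^+ 2 * (dk * dh)) : R).
  apply: cvgD; first apply: cvgD.
  - apply: (bnd0 _ _ ((`|dk| + `|chi * xk|) * (`|dh| + `|chi * xh|))); first exact: dlim.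
    by move=> n; rewrite normrM ler_pM// fb.
  - apply: (bnd0 _ _ ((`|dk| + `|- (chi * xk)|) * (`|dh| + `|- (chi * xh)|))); first exact: dlim.
    by move=> n; rewrite normrM ler_pM// fb.
  - apply: cvgM; first exact: cvg_cst.
    apply: cvgM; last exact: cvg_cst.
    by rewrite expr2; apply: cvgM.
rewrite expr0n mul0r mulr0 !addr0 in key.
apply/subr_cvg0; apply: cvg_trans key; apply: near_eq_cvg; apply: nearW => n /=.
rewrite !mulNr -oscillation_limit//.
by rewrite addrC cos2Dsin2.
Qed.

Context (T : finType) (a : T -> plane R -> R) (c : T -> R -> R) (k h : T -> 'I_2).
Context (E0 p q r : R).
Context (ba : forall t, bmeas (a t)).
Context (cc : forall t, continuous (c t)).
Context (energy : forall y : plane R -> R, (forall k, C_k k y) ->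
    (forall x, y x != 0 -> csq p q r x) ->
    0 <= E0 + \int[leb2]_(x in setT) \sum_t (a t x * (c t (y x) *
        ('D_(basis2 (k t)) y x * 'D_(basis2 (h t)) y x)))).


Lemma oscillation (chi : plane R -> R) (xi : 'rV[R]_2) :
  (forall k, C_k k chi) -> (forall x, chi x != 0 -> csq p q r x) ->
  0 <= (E0 + E0) + \int[leb2]_(x in setT) \sum_t (a t x *
         (c t 0 * (xi 0 (k t) * xi 0 (h t) * chi x ^+ 2))).
Proof.
move=> hchi chiQ.
pose B := Num.max `|p| `|q| + r.
have chiB x : chi x != 0 -> sqbox B x by move=> /chiQ /csq_sqbox.
have chi0 x : ~ csq p q r x -> chi x = 0.
  by move=> nQ; apply/eqP; apply: contrapT => /negP /chiQ.
have dchi0 x j : ~ csq p q r x -> 'D_(basis2 j) chi x = 0.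
  by move=> nQ; apply: C_k_supp_derive nQ => //; exact: closed_csq.
pose l (x : plane R) := xi 0 ord0 * x.1 + xi 0 (lift ord0 ord0) * x.2.
pose ang (n : nat) (x : plane R) := (n.+1%:R * xi 0 ord0) * x.1 + (n.+1%:R * xi 0 (lift ord0 ord0)) * x.2.
have angE n x : ang n x = n.+1%:R * l x by rewrite /ang /l mulrDr !mulrA.
have hang n j x : is_derive x (basis2 j) (ang n) (n.+1%:R * xi 0 j).
  apply: (is_derive_eq (is_derive_linear2 _ _ x j)).
  have [->|->] := ord2_cases j.
    by rewrite /basis2 /= mulr1 mulr0 addr0.
  by rewrite /basis2 /= mulr1 mulr0 add0r.
have cang n i : C_k i (ang n) by exact: C_k_linear2.
pose e (n : nat) : R := n.+1%:R^-1.
have e1 n : 0 <= e n <= 1 by rewrite invr_ge0 ler0n/= invf_le1 ?ltr0n// ler1n.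
(* The amplitude 1/(n+1) cancels the frequency n+1 upon differentiation: y tends to 0 uniformly and
   its gradient stays bounded without tending to 0. *)
pose y (g : R -> R) n x := e n * (chi x * g (ang n x)).
have hy g n : smooth1 g -> forall i, C_k i (y g n).
  by move=> sg i; apply: C_kZ; apply: C_kM => //; exact: smooth1_comp.
have yQ g n x : y g n x != 0 -> csq p q r x.
  by rewrite /y !mulf_eq0 !negb_or => /and3P[_ /chiQ].
have Dy g dg n x j : smooth1 g -> (forall s : R, is_derive s 1 g (dg s)) ->
    'D_(basis2 j) (y g n) x =
    e n * ('D_(basis2 j) chi x * g (ang n x)) + chi x * xi 0 j * dg (ang n x).
  move=> sg hg.
  have H := is_deriveZ (e n) (is_deriveM (C_kS_is_derive j x (hchi 1%N))
     (is_derive_chain (hang n j x) (hg (ang n x)))).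
  transitivity (e n *: (chi x *: (dg (ang n x) * (n.+1%:R * xi 0 j)) +
      g (ang n x) *: 'D_(basis2 j) chi x)); first by case: H.
  by rewrite /GRing.scale/= /e; field.
have ssin : smooth1 (@sin R) by exact: smooth1_sin.
have scos : smooth1 (@cos R) by exact: smooth1_cos.
have Dsin n x j := Dy _ _ n x j ssin (@is_derive_sin R).
have Dcos n x j := Dy _ _ n x j scos (@is_derive_cos R).
pose f g n t x := a t x * (c t (y g n x) * ('D_(basis2 (k t)) (y g n) x * 'D_(basis2 (h t)) (y g n) x)).
pose F n x := \sum_t f (@sin R) n t x + \sum_t f (@cos R) n t x.
have bchi := C0_bsupp (C_k_continuous (hchi 0%N)) chiB.
have [[_ [X HX]] _] := bchi.
have yX (g : R -> R) n x : (forall s, `|g s| <= 1) -> `|y g n x| <= X.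
  move=> g1; have /andP[en0 en1] := e1 n.
  rewrite /y normrM (ger0_norm en0) (le_trans _ (HX x))//.
  rewrite -[leRHS]mul1r ler_pM// normrM ler_piMr//.
have sin1 s : `|@sin R s| <= 1 by rewrite ler_norml sin_geN1 sin_le1.
have cos1 s : `|@cos R s| <= 1 by rewrite ler_norml cos_geN1 cos_le1.
have bf (g : R -> R) n t : smooth1 g -> (forall s, `|g s| <= 1) -> bsupp (f g n t).
  move=> sg g1.
  have yB x : y g n x != 0 -> sqbox B x by move=> /yQ /csq_sqbox.
  have bD j : bsupp (fun x => 'D_(basis2 j) (y g n) x).
    by apply: (@C1_bsupp_derive _ _ B) => //; exact: hy.
  apply: bsuppMl => //; apply: bsuppMl; last by apply: bsuppMl; case: (bD (k t)).
  apply: bmeas_comp => //; first exact: (C_k_continuous (hy g n sg 0%N)).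
  by exists X => x; exact: yX.
have [L HL] : exists L, forall j x, `|'D_(basis2 j) chi x| <= L.
  have [[_ [D0 H0]] _] := C1_bsupp_derive ord0 (hchi 1%N) chiB.
  have [[_ [D1 H1]] _] := C1_bsupp_derive (lift ord0 ord0) (hchi 1%N) chiB.
  exists (Num.max D0 D1) => j x.
  have [->|->] := ord2_cases j.
    by rewrite le_max H0.
  by rewrite le_max H1 orbT.
have bc t : exists C, forall s, `|s| <= X -> `|c t s| <= C by exact: continuous_bounded.
have [Ct HC] := boolp.choice bc.
have [At HA] := boolp.choice (fun t => (ba t).2).
have DB (g dg : R -> R) n x j : (forall s, `|g s| <= 1) -> (forall s, `|dg s| <= 1) ->
    `|e n * ('D_(basis2 j) chi x * g (ang n x)) + chi x * xi 0 j * dg (ang n x)| <= L + X * `|xi 0 j|.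
  move=> g1 dg1; have /andP[en0 en1] := e1 n.
  rewrite (le_trans (ler_normD _ _))// !normrM (ger0_norm en0) lerD//.
    rewrite -[leRHS]mul1r ler_pM ?mulr_ge0// -[leRHS]mulr1 ler_pM//.
  rewrite -[leRHS]mulr1 ler_pM ?mulr_ge0// ler_wpM2r//.
have fB (g dg : R -> R) n t x : smooth1 g -> (forall s : R, is_derive s 1 g (dg s)) ->
    (forall s, `|g s| <= 1) -> (forall s, `|dg s| <= 1) ->
    `|f g n t x| <= At t * (Ct t * ((L + X * `|xi 0 (k t)|) * (L + X * `|xi 0 (h t)|))).
  move=> sg hg g1 dg1; rewrite /f !normrM !(Dy g dg)// ler_pM//.
  rewrite ler_pM ?mulr_ge0//; first by rewrite HC// yX.
  by rewrite ler_pM// DB.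
apply: (@Rintegral_limit_ge F _ B
  (\sum_t At t * (Ct t * ((L + X * `|xi 0 (k t)|) * (L + X * `|xi 0 (h t)|))) +
   \sum_t At t * (Ct t * ((L + X * `|xi 0 (k t)|) * (L + X * `|xi 0 (h t)|))))).
- move=> n; have [] : bmeas (F n); last by [].
  have [bF _] : bsupp (F n); last exact: bF.
  by apply: bsuppD; apply: bsupp_sum => t; exact: bf.
- have [bG _] : bsupp (fun x => \sum_t (a t x * (c t 0 * (xi 0 (k t) * xi 0 (h t) * chi x ^+ 2)))).
    apply: bsupp_sum => t; apply: bsuppMl => //; apply: bsuppMl; first exact: bmeas_cst.
    apply: bsuppMl; first exact: bmeas_cst.
    by rewrite (_ : (fun x => _) = (fun x => chi x * chi x))//; apply: bsuppMl => //; case: bchi.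
  by case: bG.
- move=> x; rewrite (_ : (fun n => F n x) = (fun n => \sum_t (f (@sin R) n t x + f (@cos R) n t x))).
    apply: cvgn_sum => t.
    have H := @oscillation_cvg (c t) (chi x) ('D_(basis2 (k t)) chi x) ('D_(basis2 (h t)) chi x)
       (xi 0 (k t)) (xi 0 (h t)) (l x) (cc (t := t)).
    have Hc : (fun _ : nat => a t x) @ \oo --> a t x by exact: cvg_cst.
    apply: cvg_trans (cvgM Hc H); apply: near_eq_cvg; apply: nearW => n /=.
    rewrite /f -mulrDr !Dsin !Dcos /y angE; congr (_ * (_ + _)).
    by rewrite !mulrN.
  by apply/funext => n; rewrite big_split.
- move=> n x; rewrite (le_trans (ler_normD _ _))// lerD//.
    rewrite (le_trans (ler_norm_sum _ _ _))// ler_sum// => t _.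
    exact: (fB _ _ n t x ssin (@is_derive_sin R)).
  rewrite (le_trans (ler_norm_sum _ _ _))// ler_sum// => t _.
  apply: (fB _ _ n t x scos (@is_derive_cos R)) => // s.
  by rewrite normrN.
- move=> n x; apply: contra_neqP => nB.
  have nQ : ~ csq p q r x by move=> /csq_sqbox.
  have z g : smooth1 g -> forall t, f g n t x = 0.
    move=> sg t; rewrite /f (_ : 'D_(basis2 (k t)) (y g n) x = 0) ?mul0r ?mulr0//.
    apply: C_k_supp_derive nQ; [exact: closed_csq|exact: yQ].
  by rewrite /F !big1 ?addr0// => t _; exact: z.
- move=> n; rewrite RintegralD//; first last.
  + by apply: bsupp_integrable; apply: bsupp_sum => t; exact: bf.
  + by apply: bsupp_integrable; apply: bsupp_sum => t; exact: bf.
  rewrite addrACA addr_ge0//; first exact: (energy (hy _ n ssin) (yQ _ n)).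
  exact: (energy (hy _ n scos) (yQ _ n)).
Qed.

End Oscillation.

(** * From integrals against test functions to almost every point *)

Section Localization.
Context {R : realType}.

Lemma bmeas_sum (I : finType) (F : I -> plane R -> R) :
  (forall i, bmeas (F i)) -> bmeas (fun x => \sum_i F i x).
Proof.
move=> H; rewrite (_ : (fun x => _) = \sum_(i <- enum I) F i); last first.
  by apply/funext => x; rewrite fct_sumE big_enum.
elim: (enum I) => [|i s IH]; first by rewrite big_nil; exact: bmeas_cst.
by rewrite big_cons; exact: bmeasD.
Qed.

(** Replacing chi by n chi multiplies the integral by n^2 and leaves E unchanged, which removes E.
    Then chi is taken as 1 - exp(- n W) with W smooth, nonnegative and positive exactly on the open
    rectangle; this tends to the indicator of the rectangle. *)
Lemma rect_integral_ge0 (g : plane R -> R) (E p q r : R) : bmeas g ->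
  (forall chi : plane R -> R, (forall k, C_k k chi) ->
     (forall x, chi x != 0 -> csq p q r x) ->
     0 <= E + \int[leb2]_(x in setT) (g x * chi x ^+ 2)) ->
  forall p1 q1 s1 t1, rect p1 q1 s1 t1 `<=` csq p q r ->
    0 <= \int[leb2]_(x in rect p1 q1 s1 t1) g x.
Proof.
move=> bg H p1 q1 s1 t1 rQ.
have QB : csq p q r `<=` sqbox (Num.max `|p| `|q| + r) by exact: csq_sqbox.
have bchi (chi : plane R -> R) : (forall k, C_k k chi) ->
    (forall x, chi x != 0 -> csq p q r x) -> bsupp (fun x => g x * chi x ^+ 2).
  move=> hc cQ; have b : bsupp chi.
    by apply: (C0_bsupp (C_k_continuous (hc 0%N))) => x /cQ; exact: QB.
  by apply: bsuppMl => //; apply: bsuppMl => //; case: b.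
have H1 (chi : plane R -> R) : (forall k, C_k k chi) ->
    (forall x, chi x != 0 -> csq p q r x) ->
    0 <= \int[leb2]_(x in setT) (g x * chi x ^+ 2).
  move=> hc cQ; apply: (@ge0_quadratic _ E) => n.
  rewrite -RintegralZl//; last by apply: bsupp_integrable; exact: bchi.
  have -> : \int[leb2]_(x in setT) (n%:R ^+ 2 * (g x * chi x ^+ 2)) =
      \int[leb2]_(x in setT) (g x * (n%:R * chi x) ^+ 2).
    by apply: eq_Rintegral => x _; rewrite exprMn; ring.
  apply: H => [k|x]; first exact: C_kZ.
  by rewrite mulf_eq0 negb_or => /andP[_ /cQ].
pose W (x : plane R) := expm1V (x.1 - p1) * expm1V (q1 - x.1) *
  (expm1V (x.2 - s1) * expm1V (t1 - x.2)).
have hW k : C_k k W.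
  have flatC (f : plane R -> R) : C_k k f -> C_k k (fun x => expm1V (f x)).
    by move=> hf; exact: (smooth1_comp hf (smooth1_flat 1)).
  have c1 (v : R) : C_k k (fun x : plane R => x.1 - v).
    by apply: C_kB; [exact: C_k_fst|exact: C_k_cst].
  have c2 (v : R) : C_k k (fun x : plane R => v - x.1).
    by apply: C_kB; [exact: C_k_cst|exact: C_k_fst].
  have c3 (v : R) : C_k k (fun x : plane R => x.2 - v).
    by apply: C_kB; [exact: C_k_snd|exact: C_k_cst].
  have c4 (v : R) : C_k k (fun x : plane R => v - x.2).
    by apply: C_kB; [exact: C_k_cst|exact: C_k_snd].
  by apply: C_kM; apply: C_kM; apply: flatC.
have W0 x : 0 <= W x by rewrite !mulr_ge0 ?expm1V_ge0.
have Wgt0 x : (0 < W x) = (x \in rect p1 q1 s1 t1).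
  have -> : (x \in rect p1 q1 s1 t1) = [&& p1 < x.1, x.1 < q1, s1 < x.2 & x.2 < t1].
    by rewrite /rect in_setX !mem_setE !in_itv/= -!andbA.
  have pos (u v : R) : 0 <= u -> 0 <= v -> (0 < u * v) = (0 < u) && (0 < v).
    by move=> u0 v0; rewrite !lt_def mulf_eq0 negb_or mulr_ge0// u0 v0 !andbT.
  by rewrite /W !pos ?mulr_ge0 ?expm1V_ge0// !expm1V_gt0 !subr_gt0 -!andbA.
have Wrect x : W x != 0 -> rect p1 q1 s1 t1 x.
  by move=> Wx; apply/set_mem; rewrite -Wgt0 lt_def Wx W0.
pose chi (n : nat) x := 1 - expR (- n%:R * W x).
have chiE n x : chi n x = 1 - expR (- W x) ^+ n.
  by rewrite /chi mulNr -mulrN expRM_natl.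
have hchi n k : C_k k (chi n).
  by apply: C_kB; [exact: C_k_cst|exact: (smooth1_comp (hW k) (smooth1_expR _))].
have chi_supp n x : chi n x != 0 -> rect p1 q1 s1 t1 x.
  move=> cx; apply: Wrect; apply: contra_neq cx => Wx.
  by rewrite /chi Wx mulr0 expR0 subrr.
have chi01 n x : 0 <= chi n x <= 1.
  rewrite /chi subr_ge0 lerBlDr lerDl expR_ge0 andbT -expR0 ler_expR.
  by rewrite mulNr oppr_le0 mulr_ge0.
rewrite Rintegral_mkcond -[leRHS]add0r.
have [mg [C gC]] := bg.
apply: (@Rintegral_limit_ge _ (fun n x => g x * chi n x ^+ 2) _ (Num.max `|p| `|q| + r) C).
- by move=> n; have [[]] := bchi (chi n) (hchi n) (fun x cx => rQ x (chi_supp n x cx)).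
- by apply/(measurable_restrictT _ (measurable_rect _ _ _ _)); exact: measurable_funTS.
- move=> x; rewrite patchE -Wgt0; case: ifPn => Wx.
    rewrite -[X in _ --> X]mulr1; apply: cvgM; first exact: cvg_cst.
    have : expR (- W x) ^+ n @[n --> \oo] --> (0 : R).
      by apply: cvg_expr; rewrite ger0_norm ?expR_ge0// -expR0 ltr_expR oppr_lt0.
    move=> cv; have cv1 : chi n x @[n --> \oo] --> (1 : R).
      rewrite (_ : (fun n => chi n x) = (fun n => 1 - expR (- W x) ^+ n)).
        by rewrite -[X in _ --> X]subr0; apply: cvgB => //; exact: cvg_cst.
      by apply/funext => n; rewrite chiE.
    by rewrite -[X in _ --> X](mulr1 1); rewrite /GRing.exp/=; apply: cvgM.
  have W00 : W x = 0 by apply/eqP; rewrite eq_le W0 andbT leNgt.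
  rewrite (_ : (fun n => _) = (fun=> 0)); first exact: cvg_cst.
  by apply/funext => n; rewrite chiE W00 oppr0 expR0 expr1n subrr expr0n mulr0.
- move=> n x; rewrite normrM -[leRHS]mulr1 ler_pM//.
  have /andP[c0 c1] := chi01 n x.
  by rewrite ger0_norm ?exprn_ge0// exprn_ile1.
- by move=> n x; rewrite mulf_eq0 negb_or expf_eq0 /= => /andP[_ /chi_supp /rQ /QB].
- move=> n; rewrite add0r; apply: H1 => // x /chi_supp; exact: rQ.
Qed.

Context {m : nat}.
Notation idx := ('I_2 * 'I_2 * ('I_m * 'I_m) * bool)%type.

Lemma square_ae (Omega : set (plane R)) (a : idx -> plane R -> R) (phi : R -> R) (p q r : R) :
  phi_conditions phi -> 0 < r -> csq p q (3 * r) `<=` Omega ->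
  (forall t, bmeas (a t)) ->
  entries_dissipative Omega phi a ->
  {ae @leb2 R, forall z, rect (p - r) (p + r) (q - r) (q + r) z ->
     forall M (omega zeta : 'cV[R[i]]_m) (xi : 'rV[R]_2), 0 < M -> vnorm omega = 1 ->
     0 <= \sum_t coef phi M omega zeta t 0 * (xi 0 t.1.1.2 * xi 0 t.1.1.1) * a t z}.
Proof.
move=> hphi r0 KO ba H.
pose S : set (plane R) := rect (p - r) (p + r) (q - r) (q + r).
have mS : measurable S by exact: measurable_rect.
(* Multiplying by the indicator of the square gives bounded support and lets rational rectangles be
   tested anywhere in the plane. *)
pose f (t : idx) z := a t z * (\1_S z : R).
have SB : S `<=` csq p q r.
  move=> z [/=]; rewrite !in_itv/= => /andP[h1 h2] /andP[h3 h4].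
  by split; rewrite ler_norml; apply/andP; split; lra.
have bS : bsupp (\1_S : plane R -> R).
  split; last first.
    exists (Num.max `|p| `|q| + r) => z; rewrite indicE.
    by have [/set_mem/SB/csq_sqbox//|] := boolP (z \in S); rewrite eqxx.
  split; first exact: measurable_indic.
  by exists 1 => z; rewrite indicE ger0_norm//; case: (_ \in _).
have bf t : bsupp (f t) by exact: bsuppMl.
(* The parameters act on the integrand only through these coefficient vectors, so [ae_ge0_cone]
   yields one null set for all of them. *)
pose G (c : idx -> R) := exists (M : R) (omega zeta : 'cV[R[i]]_m) (xi : 'rV[R]_2),
  [/\ 0 < M, vnorm omega = 1 &
   c = fun t => coef phi M omega zeta t 0 * (xi 0 t.1.1.2 * xi 0 t.1.1.1)].
have : {ae @leb2 R, forall z, forall c, G c -> 0 <= \sum_t c t * f t z}.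
  apply: ae_ge0_cone => // c [M [omega [zeta [xi [M0 w1 ->]]]]] p1 q1 s1 t1.
  have [E0 HE] := energy_bound zeta hphi M0 w1 r0 KO ba H.
  have cc t : continuous (coef phi M omega zeta t) by exact: continuous_coef.
  have osc := oscillation ba cc HE.
  pose g (x : plane R) := \sum_t coef phi M omega zeta t 0 * (xi 0 t.1.1.2 * xi 0 t.1.1.1) * a t x.
  have bg : bmeas g.
    by apply: bmeas_sum => t; apply: bmeasM => //; exact: bmeas_cst.
  have Hg (chi : plane R -> R) : (forall k, C_k k chi) ->
     (forall x, chi x != 0 -> csq p q r x) ->
     0 <= E0 + E0 + \int[leb2]_(x in setT) (g x * chi x ^+ 2).
    move=> hc cQ; have := osc chi xi hc cQ; congr (0 <= _ + _).
    apply: eq_Rintegral => x _; rewrite /g mulr_suml; apply: eq_bigr => t _; ring.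
  (* The intersection of the rational rectangle with the square is again a rectangle, now inside the
     region where test functions are allowed. *)
  pose p' := Num.max (ratr p1) (p - r); pose q' := Num.min (ratr q1) (p + r).
  pose s' := Num.max (ratr s1) (q - r); pose t' := Num.min (ratr t1) (q + r).
  have rE z : rect p' q' s' t' z <-> rect (ratr p1) (ratr q1) (ratr s1) (ratr t1) z /\ S z.
    rewrite /S /rect/= !in_itv/= !gt_max !lt_min; split.
      by move=> [/andP[/andP[-> ->] /andP[-> ->]] /andP[/andP[-> ->] /andP[-> ->]]].
    by move=> [[/andP[-> ->] /andP[-> ->]] [/andP[-> ->] /andP[-> ->]]].
  have rQ : rect p' q' s' t' `<=` csq p q r by move=> z /rE [_ /SB].
  have := rect_integral_ge0 bg Hg rQ; congr (0 <= _).
  rewrite Rintegral_mkcond [RHS]Rintegral_mkcond; apply: eq_Rintegral => z _.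
  rewrite !patchE; have [/set_mem/rE[zr zS]|nz] := boolP (z \in rect p' q' s' t').
    rewrite mem_set//; apply: eq_bigr => t _.
    by rewrite /f indicE mem_set// mulr1.
  case: ifPn => // /set_mem zr; apply/esym/big1 => t _.
  rewrite /f indicE memNset ?mulr0// => zS; move/negP: nz; apply.
  by apply/mem_set/rE.
apply: filterS => z Hz Sz M omega zeta xi M0 w1.
have := Hz (fun t => coef phi M omega zeta t 0 * (xi 0 t.1.1.2 * xi 0 t.1.1.1)).
have -> : \sum_t coef phi M omega zeta t 0 * (xi 0 t.1.1.2 * xi 0 t.1.1.1) * f t z =
   \sum_t coef phi M omega zeta t 0 * (xi 0 t.1.1.2 * xi 0 t.1.1.1) * a t z.
  by apply: eq_bigr => t _; rewrite /f indicE mem_set// mulr1.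
by apply; exists M, omega, zeta, xi.
Qed.

End Localization.

(** * The pointwise inequality *)

Section Algebra.
Context {R : realType} {m : nat}.
Implicit Types (u v w : 'cV[R[i]]_m) (k : R).

Lemma hermDZl u v w k : herm (u + k%:C *: v) w = herm u w + k%:C * herm v w.
Proof.
rewrite /herm mulr_sumr -big_split/=; apply: eq_bigr => i _.
by rewrite !mxE mulrDl mulrA.
Qed.

Lemma hermDZr u v w k : herm w (u + k%:C *: v) = herm w u + k%:C * herm w v.
Proof.
rewrite /herm mulr_sumr -big_split/=; apply: eq_bigr => i _.
rewrite !mxE; case: (w i 0) => w1 w2; case: (u i 0) => u1 u2; case: (v i 0) => v1 v2.
by apply/eqP; rewrite eq_complex/=; apply/andP; split; apply/eqP; ring.
Qed.

Lemma hermZr v w k : herm w (k%:C *: v) = k%:C * herm w v.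
Proof.
rewrite /herm mulr_sumr; apply: eq_bigr => i _.
rewrite !mxE; case: (w i 0) => w1 w2; case: (v i 0) => v1 v2.
by apply/eqP; rewrite eq_complex/=; apply/andP; split; apply/eqP; ring.
Qed.

Lemma hermZl u w k : herm (k%:C *: u) w = k%:C * herm u w.
Proof. by rewrite /herm mulr_sumr; apply: eq_bigr => i _; rewrite mxE mulrA. Qed.

Lemma Re_realM k (x : R[i]) : complex.Re (k%:C * x) = k * complex.Re x.
Proof. by case: x => a b /=; rewrite mul0r subr0. Qed.

(** The covector is moved from the matrix into the two arguments, which then play the part of
    gradients in [Re_sum_herm]. *)
Lemma symbol_mulmx (A : 'I_2 -> 'I_2 -> plane R -> 'M[R[i]]_m) x (xi : 'rV[R]_2) u v :
  complex.Re (herm (symbol A x xi *m u) v) =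
  complex.Re (\sum_(h < 2) \sum_(k < 2)
     herm (A h k x *m ((xi 0 k)%:C *: u)) ((xi 0 h)%:C *: v)).
Proof.
have hermsum (J : Type) (s : seq J) (F : J -> 'M[R[i]]_m) :
    herm ((\sum_(j <- s) F j) *m u) v = \sum_(j <- s) herm (F j *m u) v.
  elim: s => [|j s IH].
    by rewrite !big_nil mul0mx /herm big1// => i _; rewrite mxE mul0r.
  rewrite !big_cons -IH mulmxDl.
  by rewrite /herm -big_split/=; apply: eq_bigr => i _; rewrite mxE mulrDl.
rewrite /symbol hermsum; congr complex.Re; apply: eq_bigr => h _.
rewrite hermsum; apply: eq_bigr => k _.
rewrite -scalemxAl hermZl -scalemxAr hermZl.
rewrite hermZr.
by rewrite rmorphM/= mulrA [(xi 0 h)%:C * _]mulrC.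
Qed.

Lemma bil_scale b k l (p q : R[i]) : bil b (k%:C * p) (l%:C * q) = k * l * bil b p q.
Proof. by case: b p q => -[p1 p2] [q1 q2]; rewrite /bil/=; ring. Qed.

(** At s = 0 the component along omega and the perpendicular one recombine to zeta. The velocities
    are M zeta and M phi(M) (zeta + al b omega), with al the elasticity at M and b =
    Re<zeta,omega>. *)
Lemma sum_coef0 (A : 'I_2 -> 'I_2 -> plane R -> 'M[R[i]]_m) x (xi : 'rV[R]_2)
    (phi : R -> R) (M : R) (omega zeta : 'cV[R[i]]_m) : 0 < M -> 0 < phi M ->
  \sum_t coef phi M omega zeta t 0 * (xi 0 t.1.1.2 * xi 0 t.1.1.1) * entry A t x =
  M ^+ 2 * phi M * complex.Re (herm (symbol A x xi *m zeta)
    (zeta + (elasticity phi M * rdot zeta omega)%:C *: omega)).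
Proof.
move=> M0 p0; set b := rdot zeta omega; set al := elasticity phi M.
rewrite symbol_mulmx (Re_sum_herm A x (fun j : 'I_2 => (xi 0 j)%:C *: zeta)
  (fun h => (xi 0 h)%:C *: (zeta + (al * b)%:C *: omega))) mulr_sumr.
apply: eq_bigr => t _ /=.
have scE (l : R) (u : 'cV[R[i]]_m) i : (l%:C *: u) i 0 = l%:C * u i 0 by rewrite mxE.
rewrite !scE bil_scale.
have -> : coef phi M omega zeta t 0 = M ^+ 2 * phi M *
    bil t.2 (zeta t.1.2.2 0) ((zeta + (al * b)%:C *: omega) t.1.2.1 0).
  rewrite /coef -/b !dcurve0 !dpcurve0 /perp !mxE -/b !Re_subc !Im_subc !Re_mulc !Im_mulc.
  have -> : derive1 phi M = al * phi M / M.
    by rewrite /al /elasticity; field; rewrite !lt0r_neq0.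
  rewrite /bil; case: (zeta t.1.2.2 0) => z1 z2; case: (omega t.1.2.2 0) => w1 w2.
  case: (zeta t.1.2.1 0) => z3 z4; case: (omega t.1.2.1 0) => w3 w4 /=.
  by case: t.2; field; rewrite lt0r_neq0.
by ring.
Qed.

(* With zeta = eta + L s omega, where s = Re<eta,omega>, |omega| = 1 and
   L = - al/(al + 2), one has zeta + al Re<zeta,omega> omega = eta - L s omega. *)
Lemma form_substitution (S : 'M[R[i]]_m) (eta omega : 'cV[R[i]]_m) (al : R) :
  rdot omega omega = 1 -> 0 < al + 2 ->
  let L := - (al / (al + 2)) in let s := rdot eta omega in
  let zeta := eta + (L * s)%:C *: omega in
  complex.Re (herm (S *m zeta) (zeta + (al * rdot zeta omega)%:C *: omega)) =
  complex.Re (herm (S *m eta) eta)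
  - L ^+ 2 * (complex.Re (herm (S *m omega) omega) * s ^+ 2)
  + L * ((complex.Re (herm (S *m omega) eta) - complex.Re (herm (S *m eta) omega)) * s).
Proof.
move=> ww al2 L s zeta.
have -> : rdot zeta omega = (1 + L) * s.
  by rewrite /rdot /zeta hermDZl raddfD/= Re_realM -/(rdot omega omega) ww -/(rdot eta omega) -/s; ring.
have -> : zeta + (al * ((1 + L) * s))%:C *: omega = eta + (- (L * s))%:C *: omega.
  rewrite /zeta -addrA -scalerDl -rmorphD/=; congr (_ + (_)%:C *: _).
  by rewrite /L; field; rewrite lt0r_neq0.
rewrite mulmxDr -scalemxAr hermDZl !hermDZr !raddfD/= !Re_realM raddfD/= !Re_realM.
by ring.
Qed.

End Algebra.

Theorem theorem1 (R : realType) (m : nat) (Omega : set (plane R))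
    (A : 'I_2 -> 'I_2 -> plane R -> 'M[R[i]]_m) (phi : R -> R)
    (hOmega : domain2 Omega)
    (hA : forall h k i j, in_Lp Omega +oo%E (fun x => A h k x i j))
    (hphi : phi_conditions phi)
    (hdiss : LPhi_dissipative Omega A phi) :
  {ae @leb2 R, forall x, Omega x ->
    forall (xi : 'rV[R]_2) (eta omega : 'cV[R[i]]_m), vnorm omega = 1 ->
      0 <= complex.Re
        (herm (symbol A x xi *m eta) eta
         - (Lambda_infty phi ^+ 2)%:C * herm (symbol A x xi *m omega) omega
             * (complex.Re (herm eta omega) ^+ 2)%:C
         + (Lambda_infty phi)%:C
             * (herm (symbol A x xi *m omega) eta
                - herm (symbol A x xi *m eta) omega)
             * (complex.Re (herm eta omega))%:C)}.
Proof.
have [_ oO _] := hOmega.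
have [a [ba aE Ha]] := dissipative_entries oO hA hdiss.
(* The squares with rational centres and half-sides 1/(n+1) are countably many, and those whose
   threefold enlargement stays in Omega cover Omega. *)
have all_sq : {ae @leb2 R, forall z, forall i : rat * rat * nat,
    csq (ratr i.1.1) (ratr i.1.2) (3 * i.2.+1%:R^-1) `<=` Omega ->
    rect (ratr i.1.1 - i.2.+1%:R^-1) (ratr i.1.1 + i.2.+1%:R^-1)
         (ratr i.1.2 - i.2.+1%:R^-1) (ratr i.1.2 + i.2.+1%:R^-1) z ->
    forall M (omega zeta : 'cV[R[i]]_m) (xi : 'rV[R]_2), 0 < M -> vnorm omega = 1 ->
     0 <= \sum_t coef phi M omega zeta t 0 * (xi 0 t.1.1.2 * xi 0 t.1.1.1) * a t z}.
  apply: ae_forall_count => -[[p q] n] /=.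
  have [KO|nKO] := pselect (csq (ratr p) (ratr q) (3 * n.+1%:R^-1) `<=` Omega); last first.
    by apply: aeW => z /nKO.
  have r0 : 0 < n.+1%:R^-1 :> R by rewrite invr_gt0 ltr0n.
  by apply: filterS (square_ae hphi r0 KO ba Ha) => z Hz _.
apply: filterS2 aE all_sq => z az Hz Oz xi eta omega w1.
have good M zeta : 0 < M ->
    0 <= \sum_t coef phi M omega zeta t 0 * (xi 0 t.1.1.2 * xi 0 t.1.1.1) * a t z.
  move=> M0; move: (oO); rewrite openE => /(_ _ Oz) /nbhs_ballP[e /= e0 He].
  (* The enlarged square has half-side 3/(n+1) and its centre is within 1/(n+1) of z, so all its
     points are closer than 4/(n+1) < e to z. *)
  have [n _ /(_ n.+1 (leqnSn n)) Hn] := nbhs_infty_gtr (4 / e).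
  have n0 : 0 < n.+1%:R^-1 :> R by rewrite invr_gt0 ltr0n.
  have ne : n.+1%:R^-1 < e / 4.
    by rewrite -[ltRHS]invrK ltf_pV2 ?posrE ?ltr0n ?invr_gt0 ?divr_gt0// invf_div.
  have [p Hp] := ratr_close z.1 n0; have [q Hq] := ratr_close z.2 n0.
  apply: (Hz (p, q, n)) => //=.
    move=> v [/=]; move: (n.+1%:R^-1) n0 ne Hp Hq => d n0 ne Hp Hq v1 v2.
    apply: He; split; rewrite /ball/=.
      rewrite -(subrKA (ratr p)) (le_lt_trans (ler_normD _ _))//.
      rewrite distrC in Hp; rewrite distrC in v1; lra.
    rewrite -(subrKA (ratr q)) (le_lt_trans (ler_normD _ _))//.
    rewrite distrC in Hq; rewrite distrC in v2; lra.
  move: (n.+1%:R^-1) Hp Hq => d; rewrite !ltr_norml => /andP[? ?] /andP[? ?].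
  by split; rewrite /= in_itv/=; apply/andP; split; lra.
have ww := rdot_vnorm1 w1.
pose S := symbol A z xi; pose s := rdot eta omega.
(* As a polynomial in L the form is continuous, so nonnegativity passes to the limit of Lambda. *)
pose Q (L : R) := complex.Re (herm (S *m eta) eta)
  - L ^+ 2 * (complex.Re (herm (S *m omega) omega) * s ^+ 2)
  + L * ((complex.Re (herm (S *m omega) eta) - complex.Re (herm (S *m eta) omega)) * s).
have QL t : 0 < t -> 0 <= Q (Lambda phi t).
  move=> t0; have [M M0 [_ ->]] := Lambda_val hphi t0.
  have p0 := phi_gt0 hphi M0.
  have al2 : 0 < elasticity phi M + 2 by have := elasticity_gtN1 hphi M0; lra.
  rewrite /Q -form_substitution//; set zeta := eta + _.
  have := good M zeta M0.
  (* At this z the truncated coefficients are the true entries of A; the positive factor M^2 phi(M)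
     is then divided out. *)
  rewrite (eq_bigr (fun t => coef phi M omega zeta t 0 * (xi 0 t.1.1.2 * xi 0 t.1.1.1) * entry A t z)).
    by rewrite sum_coef0// pmulr_rge0// mulr_gt0// exprn_gt0.
  by move=> t' _; rewrite az.
have cQ : Q (Lambda phi t) @[t --> +oo%R] --> Q (Lambda_infty phi).
  have cv := Lambda_cvg hphi.
  apply: cvgD; first apply: cvgB; first exact: cvg_cst.
    apply: cvgM; last exact: cvg_cst.
    by rewrite !expr2; apply: cvgM.
  by apply: cvgM => //; exact: cvg_cst.
have : 0 <= Q (Lambda_infty phi).
  apply: (cvgr_to_ge cQ).
  near=> t; apply: QL; near: t; apply: nbhs_pinfty_gt; rewrite num_real//.
congr (0 <= _); rewrite /Q /s /rdot.
set x1 := herm _ eta; set x2 := herm _ omega; set x3 := herm _ eta; set x4 := herm _ omega.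
rewrite raddfD/= raddfB/= ![_ * (_)%:C]mulrC !Re_realM raddfB/=.
ring.
Unshelve. all: by end_near. Qed.
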